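(* There is an absolute constant $C$ such that the following holds. Let $N\ge 3$, $n\ge 21$, $\epsilon>0$. The algorithm $\mathrm{PMWG}(X,F,\epsilon,0,\alpha,n)$ is $(\epsilon,0)$-differentially private, and for any $\kappa\ge1$ and $\beta>0$ it is $(\alpha,\beta)$-accurate for every (adaptively chosen) query stream $F$ satisfying $\sum_{\tau=n}^t\ell_\tau\le\kappa\sum_{\tau=n}^t\exp\!\big(\frac{\alpha^3\epsilon\sqrt{n\tau}}{C\log(Nn)}\big)$ for all $t\ge n$, as long as $$\alpha\ge C\left(\frac{\log(Nn)\log(\kappa n/\beta)}{n\epsilon}\right)^{1/3}.$$
   Context: Data universe $[N]$. A database of size $t$ is a histogram $x\in\Delta([N])\subseteq\mathbb R^N$ with $x^i=n_i/t$, $n_i\in\mathbb N$, $\sum_i n_i=t$; same-size databases are neighboring if they differ in one entry. A linear query is $f\in[0,1]^N$ with $f(x)=\langle f,x\rangle$ (so $f$ has sensitivity $1/t$ on databases of size $t$). A database stream $X=\{x_t\}_{t\ge n}$ has $x_t$ of size $t$, $x_{t+1}$ obtained from $x_t$ by adding one entry; streams $X,X'$ are neighboring if for some $t\ge n$, $x_\tau=x'_\tau$ for $n\le\tau<t$ and $x_\tau,x'_\tau$ neighboring for $\tau\ge t$. A query stream $F=\{\{f_{t,j}\}_{j=1}^{\ell_t}\}_{t\ge n}$ of linear queries, $f_{t,j}$ arriving when the database has size $t$, may be chosen adaptively. An algorithm is $(\epsilon,\delta)$-differentially private if for all neighboring streams and every set $S$ of output transcripts, $\Pr[\mathcal A(X)\in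 S]\le e^\epsilon\Pr[\mathcal A(X')\in S]+\delta$. It is $(\alpha,\beta)$-accurate for $F$ if for every database stream, with probability at least $1-\beta$, every query $f_{t,j}$ receives an answer $a_{t,j}$ with $|f_{t,j}(x_t)-a_{t,j}|\le\alpha$. $\mathrm{Lap}(b)$ has density $\frac1{2b}e^{-|z|/b}$. Subroutines (threshold $T$, noise function $\xi$, on the database stream). NATG: when started it draws $\eta\sim\mathrm{Lap}(2)$; on each subsequent query $g$ arriving at time $t$ it draws fresh $\nu\sim\mathrm{Lap}(4/\xi_t)$; if $g(x_t)+\nu\ge T+\eta/\xi_t$ it outputs $g(x_t)+Z$, $Z\sim\mathrm{Lap}(8/\xi_t)$ fresh, and halts; otherwise outputs $\bot$. NSG: processes queries in order; whenever a query arrives and no NATG instance is running, it starts a fresh NATG instance with the same $T,\xi$; it outputs the running instance's answer. $\mathrm{PMWG}(X,F,\epsilon,\delta,\alpha,n)$: set $\xi_t=\frac{\alpha^2n^{1/2}}{162\log(Nn)}\epsilon t^{1/2}$ if $\delta=0$, and $\xi_t=\frac{\alpha n^{1/2}}{48\log^{1/2}(Nn)\log^{1/2}(1/\delta)}\epsilon t^{1/2}$ if $\delta>0$. Run NSG with $T=2\alpha/3$ and noise $\xi$. Maintain a public histogram $y$, initially $y^i=1/N$, and a hard-query count $H=0$; let $b_t=\frac{\log N}{t}+\frac{\log(t-1)}{t}+\log\frac{t}{t-1}$. On query $f=f_{t,j}$: (1) if the previous query arrived at time $t'<t$, set $y^i\leftarrow\frac{t'}{t}y^i+\frac{t-t'}{t}\cdot\frac1N$;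 (2) submit to NSG the queries $g_1(x)=f(x)-f(y)$ and $g_2(x)=f(y)-f(x)$, getting $a_1,a_2\in\mathbb R\cup\{\bot\}$; (3) if $a_1=a_2=\bot$, output $f(y)$; (4) otherwise set $H\leftarrow H+1$; if $H>\frac{36}{\alpha^2}(\log N+\sum_{\tau=n+1}^t b_\tau)$ halt with output $\bot$; else output $a=f(y)+a_1$ if $a_1\in\mathbb R$ and $a=f(y)-a_2$ otherwise; let $r=f$ if $a<f(y)$ and $r=1-f$ otherwise, and update $y^i\leftarrow y^i e^{-\alpha r^i/6}/\sum_{i'}y^{i'}e^{-\alpha r^{i'}/6}$.
   Formalization: Privacy is claimed for 0 < α ≤ 1 only (accuracy for all α > 0): with no upper bound on α it fails, e.g. N=3, n=21, ε=1, α=100, where the first hard query halts and the halting probability can change by about e^{3.7} between neighboring streams. *)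

(* Defs.v *)
From HB Require Import structures.
From mathcomp Require Import all_boot all_order all_algebra finmap.
From mathcomp Require Import all_classical all_reals all_analysis.

Set Implicit Arguments.
Unset Strict Implicit.
Unset Printing Implicit Defensive.
Import Order.TTheory GRing.Theory Num.Theory.
Local Open Scope classical_set_scope.
Local Open Scope ring_scope.

(* ---- Databases ---- *)

(* A database is given by its counts n_i; its histogram is x^i = n_i / t. *)
Record db_stream (N n : nat) := DbStream {
  counts : nat -> 'I_N -> nat;
  counts_size : forall t, (n <= t)%N -> (\sum_i counts t i)%N = t;
  counts_grow : forall t, (n <= t)%N ->
    exists i, forall j, counts t.+1 j = (counts t j + (j == i))%N }.

Definition histogram (R : realType) (N n : nat) (X : db_stream N n) (t : nat)
  : 'I_N -> R := fun i => (counts X t i)%:R / t%:R.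

(* [c'] is [c] with one entry of type [i] replaced by one of type [j]. *)
Definition neighboring_db (N : nat) (c c' : 'I_N -> nat) :=
  exists i j, i != j /\
    forall k, (c k + (k == j))%N = (c' k + (k == i))%N.

Definition neighboring (N n : nat) (X X' : db_stream N n) :=
  exists t, [/\ (n <= t)%N,
    (forall tau, (n <= tau < t)%N -> counts X tau =1 counts X' tau) &
    (forall tau, (t <= tau)%N -> neighboring_db (counts X tau) (counts X' tau))].

(* ---- Linear queries and adaptive query streams ---- *)

Definition eval (R : realType) (N : nat) (f x : 'I_N -> R) : R :=
  \sum_i f i * x i.

(* The analyst sees the list [h] of the answers received so far and decides on
   the next query: [qtime h] is the database size at which it arrives ([None]
   if there are no further queries) and [qry h] is the query itself.  Both the
   queries and the numbers l_t of queries per time step are thus adaptive. *)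
Record query_stream (R : realType) (N n : nat) := QueryStream {
  qtime : seq R -> option nat;
  qry : seq R -> 'I_N -> R;
  qry_itv : forall h i, 0 <= qry h i <= 1;
  qtime_ge : forall h t, qtime h = Some t -> (n <= t)%N;
  qtime_mono : forall h a t', qtime (rcons h a) = Some t' ->
    exists2 t, qtime h = Some t & (t <= t')%N;
  qtime_finite : forall (a : nat -> R) t,
    finite_set [set k | qtime (mkseq a k) = Some t];
  qtime_measurable : forall k t,
    measurable [set h : k.-tuple R | qtime h = Some t];
  qry_measurable : forall k i,
    measurable_fun setT (fun h : k.-tuple R => qry h i) }.

(* l_t, when the successive answers are a 0, a 1, a 2, and so on *)
Definition ell (R : realType) (N n : nat) (F : query_stream R N n)
    (a : nat -> R) (t : nat) : nat :=
  #|` fset_set [set k | qtime F (mkseq a k) = Some t]|.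

(* ---- Output transcripts, privacy and accuracy ---- *)

(* [Bot] is the halting symbol; [NoOutput] marks the steps after the algorithm
   has halted or after the last query. *)
Inductive output (R : Type) := Ans of R | Bot | NoOutput.
Arguments Bot {R}.
Arguments NoOutput {R}.

(* Step k of a transcript is the output on the k-th query (k = 0, 1, ...). *)
Definition transcript (R : Type) := nat -> output R.

(* the product sigma-algebra on transcripts, [output R] being R plus two
   isolated points *)
Definition measurable_transcripts (R : realType) : set (set (transcript R)) :=
  <<s [set C | exists k (B : set (output R)),
         measurable ([set a | B (Ans a)] : set R) /\ C = [set T | B (T k)] ] >>.

Definition answers (R : Type) (T : transcript R) (k : nat) : seq R :=
  pmap (fun j => if T j is Ans a then Some a else None) (iota 0 k).

(* a randomized algorithm, as a function of its random source in Omega *)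
Definition mechanism (R : realType) (N n : nat) (Omega : Type) :=
  db_stream N n -> query_stream R N n -> Omega -> transcript R.

Definition differentially_private (R : realType) (N n : nat)
    (d : measure_display) (Omega : measurableType d) (P : probability Omega R)
    (eps delta : R) (M : mechanism R N n Omega) :=
  forall (F : query_stream R N n) (X X' : db_stream N n), neighboring X X' ->
  forall S, measurable_transcripts S ->
  (P [set w | S (M X F w)]
     <= (expR eps)%:E * P [set w | S (M X' F w)] + delta%:E)%E.

Definition all_accurate (R : realType) (N n : nat) (alpha : R)
    (X : db_stream N n) (F : query_stream R N n) (T : transcript R) :=
  forall k t, qtime F (answers T k) = Some t ->
  exists2 a, T k = Ans a &
    `|eval (qry F (answers T k)) (histogram R X t) - a| <= alpha.

Definition accurate (R : realType) (N n : nat)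
    (d : measure_display) (Omega : measurableType d) (P : probability Omega R)
    (alpha beta : R) (M : mechanism R N n Omega) (F : query_stream R N n) :=
  forall X : db_stream N n,
  ((1 - beta)%:E <= P [set w | all_accurate alpha X F (M X F w)])%E.

(* ---- Noise ---- *)

Definition laplace_pdf (R : realType) (b z : R) : R :=
  (2 * b)^-1 * expR (- `|z| / b).

Definition has_laplace_law (R : realType) (d : measure_display)
    (Omega : measurableType d) (P : probability Omega R)
    (b : R) (V : {RV P >-> R}) :=
  forall A : set R, measurable A ->
  distribution P V A = (\int[lebesgue_measure]_(z in A) (laplace_pdf b z)%:E)%E.

Definition mutually_independent (R : realType) (d : measure_display)
    (Omega : measurableType d) (P : probability Omega R)
    (I : Type) (V : I -> {RV P >-> R}) :=
  forall (m : nat) (e : 'I_m -> I) (A : 'I_m -> set R), injective e ->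
  (forall j, measurable (A j)) ->
  (P (\bigcap_j (V (e j) @^-1` A j))
     = \prod_(j < m) P (V (e j) @^-1` A j))%E.

(* The random draws attached to the m-th query submitted to NSG: the threshold
   noise eta of an NATG instance started on it, nu, and Z. *)
Inductive draw := DrawEta of nat | DrawNu of nat | DrawZ of nat.

(* The random source of the algorithm is an i.i.d. family of Lap(1) draws. *)
Definition laplace_source (R : realType) (d : measure_display)
    (Omega : measurableType d) (P : probability Omega R)
    (W : draw -> {RV P >-> R}) :=
  mutually_independent W /\ forall i, has_laplace_law 1 (W i).

(* b times a Lap(1) variable is a Lap(b) variable *)
Definition lap (R : realType) (b u : R) : R := b * u.

(* ---- Subroutines (xi stands for the current value xi_t) ---- *)

Definition natg (R : realType) (H : Type) (T xi eta nu z : R) (x : H)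
    (g : H -> R) : option R :=
  if T + eta / xi <= g x + nu then Some (g x + z) else None.

(* The state of NSG is the threshold noise of the running NATG instance, if
   any; [m] is the number of the submitted query and [u] the random source. *)
Definition nsg (R : realType) (H : Type) (T xi : R) (u : draw -> R) (x : H)
    (m : nat) (st : option R) (g : H -> R) : option R * option R :=
  let eta := if st is Some e then e else lap 2 (u (DrawEta m)) in
  let a := natg T xi eta (lap (4 / xi) (u (DrawNu m)))
             (lap (8 / xi) (u (DrawZ m))) x g in
  (a, if a is Some _ then None else Some eta).

(* ---- Private multiplicative weights for growing databases ---- *)

Definition pmwg_xi (R : realType) (N n : nat) (eps delta alpha : R) (t : nat)
  : R :=
  if delta == 0 then
    alpha ^+ 2 * Num.sqrt n%:R / (162 * ln (N * n)%:R) * eps * Num.sqrt t%:R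
  else
    alpha * Num.sqrt n%:R
      / (48 * Num.sqrt (ln (N * n)%:R) * Num.sqrt (ln (1 / delta)))
      * eps * Num.sqrt t%:R.

Definition pmwg_b (R : realType) (N t : nat) : R :=
  ln N%:R / t%:R + ln (t%:R - 1) / t%:R + ln (t%:R / (t%:R - 1)).

Definition pmwg_max_hard (R : realType) (N n : nat) (alpha : R) (t : nat) : R :=
  36 / alpha ^+ 2 * (ln N%:R + \sum_(n.+1 <= tau < t.+1) pmwg_b R N tau).

Record pmwg_state (R : realType) (N : nat) := PmwgState {
  st_answers : seq R;           (* the answers output so far *)
  st_y : 'I_N -> R;             (* the public histogram y *)
  st_hard : nat;                (* the hard-query count H *)
  st_last : option nat;         (* the arrival time of the previous query *)
  st_nsg : option R }.

Definition pmwg_init (R : realType) (N : nat) : pmwg_state R N :=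
  PmwgState [::] (fun=> N%:R^-1) 0 None None.

Definition pmwg_mix (R : realType) (N : nat) (last : option nat) (t : nat)
    (y : 'I_N -> R) : 'I_N -> R :=
  if last is Some t' then
    if (t' < t)%N then
      fun i => t'%:R / t%:R * y i + (t - t')%:R / t%:R * N%:R^-1
    else y
  else y.

Definition mw_update (R : realType) (N : nat) (alpha : R) (r y : 'I_N -> R)
  : 'I_N -> R :=
  fun i => y i * expR (- (alpha * r i / 6))
             / \sum_j y j * expR (- (alpha * r j / 6)).

(* The k-th query f, arriving at time t, is submitted to NSG as the queries
   number 2k and 2k+1.  The new state is [None] if the algorithm halts. *)
Definition pmwg_query (R : realType) (N n : nat) (eps delta alpha : R)
    (u : draw -> R) (X : db_stream N n) (k t : nat) (f : 'I_N -> R)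
    (s : pmwg_state R N) : output R * option (pmwg_state R N) :=
  let x := histogram R X t in
  let xi := pmwg_xi N n eps delta alpha t in
  let T := 2 * alpha / 3 in
  let y := pmwg_mix (st_last s) t (st_y s) in
  let: (a1, nsg1) :=
    nsg T xi u x k.*2 (st_nsg s) (fun x => eval f x - eval f y) in
  let: (a2, nsg2) :=
    nsg T xi u x k.*2.+1 nsg1 (fun x => eval f y - eval f x) in
  let easy a :=
    (Ans a, Some (PmwgState (rcons (st_answers s) a) y (st_hard s)
                    (Some t) nsg2)) in
  let hard a :=
    let H := (st_hard s).+1 in
    if pmwg_max_hard N n alpha t < H%:R then (Bot, None)
    else
      let r := if a < eval f y then f else (fun i => 1 - f i) in
      (Ans a, Some (PmwgState (rcons (st_answers s) a) (mw_update alpha r y) H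
                      (Some t) nsg2)) in
  match a1, a2 with
  | None, None => easy (eval f y)
  | Some a, _ => hard (eval f y + a)
  | None, Some a => hard (eval f y - a)
  end.

Definition pmwg_step (R : realType) (N n : nat) (eps delta alpha : R)
    (u : draw -> R) (X : db_stream N n) (F : query_stream R N n) (k : nat)
    (so : option (pmwg_state R N)) : output R * option (pmwg_state R N) :=
  if so is Some s then
    if qtime F (st_answers s) is Some t then
      pmwg_query eps delta alpha u X k t (qry F (st_answers s)) s
    else (NoOutput, None)
  else (NoOutput, None).

(* the state before the k-th query; [None] once the run is over *)
Fixpoint pmwg_run (R : realType) (N n : nat) (eps delta alpha : R)
    (u : draw -> R) (X : db_stream N n) (F : query_stream R N n) (k : nat)
  : option (pmwg_state R N) :=
  if k is k'.+1 then
    (pmwg_step eps delta alpha u X F k'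
       (pmwg_run eps delta alpha u X F k')).2
  else Some (pmwg_init R N).

Definition pmwg (R : realType) (N n : nat) (eps delta alpha : R)
    (d : measure_display) (Omega : measurableType d) (P : probability Omega R)
    (W : draw -> {RV P >-> R}) : mechanism R N n Omega :=
  fun X F w k =>
    let u := fun i => W i w in
    (pmwg_step eps delta alpha u X F k
       (pmwg_run eps delta alpha u X F k)).1.

(* Main.v *)
Require Import Defs.
From HB Require Import structures.
From mathcomp Require Import all_boot all_order all_algebra finmap.
From mathcomp Require Import all_classical all_reals all_analysis.
From mathcomp Require Import measurable_realfun ring lra.

Set Implicit Arguments.
Unset Strict Implicit.
Unset Printing Implicit Defensive.
Import Order.TTheory GRing.Theory Num.Theory.
Local Open Scope classical_set_scope.
Local Open Scope ring_scope.

(* Privacy. All of the state of PMWG is a function of the transcript, except for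
   the threshold noise of the running NATG instance. On neighboring streams the
   values f(x_t) differ by at most 1/t, so the runs on X and X' are compared by
   shifting that noise by c, where c = xi_s/s for the time s at which the instance
   was started (xi_t/t decreases, so c dominates all later differences). With this
   shift an easy query costs nothing, and a hard query at time t multiplies the
   likelihood ratio by at most exp(c/4 + 23/24 xi_t/t); when the first of the two
   NSG calls fires, the hidden answer of the second one only enters through the law
   of the noise left running. As at most 36/alpha^2 (log N + b_(n+1) + ... + b_t)
   hard queries are answered up to time t, these costs add up to at most eps. This
   gives the inequality for events depending on finitely many outputs, and the
   monotone class theorem extends it to all measurable sets of transcripts.

   Accuracy. With probability 1 - beta the j-th draw is at most
   log(2 (j+1)^2 / beta) in absolute value for all j. By the assumptions on alpha
   and on the number of queries this is at most xi_t alpha/48 for the draws used at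
   time t, so that easy answers are accurate and hard queries have error at least
   alpha/3 with the observed sign. Hence each hard query decreases the relative
   entropy of x_t with respect to y by alpha^2/36, whereas a time step increases it
   by at most b_t, so that the bound on the number of hard queries is never hit. *)

(** The privacy constants leave almost no room: for [N = 3], [n = 21], [alpha = 1] the bound on the
    total loss is within a tenth of a percent of [eps]. The delicate point is the hidden second
    comparison. After the first call fires, the noise [e] left running was either kept or redrawn,
    and its density relative to Lap(2) is [mixw D (D + e)], with [D] the scaled threshold of the
    second call. A change of [D] by c' alone may change this weight by the factor exp(c'/4); a hard
    query would then cost 33/24 instead of 29/24 times xi_t/t, and the bound would fail. But the
    shift of the noise also moves [D + e], at least twice as far as [D] when [D] grows, and this
    acts in the opposite direction. It reduces c'/4 to c'/12, and with the c'/2 for the shifted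
    noise itself the cost is 7c'/12. One shift serves an instance at all times because the
    comparisons are multiplied by xi_t: the threshold noise then enters unscaled, and only the query
    values, which differ by at most 1/t, carry the factor xi_t. *)

Local Notation eval := Defs.eval.

(** * Translation invariance of Lebesgue measure and of its integrals *)

Lemma lebesgue_measure_shift (R : realType) (s : R) (A : set R) : measurable A ->
  pushforward lebesgue_measure ((fun x => x + s) : _ -> measurableTypeR R) A
  = lebesgue_measure A.
Proof.
move=> mA.
have ms : measurable_fun [set: measurableTypeR R]
    ((fun x => x + s) : measurableTypeR R -> measurableTypeR R).
  by apply: measurable_funD => //; exact: measurable_cst.
pose h : {mfun measurableTypeR R >-> measurableTypeR R} :=
  HB.pack ((fun x => x + s) : measurableTypeR R -> measurableTypeR R)
    (isMeasurableFun.Build _ _ _ _ _ ms).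
apply/esym; pose m := pushforward (@lebesgue_measure R) h.
apply: (@lebesgue_measure_unique R m) => //= _ [[a b]] _ <-; rewrite /m.
rewrite /pushforward/=.
have -> : (fun x => x + s) @^-1` `]a, b]%classic = `]a - s, b - s]%classic.
  by apply/seteqP; split=> x /=; rewrite !in_itv/= ltrBlDr lerBrDr.
rewrite !lebesgue_measure_itv/= !lte_fin ltrD2r.
by case: ifPn => // _; rewrite -EFinB; congr EFin; lra.
Qed.

Lemma ge0_integral_lebesgue_shift (R : realType) (s : R) (f : R -> \bar R) :
  measurable_fun setT f -> (forall x, 0 <= f x)%E ->
  (\int[lebesgue_measure]_x f (x + s)%R = \int[lebesgue_measure]_x f x)%E.
Proof.
move=> mf f0.
have ms : measurable_fun [set: measurableTypeR R]
    ((fun x => x + s) : measurableTypeR R -> measurableTypeR R).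
  by apply: measurable_funD => //; exact: measurable_cst.
have := @ge0_integral_pushforward _ _ _ _ R _ ms lebesgue_measure setT f
  measurableT mf (fun x _ => f0 x).
rewrite preimage_setT => <-.
by apply: eq_measure_integral => //= A mA _; exact: lebesgue_measure_shift.
Qed.

(* The library's Lebesgue measure lives on the copy [measurableTypeR R] of [R];
   this is the same measure on [R] itself, where random variables take values. *)
Definition lebesgueR (R : realType) : set R -> \bar R := @lebesgue_measure R.

Section lebesgueR.
Context (R : realType).

Let lebesgueR0 : @lebesgueR R set0 = 0%E. Proof. exact: measure0. Qed.
Let lebesgueR_ge0 A : (0 <= @lebesgueR R A)%E. Proof. exact: measure_ge0. Qed.
Let lebesgueR_sigma : semi_sigma_additive (@lebesgueR R).
Proof. exact: (@measure_semi_sigma_additive _ _ _ (@lebesgue_measure R)). Qed.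

HB.instance Definition _ := isMeasure.Build _ _ _ (@lebesgueR R)
  lebesgueR0 lebesgueR_ge0 lebesgueR_sigma.

End lebesgueR.

Lemma integral_lebesgueR (R : realType) (A : set R) (f : R -> \bar R) :
  measurable A -> measurable_fun A f -> (forall x, 0 <= f x)%E ->
  (\int[@lebesgueR R]_(x in A) f x = \int[lebesgue_measure]_(x in A) f x)%E.
Proof.
move=> mA mf f0.
have mid : measurable_fun [set: R] (id : R -> measurableTypeR R).
  exact: (@measurable_id _ R setT).
by rewrite -(@ge0_integral_pushforward _ _ R (measurableTypeR R) R id mid
  (@lebesgueR R) A f mA mf (fun x _ => f0 x)).
Qed.

Lemma ge0_integral_shift (R : realType) (s : R) (f : R -> \bar R) :
  measurable_fun setT f -> (forall x, 0 <= f x)%E ->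
  (\int[@lebesgueR R]_x f (x + s)%R = \int[@lebesgueR R]_x f x)%E.
Proof.
move=> mf f0; rewrite !integral_lebesgueR//; first exact: ge0_integral_lebesgue_shift.
apply: measurableT_comp => //.
by apply: measurable_funD => //; exact: measurable_cst.
Qed.

(** * The Laplace law: density formula, shifts and tails *)

Section laplace.
Context (R : realType) (mu : probability R R).
Hypothesis mu_laplace : forall A : set R, measurable A ->
  mu A = (\int[lebesgue_measure]_(z in A) (laplace_pdf 1 z)%:E)%E.
Let pdf : R -> R := @laplace_pdf R 1.

Lemma laplace_pdfE (z : R) : pdf z = 2^-1 * expR (- `|z|).
Proof. by rewrite /pdf/laplace_pdf mulr1 divr1. Qed.

Lemma laplace_pdf_ge0 z : 0 <= pdf z.
Proof. by rewrite laplace_pdfE mulr_ge0 ?expR_ge0 ?invr_ge0. Qed.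

Lemma measurable_laplace_pdf : measurable_fun setT pdf.
Proof.
rewrite (_ : pdf = fun z => 2^-1 * expR (- `|z|)); last first.
  by apply/funext => z; exact: laplace_pdfE.
apply: measurable_funM => //; apply: measurableT_comp => //.
by apply: measurableT_comp => //; exact: measurableT_comp.
Qed.

Import HBNNSimple.

(** The law is given only by its values on sets; monotone approximation by simple functions lifts
    the density formula to nonnegative functions. *)
Lemma ge0_integral_laplace (f : R -> \bar R) :
  measurable_fun setT f -> (forall x, 0 <= f x)%E ->
  (\int[mu]_x f x = \int[@lebesgueR R]_x (f x * (pdf x)%:E))%E.
Proof.
move=> mf f0.
have mpdf : measurable_fun setT (EFin \o pdf).
  by apply/measurable_EFinP; exact: measurable_laplace_pdf.
pose f_ := nnsfun_approx measurableT mf.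
have fcvg x : (EFin \o f_ ^~ x) @ \oo --> f x.
  by apply: cvg_nnsfun_approx.
transitivity (limn (fun n => \int[mu]_x (f_ n x)%:E))%E.
  rewrite -monotone_convergence//.
  - by apply: eq_integral => y _; apply/esym/cvg_lim => //; exact: fcvg.
  - by move=> n; exact/measurable_EFinP/measurable_funP.
  - by move=> n y _; rewrite lee_fin.
  - by move=> y _ m n mn; rewrite lee_fin; exact/lefP/nd_nnsfun_approx.
transitivity (limn (fun n => \int[@lebesgueR R]_x ((f_ n x)%:E * (pdf x)%:E)))%E;
  last first.
  rewrite -monotone_convergence//.
  - apply: eq_integral => y _; apply/cvg_lim => //.
    apply: cvgeZr => //; exact: fcvg.
  - by move=> n; apply: emeasurable_funM => //; exact/measurable_EFinP/measurable_funP.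
  - by move=> n y _; rewrite mule_ge0// lee_fin// laplace_pdf_ge0.
  - move=> y _ m n mn; rewrite lee_wpmul2r ?lee_fin ?laplace_pdf_ge0//.
    exact/lefP/nd_nnsfun_approx.
congr (limn _); apply/funext => n.
under eq_integral do rewrite fimfunE -fsumEFin//.
rewrite ge0_integral_fsum//; last 2 first.
- by move=> y; exact/measurable_EFinP/measurable_funM.
- by move=> y x _; rewrite nnfun_muleindic_ge0.
transitivity (\int[@lebesgueR R]_x (\sum_(r \in range (f_ n))
   ((r * \1_(f_ n @^-1` [set r]) x)%:E * (pdf x)%:E)))%E; last first.
  apply: eq_integral => x _.
  rewrite [X in (X%:E * _)%E]fimfunE -fsumEFin// ge0_mule_fsuml//.
  by move=> r; rewrite nnfun_muleindic_ge0.
rewrite ge0_integral_fsum//; last 2 first.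
- move=> y; apply: emeasurable_funM => //; exact/measurable_EFinP/measurable_funM.
- by move=> y x _; rewrite mule_ge0 ?nnfun_muleindic_ge0 ?lee_fin ?laplace_pdf_ge0.
apply: eq_fsbigr => r _.
rewrite integralZl_indic_nnsfun// integral_indic// setIT.
rewrite [X in (_ * X)%E](mu_laplace (A := f_ n @^-1` [set r]))//.
rewrite -integral_lebesgueR//; last 2 first.
- exact: measurable_funTS.
- by move=> z; rewrite lee_fin laplace_pdf_ge0.
(* A negative level of a nonnegative simple function has empty preimage, so both sides vanish;
   otherwise the level is a constant that can be pulled out. *)
have [r0|r0] := ltP r 0.
  rewrite preimage_nnfun0// integral_set0 mule0.
  by rewrite integral0_eq// => x _; rewrite indic0 mulr0 mul0e.
rewrite -ge0_integralZl//; last 2 first.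
- exact: measurable_funTS.
- by move=> x _; rewrite lee_fin laplace_pdf_ge0.
rewrite integral_mkcond; apply: eq_integral => x _; rewrite patchE indicE.
by case: ifP => _ /=; rewrite ?mulr1// mulr0 mul0e.
Qed.

(** The change of variable behind the comparisons of laws below: a pointwise inequality between
    weighted densities at [v] and [v + s] is integrated. The normalization 1/2 of the density
    cancels. *)
Lemma laplace_weighted_shift (a b : R -> R) (M s : R) (f : R -> \bar R) :
  measurable_fun setT a -> measurable_fun setT b ->
  (forall v, 0 <= a v) -> (forall v, 0 <= b v) -> 0 <= M ->
  (forall v, a v * expR (- `|v|) <= M * (b (v + s) * expR (- `|v + s|))) ->
  measurable_fun setT f -> (forall v, 0 <= f v)%E ->
  (\int[mu]_v ((a v)%:E * f v) <= M%:E * \int[mu]_v ((b v)%:E * f (v - s)%R))%E.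
Proof.
move=> ma mb a0 b0 M0 ab mf f0.
have mpdf : measurable_fun setT (EFin \o pdf).
  by apply/measurable_EFinP; exact: measurable_laplace_pdf.
have mfs : measurable_fun setT (fun v : R => f (v - s)).
  apply: measurableT_comp => //.
  by apply: measurable_funB => //; exact: measurable_cst.
have mEa : measurable_fun setT (EFin \o a) by exact/measurable_EFinP.
have mEb : measurable_fun setT (EFin \o b) by exact/measurable_EFinP.
have mas : measurable_fun setT (fun v : R => ((a v)%:E * f v)%E).
  exact: emeasurable_funM.
have mbs : measurable_fun setT (fun v : R => ((b v)%:E * f (v - s)%R)%E).
  exact: emeasurable_funM.
have as0 v : (0 <= (a v)%:E * f v)%E by rewrite mule_ge0// lee_fin.
have bs0 v : (0 <= (b v)%:E * f (v - s)%R)%E by rewrite mule_ge0// lee_fin.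
rewrite !ge0_integral_laplace//.
have mbp : measurable_fun setT (fun v : R => ((b v)%:E * f (v - s)%R * (pdf v)%:E)%E).
  exact: emeasurable_funM.
have pdf0 := laplace_pdf_ge0.
have bp0 v : (0 <= (b v)%:E * f (v - s)%R * (pdf v)%:E)%E.
  by rewrite !mule_ge0// lee_fin.
rewrite -(ge0_integral_shift s mbp)//.
have mbps : measurable_fun setT (fun v : R =>
    ((b (v + s)%R)%:E * f (v + s - s)%R * (pdf (v + s)%R)%:E)%E).
  apply: (measurableT_comp mbp).
  by apply: measurable_funD => //; exact: measurable_cst.
rewrite -ge0_integralZl//.
apply: ge0_le_integral => //.
- by move=> v _; rewrite !mule_ge0// lee_fin.
- exact: emeasurable_funM.
- by apply: emeasurable_funM => //; exact: measurable_cst.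
move=> v _; rewrite addrK !laplace_pdfE.
rewrite [((a v)%:E * _)%E]muleC -muleA [leRHS]muleA [(M%:E * _)%E]muleA.
rewrite [(_ * f v)%E]muleC -muleA lee_wpmul2l// -!EFinM lee_fin.
have := ab v; nra.
Qed.

Lemma laplace_shift (s : R) (f : R -> \bar R) :
  measurable_fun setT f -> (forall v, 0 <= f v)%E ->
  (\int[mu]_v f v <= (expR `|s|)%:E * \int[mu]_v f (v - s)%R)%E.
Proof.
move=> mf f0.
have -> : (\int[mu]_v f v = \int[mu]_v ((cst 1%R v)%:E * f v))%E.
  by apply: eq_integral => v _; rewrite mul1e.
have -> : (\int[mu]_v f (v - s)%R = \int[mu]_v ((cst 1%R v)%:E * f (v - s)%R))%E.
  by apply: eq_integral => v _; rewrite mul1e.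
apply: laplace_weighted_shift => //; try exact: measurable_cst; try exact: expR_ge0.
move=> v; rewrite !mul1r -expRD ler_expR.
have := ler_normD v s; lra.
Qed.

(** The exponent [m] may be negative. [m = |s|] always satisfies the norm condition and gives the
    usual privacy factor; if the shift moves all points of [A] towards 0 without crossing it,
    [m = - |s|] gives exact exponential decay. *)
Lemma laplace_set_shift (m s : R) (A B : set R) :
  measurable A -> measurable B ->
  (forall v, A v -> B (v + s) /\ `|v + s| <= `|v| + m) ->
  (mu A <= (expR m)%:E * mu B)%E.
Proof.
move=> mA mB AB.
have mE C : measurable C -> (mu C = \int[mu]_v ((\1_C v)%:E * (cst 1%E) (v - s)%R))%E.
  move=> mC; rewrite -[LHS]/(mu C) -[in LHS](setIT C) -integral_indic//.
  by apply: eq_integral => v _; rewrite mule1.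
have mE0 : (mu A = \int[mu]_v ((\1_A v)%:E * (cst 1%E) v))%E by exact: mE.
rewrite mE0 (mE B)//; apply: laplace_weighted_shift => //.
move=> v; rewrite !indicE; have [Av|nAv] := pselect (A v); last first.
  by rewrite memNset// mul0r !mulr_ge0 ?expR_ge0.
have [Bv vm] := AB v Av; rewrite !mem_set// !mul1r -expRD ler_expR; lra.
Qed.

(** Each one-sided tail is a translate of a half-line at 0 and has at most [expR (- l)] times its
    mass. The two half-lines together have mass at most 1, so no factor 2 appears. *)
Lemma laplace_tail (l : R) : 0 <= l ->
  (mu [set v | (l < `|v|)%R] <= (expR (- l))%:E)%E.
Proof.
move=> l0.
have mpos a : measurable [set v : R | a < v].
  by rewrite -set_itvoy; exact: measurable_itv.
have mneg a : measurable [set v : R | v < a].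
  by rewrite -set_itvNyo; exact: measurable_itv.
have -> : [set v : R | l < `|v|] = [set v : R | l < v] `|` [set v : R | v < - l].
  by apply/seteqP; split=> v /=; rewrite /= ltr_normr ltrNr => /orP.
have hA : (mu [set v : R | l < v]%R <= (expR (- l))%:E * mu [set v : R | 0 < v]%R)%E.
  apply: (laplace_set_shift (s := - l)) => //= v lv.
  by split; rewrite ?gtr0_norm; lra.
have hB : (mu [set v : R | v < - l]%R <= (expR (- l))%:E * mu [set v : R | v < 0]%R)%E.
  apply: (laplace_set_shift (s := l)) => //= v lv.
  by split; rewrite ?ltr0_norm; lra.
rewrite (le_trans (measureU2 _ _ _))//.
rewrite (le_trans (leeD hA hB))// -ge0_muleDr//.
rewrite -measureU//; last first.
  by apply/seteqP; split=> v //= [? ?]; lra.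
rewrite -[leRHS]mule1 lee_wpmul2l// ?lee_fin ?expR_ge0//.
exact: probability_le1 (measurableU _ _ (mpos _) (mneg _)).
Qed.

(* [E exp(max(v,0)/2) <= 2]: the part on [v >= 0] is the total mass of the
   exponential density of rate 1/2. *)
Lemma laplace_exp_half :
  (\int[mu]_v (expR (Num.max v 0 / 2))%:E <= 2%:E)%E.
Proof.
have mm : measurable_fun setT (fun v : R => (expR (Num.max v 0 / 2))%:E).
  apply/measurable_EFinP; apply: measurableT_comp => //.
  apply: measurable_funM; last exact: measurable_cst.
  by apply: measurable_maxr => //; exact: measurable_cst.
rewrite ge0_integral_laplace//.
have mpdf : measurable_fun setT (EFin \o pdf).
  by apply/measurable_EFinP; exact: measurable_laplace_pdf.
have h0 : (0:R) <= 1/2 by lra.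
have mex : measurable_fun setT (fun v : R => (exponential_pdf (1/2 : R) v)%:E).
  by apply/measurable_EFinP; exact: (measurable_exponential_pdf (1/2 : R)).
have pdf0 := laplace_pdf_ge0.
apply: (@le_trans _ _ (\int[@lebesgueR R]_v ((exponential_pdf (1/2 : R) v)%:E + (pdf v)%:E))%E).
  apply: ge0_le_integral => //.
  - by move=> v _; rewrite mule_ge0// lee_fin ?expR_ge0.
  - exact: emeasurable_funM.
  - exact: emeasurable_funD.
  move=> v _; rewrite -EFinM -EFinD lee_fin laplace_pdfE.
  have [v0|v0] := leP 0 v.
    rewrite exponential_pdfE// ger0_norm// mulrCA -expRD.
    rewrite (_ : v / 2 - v = - (1 / 2) * v); last by lra.
    by have := expR_ge0 (- v); lra.
  rewrite lt0_exponential_pdf// mul0r expR0 mul1r; lra.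
rewrite ge0_integralD//; last 2 first.
- by move=> v _; rewrite lee_fin exponential_pdf_ge0.
- by move=> v _; rewrite lee_fin.
rewrite !integral_lebesgueR//; last first.
  by move=> v; rewrite lee_fin exponential_pdf_ge0.
have r0 : (0:R) < 1/2 by lra.
rewrite (integral_exponential_pdf r0).
have := probability_setT mu; rewrite mu_laplace// => ->.
by rewrite -EFinD lee_fin; lra.
Qed.

End laplace.

Lemma expR_ge1 (R : realType) (x : R) : 0 <= x -> 1 <= expR x.
Proof. by move=> x0; rewrite -[leLHS]expR0 ler_expR. Qed.

(** * Laplace comparisons *)

Section threshold.
Context (R : realType) (mu : probability R R).
Hypothesis mu_laplace : forall A : set R, measurable A ->
  mu A = (\int[lebesgue_measure]_(z in A) (laplace_pdf 1 z)%:E)%E.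

Lemma measurable_ge4 (x : R) : measurable [set v : R | x <= 4 * v].
Proof.
rewrite (_ : [set v | _] = `[x / 4, +oo[%classic); first exact: measurable_itv.
by apply/seteqP; split=> v /=; rewrite in_itv/= andbT ler_pdivrMr// mulrC.
Qed.

(* [exceed x] is the probability that a Lap(4) draw is at least [x]; [exceedE D]
   is the probability that it is at least [D] plus an independent Lap(2) draw. *)
Definition exceed (x : R) : R := fine (mu [set v : R | x <= 4 * v]).

Definition exceedE (D : R) : R := fine (\int[mu]_v (exceed (D + 2 * v))%:E)%E.

Lemma exceed_EFin (x : R) : (exceed x)%:E = mu [set v : R | x <= 4 * v].
Proof. by rewrite /exceed fineK// fin_num_measure//; exact: measurable_ge4. Qed.

Lemma exceedC_EFin (x : R) : (1 - exceed x)%:E = mu [set v : R | 4 * v < x].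
Proof.
rewrite EFinB exceed_EFin -probability_setC; last exact: measurable_ge4.
by congr (mu _); apply/seteqP; split=> v /=; rewrite ltNge; move/negP.
Qed.

Lemma measurable_lt4 (x : R) : measurable [set v : R | 4 * v < x].
Proof.
have := measurableC (measurable_ge4 x).
rewrite (_ : ~` _ = [set v : R | 4 * v < x])//.
by apply/seteqP; split=> v /=; rewrite ltNge; move/negP.
Qed.

Lemma exceed_ge0 (x : R) : 0 <= exceed x.
Proof. by rewrite -lee_fin exceed_EFin. Qed.

Lemma exceed_le1 (x : R) : exceed x <= 1.
Proof. by rewrite -lee_fin exceed_EFin probability_le1//; exact: measurable_ge4. Qed.

Lemma exceed_shift (m s x y : R) :
  (forall v, x <= 4 * v -> y <= 4 * (v + s) /\ `|v + s| <= `|v| + m) ->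
  exceed x <= expR m * exceed y.
Proof.
move=> h; rewrite -lee_fin EFinM !exceed_EFin.
by apply: (laplace_set_shift mu_laplace (s := s)) => //; exact: measurable_ge4.
Qed.

Lemma exceedC_shift (m s x y : R) :
  (forall v, 4 * v < x -> 4 * (v + s) < y /\ `|v + s| <= `|v| + m) ->
  1 - exceed x <= expR m * (1 - exceed y).
Proof.
move=> h; rewrite -lee_fin EFinM !exceedC_EFin.
by apply: (laplace_set_shift mu_laplace (s := s)) => //; exact: measurable_lt4.
Qed.

Lemma exceed_anti (x y : R) : x <= y -> exceed y <= exceed x.
Proof.
move=> xy; have := @exceed_shift 0 0 y x; rewrite expR0 mul1r; apply => v yv.
by rewrite !addr0; split => //; lra.
Qed.

Lemma exceed_le (x d : R) : 0 <= d -> exceed x <= expR (d / 4) * exceed (x + d).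
Proof.
move=> d0; apply: (@exceed_shift _ (d / 4)) => v xv; split; first by lra.
by rewrite (le_trans (ler_normD _ _))// lerD2l ger0_norm//; lra.
Qed.

Lemma exceedC_le (x d : R) : 0 <= d ->
  1 - exceed (x + d) <= expR (d / 4) * (1 - exceed x).
Proof.
move=> d0; apply: (@exceedC_shift _ (- d / 4)) => v xv; split; first by lra.
rewrite (le_trans (ler_normD _ _))// lerD2l ler0_norm; lra.
Qed.

(** Above 0 the tail is purely exponential, so raising the threshold gains the full factor, in the
    direction opposite to [exceed_le]. *)
Lemma exceed_decay (x d : R) : 0 <= x -> 0 <= d ->
  exceed (x + d) <= expR (- d / 4) * exceed x.
Proof.
move=> x0 d0; apply: (@exceed_shift _ (- d / 4)) => v xv; split; first by lra.
by rewrite !ger0_norm; lra.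
Qed.

Lemma exceedC_decay (x d : R) : x <= 0 -> 0 <= d ->
  1 - exceed (x - d) <= expR (- d / 4) * (1 - exceed x).
Proof.
move=> x0 d0; apply: (@exceedC_shift _ (d / 4)) => v xv; split; first by lra.
by rewrite !ler0_norm; lra.
Qed.

Lemma measurable_exceed (D a : R) :
  measurable_fun setT (fun v : R => exceed (D + a * v)).
Proof.
have mx : measurable_fun setT exceed.
  by apply: nonincreasing_measurable => // x y xy; exact: exceed_anti.
apply: (measurableT_comp mx); apply: measurable_funD; first exact: measurable_cst.
by apply: measurable_funM => //; exact: measurable_cst.
Qed.

Lemma exceedE_EFin (D : R) : (exceedE D)%:E = (\int[mu]_v (exceed (D + 2 * v))%:E)%E.
Proof.
rewrite /exceedE fineK// ge0_fin_numE; last first.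
  by apply: integral_ge0 => v _; rewrite lee_fin exceed_ge0.
apply: (@le_lt_trans _ _ (\int[mu]_v (cst 1%E v))%E); last first.
  rewrite integral_cst// mul1e; have := probability_setT mu => /= ->.
  by rewrite ltey.
apply: ge0_le_integral => //.
- by move=> v _; rewrite lee_fin exceed_ge0.
- by apply/measurable_EFinP; exact: measurable_exceed.
by move=> v _; rewrite lee_fin exceed_le1.
Qed.

Lemma exceedEC_EFin (D : R) :
  (1 - exceedE D)%:E = (\int[mu]_v (1 - exceed (D + 2 * v))%:E)%E.
Proof.
have h : ((exceedE D)%:E + \int[mu]_v (1 - exceed (D + 2 * v))%:E = 1)%E.
  rewrite exceedE_EFin -ge0_integralD//.
  - under eq_integral do rewrite -EFinD addrCA subrr addr0.
    by rewrite integral_cst// mul1e; exact: probability_setT.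
  - by move=> v _; rewrite lee_fin exceed_ge0.
  - by apply/measurable_EFinP; exact: measurable_exceed.
  - by move=> v _; rewrite lee_fin subr_ge0 exceed_le1.
  - apply/measurable_EFinP; apply: measurable_funB; first exact: measurable_cst.
    exact: measurable_exceed.
by rewrite EFinB -h addeAC subee// add0e.
Qed.

Lemma le_integral_EFin (f g : R -> R) :
  measurable_fun setT f -> measurable_fun setT g ->
  (forall v, 0 <= f v) -> (forall v, f v <= g v) ->
  (\int[mu]_v (f v)%:E <= \int[mu]_v (g v)%:E)%E.
Proof.
move=> mf mg f0 fg; apply: ge0_le_integral => //.
- by move=> v _; rewrite lee_fin.
- exact/measurable_EFinP.
- exact/measurable_EFinP.
- by move=> v _; rewrite lee_fin.
Qed.

Lemma exceedE_ge0 (D : R) : 0 <= exceedE D.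
Proof.
rewrite -lee_fin exceedE_EFin; apply: integral_ge0 => v _.
by rewrite lee_fin exceed_ge0.
Qed.

Lemma exceedE_le1 (D : R) : exceedE D <= 1.
Proof.
rewrite -subr_ge0 -lee_fin exceedEC_EFin; apply: integral_ge0 => v _.
by rewrite lee_fin subr_ge0 exceed_le1.
Qed.

Lemma exceedE_le (D d : R) : 0 <= d -> exceedE D <= expR (d / 4) * exceedE (D + d).
Proof.
move=> d0; rewrite -lee_fin EFinM !exceedE_EFin -ge0_integralZl//; last 2 first.
- by apply/measurable_EFinP; exact: measurable_exceed.
- by move=> v _; rewrite lee_fin exceed_ge0.
under [leRHS]eq_integral do rewrite -EFinM.
apply: le_integral_EFin.
- exact: measurable_exceed.
- apply: measurable_funM; first exact: measurable_cst.
  exact: measurable_exceed.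
- by move=> v; exact: exceed_ge0.
- by move=> v; rewrite (addrAC D d); exact: exceed_le.
Qed.

Lemma exceedEC_le (D d : R) : 0 <= d ->
  1 - exceedE (D + d) <= expR (d / 4) * (1 - exceedE D).
Proof.
have mC x : measurable_fun setT (fun v : R => 1 - exceed (x + 2 * v)).
  apply: measurable_funB; first exact: measurable_cst.
  exact: measurable_exceed.
move=> d0; rewrite -lee_fin EFinM !exceedEC_EFin -ge0_integralZl//; last 2 first.
- by apply/measurable_EFinP.
- by move=> v _; rewrite lee_fin subr_ge0 exceed_le1.
under [leRHS]eq_integral do rewrite -EFinM.
apply: le_integral_EFin => //.
- by apply: measurable_funM; first exact: measurable_cst.
- by move=> v; rewrite subr_ge0; exact: exceed_le1.
- by move=> v; rewrite (addrAC D d); exact: exceedC_le.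
Qed.

Lemma exceedE_anti (D D' : R) : D <= D' -> exceedE D' <= exceedE D.
Proof.
move=> DD'; rewrite -lee_fin !exceedE_EFin; apply: le_integral_EFin.
- exact: measurable_exceed.
- exact: measurable_exceed.
- by move=> v; exact: exceed_ge0.
- by move=> v; apply: exceed_anti; lra.
Qed.

(** Averaging over the threshold noise raises the lower tail at [D] by the factor
    [expR (Num.max v 0 / 2)] at most, whose expectation is at most 2. A factor of 2 is exactly what
    [mixw_le_neg] can afford. *)
Lemma exceedEC_exceedC (D : R) : 1 - exceedE D <= 2 * (1 - exceed D).
Proof.
have mm : measurable_fun setT (fun v : R => expR (Num.max v 0 / 2)).
  apply: measurableT_comp => //.
  apply: measurable_funM; last exact: measurable_cst.
  by apply: measurable_maxr => //; exact: measurable_cst.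
have Q0 : 0 <= 1 - exceed D by rewrite subr_ge0 exceed_le1.
rewrite -lee_fin exceedEC_EFin.
apply: (@le_trans _ _ (\int[mu]_v ((1 - exceed D)%:E * (expR (Num.max v 0 / 2))%:E))%E).
  under [leRHS]eq_integral do rewrite -EFinM.
  apply: le_integral_EFin.
  - apply: measurable_funB; first exact: measurable_cst.
    exact: measurable_exceed.
  - by apply: measurable_funM; first exact: measurable_cst.
  - by move=> v; rewrite subr_ge0 exceed_le1.
  move=> v; rewrite [leRHS]mulrC; have [v0|v0] := leP 0 v.
    by rewrite (_ : v / 2 = 2 * v / 4); [apply: exceedC_le; lra|lra].
  by rewrite mul0r expR0 mul1r lerB// exceed_anti//; lra.
rewrite ge0_integralZl//; last exact/measurable_EFinP.
rewrite mulrC EFinM lee_wpmul2l ?lee_fin//; exact: (laplace_exp_half mu_laplace).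
Qed.

(* The density, relative to Lap(2), of the threshold noise that is running after
   two successive comparisons of which only the first one is revealed. *)
Definition mixw (D x : R) : R := 1 + exceedE D - exceed x.

Lemma mixw_ge0 (D x : R) : 0 <= mixw D x.
Proof. rewrite /mixw; have := exceedE_ge0 D; have := exceed_le1 x; lra. Qed.

(** The crude estimate, in which the growth of [x] pays for nothing. *)
Lemma mixw_le (D D' x x' d : R) : 0 <= d -> D' <= D + d -> x <= x' ->
  mixw D x <= expR (d / 4) * mixw D' x'.
Proof.
move=> d0 Dd xx'; rewrite /mixw.
have h1 := exceedE_le D d0.
have h2 := exceedE_anti Dd.
have h3 := exceed_anti xx'.
have h4 := exceed_le1 x'.
have h5 : 1 <= expR (d / 4) by apply: expR_ge1; lra.
nra.
Qed.

(** Write q for [1 - exceedE D] and A for [1 - exceed x], so that the weight is 1 - q + A, and let r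
    be exp((D1 - D)/4). Raising [D] adds at most (r - 1) q <= 2 (r - 1) A to q. Raising [x] below 0,
    where the lower tail is purely exponential, adds at least (r^2 - 1) A to A. The surplus is (r -
    1)^2 A. *)
Lemma mixw_le_neg (D D1 x x1 : R) : D <= D1 -> D <= x -> x1 <= 0 ->
  2 * (D1 - D) <= x1 - x -> mixw D x <= mixw D1 x1.
Proof.
move=> DD1 Dx x10 h; rewrite /mixw.
have d0 : 0 <= D1 - D by lra.
have := exceedEC_le D d0; rewrite subrKC => h1.
have h2 := exceedEC_exceedC D.
have h3 := exceed_anti Dx.
have := @exceedC_decay x1 (x1 - x) x10; rewrite opprB subrKC => /(_ ltac:(lra)) h4.
set r := expR ((D1 - D) / 4) in h1.
have r1 : 1 <= r by apply: expR_ge1; lra.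
have h5 : 1 - exceed x <= expR (- ((D1 - D) / 4 + (D1 - D) / 4)) * (1 - exceed x1).
  apply: (le_trans h4); apply: ler_wpM2r; first by rewrite subr_ge0 exceed_le1.
  by rewrite ler_expR; lra.
move: h5; rewrite expRN expRD -/r mulrC ler_pdivlMr; last by rewrite mulr_gt0 ?expR_gt0.
move=> h5.
have A0 : 0 <= 1 - exceed x by rewrite subr_ge0 exceed_le1.
have k1 : (r - 1) * (1 - exceedE D) <= (r - 1) * (2 * (1 - exceed x)).
  by apply: ler_wpM2l; lra.
have k2 : 0 <= (r - 1) ^+ 2 * (1 - exceed x) by rewrite mulr_ge0// sqr_ge0.
lra.
Qed.

(** The extreme case has both hypotheses tight: with r = z^3, p = r/(r + 1) and p' = 1/(r + 1). The
    claim then reads 2r + 1 <= z (r + 2), and the difference of the two sides factors as (z - 1)^3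
    (z + 1). This turns the exponent d/4 for a probability into d/12 for one plus a probability. *)
Lemma one_plus_cube_ratio (z p p' : R) : 1 <= z -> 0 <= p <= 1 -> p' <= 1 ->
  p <= z ^+ 3 * p' -> 1 - p' <= z ^+ 3 * (1 - p) -> 1 + p <= z * (1 + p').
Proof.
move=> z1 /andP[p0 p1] p'1 h1 h2.
have r1 : 1 <= z ^+ 3 by rewrite exprn_ege1.
have key : 0 <= z * z ^+ 3 - 2 * z ^+ 3 + 2 * z - 1.
  rewrite (_ : _ - 1 = (z - 1) ^+ 3 * (z + 1)); last by ring.
  by rewrite mulr_ge0 ?exprn_ge0//; lra.
have zr : z <= z ^+ 3 by rewrite -[leLHS]expr1 ler_weXn2l.
set r := z ^+ 3 in h1 h2 r1 key zr *.
have r0 : 0 < r + 1 by lra.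
(* The two hypotheses bound p' below by p/r and by 1 - r (1 - p). These bounds agree at p = r/(r +
   1); the first is the better one below this value, the second above it. *)
have [hp|hp] := leP (p * (r + 1)) r.
  have : 0 <= (r * (z * (1 + p') - (1 + p))) * (r + 1) by nra.
  rewrite pmulr_lge0// pmulr_rge0 ?subr_ge0//; lra.
have : 0 <= (z * (1 + p') - (1 + p)) * (r + 1) by nra.
by rewrite pmulr_lge0// subr_ge0.
Qed.

(** With z = exp((D' - D1)/12), the term [1 + exceedE] shrinks by at most the factor z, by
    [one_plus_cube_ratio], while the subtracted [exceed] shrinks by at least this factor since its
    argument is positive. Hence the difference also shrinks by at most z. *)
Lemma mixw_le_pos (D1 D' x1 x' : R) : D1 <= D' -> 0 <= x1 ->
  2 * (D' - D1) <= x' - x1 ->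
  mixw D1 x1 <= expR ((D' - D1) / 12) * mixw D' x'.
Proof.
move=> DD1 x10 h; rewrite /mixw.
have d0 : 0 <= D' - D1 by lra.
have := exceedEC_le D1 d0; rewrite subrKC => h1.
have := exceedE_le D1 d0; rewrite subrKC => h2.
set z := expR ((D' - D1) / 12).
have z1 : 1 <= z by apply: expR_ge1; lra.
have zr : expR ((D' - D1) / 4) = z ^+ 3.
  by rewrite /z -expRM_natl; congr expR; lra.
rewrite zr in h1 h2.
have := @exceed_decay x1 (x' - x1) x10 ltac:(lra); rewrite subrKC => h4.
have h5 : exceed x' <= expR (- ((D' - D1) / 12)) * exceed x1.
  apply: (le_trans h4); apply: ler_wpM2r; first exact: exceed_ge0.
  by rewrite ler_expR; lra.
move: h5; rewrite expRN -/z mulrC ler_pdivlMr; last by rewrite expR_gt0.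
have := one_plus_cube_ratio z1 _ (exceedE_le1 D') h2 h1.
rewrite exceedE_ge0 exceedE_le1 => /(_ isT); lra.
Qed.

Lemma mixw_le_core (D D' e c : R) : 0 <= e -> D <= D' -> D' - D <= c ->
  mixw D (D + e) <= expR ((D' - D) / 12) * mixw D' (D' + e + c).
Proof.
move=> e0 DD' DDc; set x := D + e; set x' := D' + e + c.
have [x0|x0] := leP 0 x; first by apply: mixw_le_pos => //; rewrite /x /x'; lra.
have e1 : 1 <= expR ((D' - D) / 12) by apply: expR_ge1; lra.
have [x'0|x'0] := leP x' 0.
  apply: (@le_trans _ _ (mixw D' x')).
    by apply: mixw_le_neg => //; rewrite /x /x'; lra.
  by rewrite ler_peMl// mixw_ge0.
(* split the segment from (D, x) to (D', x') where x crosses 0 *)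
have xx : 0 < x' - x by lra.
pose s := - x / (x' - x); pose D1 := D + s * (D' - D).
have sE : s * (x' - x) = - x by rewrite /s mulfVK// gt_eqF.
have s0 : 0 <= s by rewrite divr_ge0//; lra.
have s1 : s <= 1 by rewrite ler_pdivrMr//; lra.
have xxE : x' - x = D' - D + c by rewrite /x /x'; lra.
have D1l : D <= D1 by rewrite /D1 lerDl mulr_ge0//; lra.
have D1r : D1 <= D' by rewrite /D1; nra.
apply: (@le_trans _ _ (mixw D1 0)).
  apply: mixw_le_neg => //; first by rewrite /x; lra.
  by rewrite /D1; nra.
apply: (@le_trans _ _ (expR ((D' - D1) / 12) * mixw D' x')).
  by apply: mixw_le_pos => //; rewrite /D1; nra.
by rewrite ler_wpM2r ?mixw_ge0// ler_expR; lra.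
Qed.

(** The constant is 7/12 = 1/2 + 1/12: moving Lap(2) noise by [c] costs c/2, and the change of the
    weight costs c/12. Where the move brings the noise closer to 0, the density has slack and the
    crude bound on the weight suffices. *)
Lemma mixw_shift (D D' c e : R) : `|D - D'| <= c ->
  mixw D (D + e) * expR (- `|e / 2|)
  <= expR (7 * c / 12) * (mixw D' (D' + e + c) * expR (- `|(e + c) / 2|)).
Proof.
move=> /[dup] Dc /ler_normlP[Dc1 Dc2].
have c0 : 0 <= c by rewrite (le_trans _ Dc).
suff : exists m, mixw D (D + e) <= expR m * mixw D' (D' + e + c) /\
    m - `|e / 2| <= 7 * c / 12 - `|(e + c) / 2|.
  case=> m [h1 h2].
  have := ler_wpM2r (expR_ge0 (- `|e / 2|)) h1.
  move=> /le_trans; apply; rewrite mulrAC -expRD mulrCA -mulrA -expRD mulrC.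
  by rewrite ler_wpM2l ?mixw_ge0// ler_expR; lra.
have ab : `|(e + c) / 2| <= `|e / 2| + c / 2.
  by rewrite mulrDl (le_trans (ler_normD _ _))// lerD2l ger0_norm//; lra.
have [D'D|DD'] := leP D' D.
  exists 0; split; last by lra.
  have := @mixw_le D D' (D + e) (D' + e + c) 0; rewrite mul0r; apply; lra.
have [e0|e0] := leP 0 e.
  exists ((D' - D) / 12); split; last by lra.
  by apply: mixw_le_core => //; lra.
(* Both [e] and [e + c] are nonpositive here, so the density gains c/2 instead of losing it, and c/4
   for the weight is affordable. *)
have [ec|ec] := leP e (- c).
  exists (c / 4); split; first by apply: mixw_le; lra.
  by rewrite !ler0_norm; lra.
have cp : 0 < c by lra.
(* The path from [(D, e)] to [(D', e + c)] is split at the fraction [s] at which the noise crosses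
   0: the crude bound is used before this point, the sharp one after it. *)
pose s := - e / c; pose D1 := D + s * (D' - D).
have sE : s * c = - e by rewrite /s mulfVK// gt_eqF.
have s0 : 0 <= s by rewrite divr_ge0//; lra.
have s1 : s <= 1 by rewrite ler_pdivrMr//; lra.
exists (- e / 4 + c / 12); split; last by rewrite ler0_norm ?ger0_norm; lra.
have h1 : mixw D (D + e) <= expR (- e / 4) * mixw D1 (D1 + 0).
  by apply: mixw_le; rewrite /D1; nra.
have h2 : mixw D1 (D1 + 0) <= expR ((D' - D1) / 12) * mixw D' (D' + 0 + (c + e)).
  by apply: mixw_le_core => //; rewrite /D1; nra.
apply: (le_trans h1); rewrite expRD -mulrA ler_wpM2l ?expR_ge0//.
apply: (le_trans h2); rewrite (_ : D' + 0 + (c + e) = D' + e + c); last by lra.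
rewrite ler_wpM2r ?mixw_ge0// ler_expR.
have : D <= D1 by rewrite /D1 lerDl mulr_ge0//; lra.
lra.
Qed.

End threshold.

(** * A single query: its six draws integrated out and compared on two databases *)

Lemma measurable_integral_snd (R : realType) (mu : probability R R)
    (d : measure_display) (T : measurableType d) (f : T * R -> \bar R) :
  measurable_fun setT f -> (forall x, 0 <= f x)%E ->
  measurable_fun setT (fun x => \int[mu]_y f (x, y))%E.
Proof.
by move=> mf f0; exact: (@measurable_fun_fubini_tonelli_F _ _ T R R mu f).
Qed.

Section onestep.
Context (R : realType) (mu : probability R R).
Hypothesis mu_laplace : forall A : set R, measurable A ->
  mu A = (\int[lebesgue_measure]_(z in A) (laplace_pdf 1 z)%:E)%E.
Local Notation exceed := (exceed mu).
Local Notation exceedE := (exceedE mu).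
Local Notation mixw := (mixw mu).

Lemma integral_prob_cst (c : \bar R) : (\int[mu]_v c = c)%E.
Proof.
by rewrite integral_cst//; have := probability_setT mu => /= ->; rewrite mule1.
Qed.

Lemma integral_threshold (x : R) (A B : \bar R) : (0 <= A)%E -> (0 <= B)%E ->
  (\int[mu]_v (if (x <= 4 * v)%R then A else B)
   = (exceed x)%:E * A + (1 - exceed x)%:E * B)%E.
Proof.
move=> A0 B0.
pose S := [set v : R | x <= 4 * v].
have mS : measurable S by exact: measurable_ge4.
transitivity (\int[mu]_v (A * (\1_S v)%:E + B * (\1_(~` S) v)%:E))%E.
  apply: eq_integral => v _; rewrite !indicE in_setC; case: ifPn => xv.
    by rewrite mem_set// mule1 mule0 adde0.
  by rewrite memNset ?mule1 ?mule0 ?add0e// /S/=; apply/negP.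
have mI (U : set R) : measurable U -> measurable_fun setT (fun v : R => (\1_U v : R)%:E).
  by move=> mU; apply/measurable_EFinP; exact: measurable_indic.
have mSC : measurable (~` S) by exact: measurableC.
rewrite ge0_integralD//; last 4 first.
- by move=> v _; rewrite mule_ge0// lee_fin.
- by apply: emeasurable_funM; [exact: measurable_cst|exact: mI].
- by move=> v _; rewrite mule_ge0// lee_fin.
- by apply: emeasurable_funM; [exact: measurable_cst|exact: mI].
rewrite !ge0_integralZl//; try exact: mI.
rewrite !integral_indic// !setIT exceed_EFin exceedC_EFin muleC [(B * _)%E]muleC.
congr (_ + mu _ * _)%E.
by apply/seteqP; split=> v /=; rewrite /S/= ltNge; move/negP.
Qed.

Definition mixE (D : R) (psi : R -> \bar R) : \bar R :=
  (\int[mu]_v ((mixw D (D + 2 * v))%:E * psi (2 * v)%R))%E.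

Lemma measurable_mixw (D : R) :
  measurable_fun setT (fun v : R => mixw D (D + 2 * v)).
Proof.
apply: measurable_funB; first exact: measurable_cst.
exact: measurable_exceed.
Qed.

Lemma measurable_scale (a : R) : measurable_fun setT (fun v : R => a * v).
Proof. by apply: measurable_funM => //; exact: measurable_cst. Qed.

(** Here [a] gives the running noise, [b] the draw of the hidden comparison and [c] the replacement
    noise. The noise is kept with density factor [1 - exceed (D + 2 * a)]; as [c] is independent of
    the rest, a replacement contributes the averaged firing probability [exceedE D] at every
    value. *)
Lemma hidden_mixE (D : R) (psi : R -> \bar R) :
  measurable_fun setT psi -> (forall e, 0 <= psi e)%E ->
  (\int[mu]_a \int[mu]_b \int[mu]_c
     psi (if D + 2 * a <= 4 * b then 2 * c else 2 * a)%R = mixE D psi)%E.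
Proof.
move=> mpsi psi0.
have mp2 : measurable_fun setT (fun v : R => psi (2 * v)).
  by apply: (measurableT_comp mpsi); exact: measurable_scale.
have mQ := @measurable_exceed _ mu mu_laplace D 2.
pose A := (\int[mu]_c psi (2 * c)%R)%E.
have A0 : (0 <= A)%E by apply: integral_ge0.
have Q0 := @exceed_ge0 _ mu.
have Q1 v : 0 <= 1 - exceed v by rewrite subr_ge0 exceed_le1.
have mQC : measurable_fun setT (fun v : R => 1 - exceed (D + 2 * v)).
  by apply: measurable_funB => //; exact: measurable_cst.
transitivity (\int[mu]_a ((exceed (D + 2 * a))%:E * A
    + (1 - exceed (D + 2 * a))%:E * psi (2 * a)%R))%E.
  apply: eq_integral => a _; rewrite -integral_threshold//.
  apply: eq_integral => b _; case: ifPn => // _; exact: integral_prob_cst.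
have mEQ : measurable_fun setT (fun v : R => (exceed (D + 2 * v))%:E).
  exact/measurable_EFinP.
have mEQC : measurable_fun setT (fun v : R => (1 - exceed (D + 2 * v))%:E).
  exact/measurable_EFinP.
rewrite ge0_integralD//; last 4 first.
- by move=> v _; rewrite mule_ge0// lee_fin.
- by apply: emeasurable_funM => //; exact: measurable_cst.
- by move=> v _; rewrite mule_ge0// lee_fin.
- exact: emeasurable_funM.
rewrite ge0_integralZr//; last by move=> v _; rewrite lee_fin.
rewrite -exceedE_EFin// /A -ge0_integralZl//; last by rewrite lee_fin exceedE_ge0.
rewrite -ge0_integralD//.
- apply: eq_integral => v _; rewrite -ge0_muleDl ?lee_fin ?exceedE_ge0//.
  by congr (_ * _)%E; rewrite -EFinD; congr EFin; rewrite /mixw; lra.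
- by move=> v _; rewrite mule_ge0// lee_fin exceedE_ge0.
- by apply: emeasurable_funM => //; exact: measurable_cst.
- by move=> v _; rewrite mule_ge0// lee_fin.
- exact: emeasurable_funM.
Qed.

Lemma mixE_shift (D D' c : R) (psi : R -> \bar R) :
  `|D - D'| <= c ->
  measurable_fun setT psi -> (forall e, 0 <= psi e)%E ->
  (mixE D psi <= (expR (7 * c / 12))%:E * mixE D' (fun e => psi (e - c)%R))%E.
Proof.
move=> Dc mpsi psi0; rewrite /mixE.
have mp2 : measurable_fun setT (fun v : R => psi (2 * v)).
  by apply: (measurableT_comp mpsi); exact: measurable_scale.
have := @laplace_weighted_shift R mu mu_laplace
  (fun v => mixw D (D + 2 * v)) (fun v => mixw D' (D' + 2 * v))
  (expR (7 * c / 12)) (c / 2) (fun v => psi (2 * v)).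
move=> /(_ (measurable_mixw D) (measurable_mixw D')).
have e2 v : 2 * (v - c / 2) = 2 * v - c by lra.
have -> : (\int[mu]_v ((mixw D' (D' + 2 * v))%:E * psi (2 * v - c)%R)
  = \int[mu]_v ((mixw D' (D' + 2 * v))%:E * psi (2 * (v - c / 2))%R))%E.
  by apply: eq_integral => v _; rewrite e2.
apply => //; try (by move=> v; exact: mixw_ge0).
move=> v; have := mixw_shift mu_laplace (2 * v) Dc.
have -> : 2 * v / 2 = v by lra.
have -> : (2 * v + c) / 2 = v + c / 2 by lra.
by have -> : D' + 2 * v + c = D' + 2 * (v + c / 2) by lra.
Qed.

(** [D1] and [D2] are the thresholds multiplied by xi_t and [e] is the running noise. All six draws
    are integrated whether or not they matter, so that every step consumes the same number of
    draws. *)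
Definition onestep (D1 D2 e : R) (H1 H2 : R * R -> \bar R) (E0 : \bar R) : \bar R :=
  (\int[mu]_a \int[mu]_z \int[mu]_h \int[mu]_a' \int[mu]_z' \int[mu]_h'
    if (D1 + e <= 4 * a)%R
    then H1 (z, if D2 + 2 * h <= 4 * a' then 2 * h' else 2 * h)%R
    else if (D2 + e <= 4 * a')%R then H2 (z', 2 * h')%R else E0)%E.

Lemma measurable_section (H : R * R -> \bar R) (z : R) :
  measurable_fun setT H -> measurable_fun setT (fun e => H (z, e)).
Proof. by move=> mH; exact: (measurableT_comp mH (pair1_measurable z)). Qed.

Lemma onestepE (D1 D2 e : R) (H1 H2 : R * R -> \bar R) (E0 : \bar R) :
  measurable_fun setT H1 -> measurable_fun setT H2 ->
  (forall x, 0 <= H1 x)%E -> (forall x, 0 <= H2 x)%E -> (0 <= E0)%E ->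
  (onestep D1 D2 e H1 H2 E0 =
   (exceed (D1 + e))%:E * (\int[mu]_z mixE D2 (fun e' => H1 (z, e')))
   + (1 - exceed (D1 + e))%:E *
     ((exceed (D2 + e))%:E * (\int[mu]_z \int[mu]_h H2 (z, 2 * h)%R)
      + (1 - exceed (D2 + e))%:E * E0))%E.
Proof.
move=> mH1 mH2 H10 H20 E00.
have Q0 := @exceed_ge0 _ mu.
have Q1 v : 0 <= 1 - exceed v by rewrite subr_ge0 exceed_le1.
have w0 := @mixw_ge0 _ mu mu_laplace.
rewrite -[X in (_ + _ * X)%E]integral_threshold//; last first.
  by apply: integral_ge0 => z _; exact: integral_ge0.
rewrite -integral_threshold; last 2 first.
- by apply: integral_ge0 => z _; apply: integral_ge0 => h _; rewrite mule_ge0// lee_fin.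
- apply: integral_ge0 => a _; case: ifP => // _.
  by apply: integral_ge0 => z _; exact: integral_ge0.
apply: eq_integral => a _; case: ifPn => _.
  apply: eq_integral => z _.
  apply: (etrans _ (hidden_mixE D2 (measurable_section z mH1) (fun _ => H10 _))).
  apply: eq_integral => h _; apply: eq_integral => a' _.
  exact: integral_prob_cst.
rewrite integral_prob_cst integral_prob_cst.
apply: eq_integral => a' _; case: ifPn => // _.
by rewrite !integral_prob_cst.
Qed.

(** [Delta] is the sum of (c + c')/4 for the draw of scale 4 that fires, whose threshold rises by at
    most c + c', of c'/8 for the released draw of scale 8, and of 7c'/12 for the noise left running.
    If the second call fires, the noise left running is fresh and its shift costs only c'/2. An easy
    query is free: as c' <= c, passing from [e] to [e + c] raises both thresholds. *)
Lemma onestep_le (D1 D2 D1' D2' c c' e s1 s2 : R) (H1 H2 : R * R -> \bar R)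
    (E0 : \bar R) (Delta := c / 4 + 3 * c' / 8 + 7 * c' / 12) :
  `|D1 - D1'| <= c' -> `|D2 - D2'| <= c' -> c' <= c ->
  `|s1| <= c' / 8 -> `|s2| <= c' / 8 ->
  measurable_fun setT H1 -> measurable_fun setT H2 ->
  (forall x, 0 <= H1 x)%E -> (forall x, 0 <= H2 x)%E -> (0 <= E0)%E ->
  (onestep D1 D2 e H1 H2 E0 <=
   onestep D1' D2' (e + c)%R
     (fun x => (expR Delta)%:E * H1 (x.1 - s1, x.2 - c')%R)
     (fun x => (expR Delta)%:E * H2 (x.1 - s2, x.2 - c')%R) E0)%E.
Proof.
move=> D1c D2c cc s1c s2c mH1 mH2 H10 H20 E00.
have c'0 : 0 <= c' by rewrite (le_trans _ D1c).
have mshift (H : R * R -> \bar R) (s : R) : measurable_fun setT H ->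
    measurable_fun setT (fun x : R * R => H (x.1 - s, x.2 - c')).
  move=> mH; apply: (measurableT_comp mH); apply: measurable_fun_pair.
    by apply: measurable_funB; [exact: measurable_fst|exact: measurable_cst].
  by apply: measurable_funB; [exact: measurable_snd|exact: measurable_cst].
have mZ (H : R * R -> \bar R) (k : \bar R) : measurable_fun setT H ->
    measurable_fun setT (fun x : R * R => (k * H x)%E).
  by move=> mH; apply: emeasurable_funM => //; exact: measurable_cst.
have eD : (0 <= (expR Delta)%:E)%E by rewrite lee_fin expR_ge0.
rewrite !onestepE//; try (by apply: mZ; exact: mshift);
  try (by move=> x; rewrite mule_ge0).
have Q0 := @exceed_ge0 _ mu.
have Q1 v : 0 <= 1 - exceed v by rewrite subr_ge0 exceed_le1.
have w0 := @mixw_ge0 _ mu mu_laplace.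
have up D D' : `|D - D'| <= c' ->
    exceed (D + e) <= expR ((c + c') / 4) * exceed (D' + (e + c)).
  move=> /ler_normlP[Da Db].
  apply: (le_trans (@exceed_le _ _ mu_laplace (D + e) (c + c') _)); first by lra.
  by rewrite ler_wpM2l ?expR_ge0// (exceed_anti mu_laplace)//; lra.
have lo D D' : `|D - D'| <= c' -> 1 - exceed (D + e) <= 1 - exceed (D' + (e + c)).
  by move=> /ler_normlP[Da Db]; rewrite lerB// (exceed_anti mu_laplace)//; lra.
have mW1 : measurable_fun setT (fun x : R * R =>
     ((mixw D2' (D2' + 2 * x.2))%:E * H1 (x.1 - s1, 2 * x.2 - c')%R)%E).
  apply: emeasurable_funM.
    apply/measurable_EFinP.
    exact: (measurableT_comp (measurable_mixw D2') measurable_snd).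
  apply: (measurableT_comp mH1); apply: measurable_fun_pair.
    by apply: measurable_funB; [exact: measurable_fst|exact: measurable_cst].
  apply: measurable_funB; last exact: measurable_cst.
  exact: (measurableT_comp (measurable_scale 2) measurable_snd).
have W01 x : (0 <= (mixw D2' (D2' + 2 * x.2))%:E * H1 (x.1 - s1, 2 * x.2 - c')%R)%E.
  by rewrite mule_ge0// lee_fin.
have mM1 : measurable_fun setT (fun z : R => mixE D2' (fun e' => H1 (z - s1, e' - c')%R)).
  exact: (measurable_integral_snd mu mW1 W01).
have M10 z : (0 <= mixE D2' (fun e' => H1 (z - s1, e' - c')%R))%E.
  by apply: integral_ge0 => v _; rewrite mule_ge0// lee_fin.
have mW2 : measurable_fun setT (fun x : R * R => H2 (x.1 - s2, 2 * x.2 - c')%R).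
  apply: (measurableT_comp mH2); apply: measurable_fun_pair.
    by apply: measurable_funB; [exact: measurable_fst|exact: measurable_cst].
  apply: measurable_funB; last exact: measurable_cst.
  exact: (measurableT_comp (measurable_scale 2) measurable_snd).
have mM2 : measurable_fun setT (fun z : R => \int[mu]_h H2 (z - s2, 2 * h - c')%R)%E.
  exact: (measurable_integral_snd mu mW2 (fun x => H20 _)).
have hM : (\int[mu]_z mixE D2 (fun e' => H1 (z, e'))
   <= (expR (c' / 8))%:E * \int[mu]_z ((expR (7 * c' / 12))%:E *
        mixE D2' (fun e' => H1 (z - s1, e' - c')%R)))%E.
  have mW : measurable_fun setT (fun x : R * R =>
     ((mixw D2 (D2 + 2 * x.2))%:E * H1 (x.1, 2 * x.2)%R)%E).
    apply: emeasurable_funM.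
      apply/measurable_EFinP.
      exact: (measurableT_comp (measurable_mixw D2) measurable_snd).
    apply: (measurableT_comp mH1); apply: measurable_fun_pair.
      exact: measurable_fst.
    exact: (measurableT_comp (measurable_scale 2) measurable_snd).
  have W0 x : (0 <= (mixw D2 (D2 + 2 * x.2))%:E * H1 (x.1, 2 * x.2)%R)%E.
    by rewrite mule_ge0// lee_fin.
  have mM := measurable_integral_snd mu mW W0.
  have mM' : measurable_fun setT (fun z : R => mixE D2 (fun e' => H1 (z, e'))) by exact: mM.
  apply: (le_trans (@laplace_shift _ _ mu_laplace s1 _ mM' _)).
    by move=> z; apply: integral_ge0 => v _; rewrite mule_ge0// lee_fin.
  apply: lee_pmul; rewrite ?lee_fin ?expR_ge0 ?ler_expR//.
    by apply: integral_ge0 => z _; apply: integral_ge0 => v _; rewrite mule_ge0// lee_fin.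
  apply: ge0_le_integral => //.
  - by move=> z _; apply: integral_ge0 => v _; rewrite mule_ge0// lee_fin.
  - apply: (measurableT_comp mM').
    by apply: measurable_funB => //; exact: measurable_cst.
  - apply: emeasurable_funM; first exact: measurable_cst.
    exact: mM1.
  move=> z _; apply: (@mixE_shift D2 D2' c' (fun e' => H1 (z - s1, e'))) => //.
  exact: measurable_section.
have hZ : (\int[mu]_z \int[mu]_h H2 (z, 2 * h)%R
   <= (expR (c' / 8))%:E * \int[mu]_z ((expR (c' / 2))%:E *
        \int[mu]_h H2 (z - s2, 2 * h - c')%R))%E.
  have mW : measurable_fun setT (fun x : R * R => H2 (x.1, 2 * x.2)%R).
    apply: (measurableT_comp mH2); apply: measurable_fun_pair.
      exact: measurable_fst.
    exact: (measurableT_comp (measurable_scale 2) measurable_snd).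
  have mM := measurable_integral_snd mu mW (fun x => H20 _).
  have mM' : measurable_fun setT (fun z : R => \int[mu]_h H2 (z, 2 * h)%R)%E by exact: mM.
  apply: (le_trans (@laplace_shift _ _ mu_laplace s2 _ mM' _)).
    by move=> z; apply: integral_ge0.
  apply: lee_pmul; rewrite ?lee_fin ?expR_ge0 ?ler_expR//.
    by apply: integral_ge0 => z _; apply: integral_ge0.
  apply: ge0_le_integral => //.
  - by move=> z _; apply: integral_ge0.
  - apply: (measurableT_comp mM').
    by apply: measurable_funB => //; exact: measurable_cst.
  - apply: emeasurable_funM; first exact: measurable_cst.
    exact: mM2.
  move=> z _.
  have mz : measurable_fun setT (fun h : R => H2 (z - s2, 2 * h)).
    apply: (measurableT_comp (measurable_section (z - s2) mH2)).
    exact: measurable_scale.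
  have := @laplace_shift _ _ mu_laplace (c' / 2) _ mz (fun h => H20 _).
  rewrite ger0_norm; last by lra.
  have e2 v : 2 * (v - c' / 2) = 2 * v - c' by lra.
  have -> : (\int[mu]_h H2 (z - s2, 2 * h - c')%R
    = \int[mu]_h H2 (z - s2, 2 * (h - c' / 2))%R)%E.
    by apply: eq_integral => v _; rewrite e2.
  by [].
pose J1 := (\int[mu]_z mixE D2' (fun e' => H1 (z - s1, e' - c')%R))%E.
pose J2 := (\int[mu]_z \int[mu]_h H2 (z - s2, 2 * h - c')%R)%E.
have J10 : (0 <= J1)%E by exact: integral_ge0.
have J20 : (0 <= J2)%E by apply: integral_ge0 => z _; exact: integral_ge0.
have eqJ1 : (\int[mu]_z mixE D2' (fun e' =>
    (expR Delta)%:E * H1 (z - s1, e' - c')%R) = (expR Delta)%:E * J1)%E.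
  rewrite -ge0_integralZl//; apply: eq_integral => z _.
  rewrite /mixE -ge0_integralZl//.
  - by apply: eq_integral => v _; rewrite muleCA.
  - exact: (measurable_section z mW1).
  - by move=> v _; exact: (W01 (z, v)).
have eqJ2 : (\int[mu]_z \int[mu]_h
    ((expR Delta)%:E * H2 (z - s2, 2 * h - c')%R) = (expR Delta)%:E * J2)%E.
  rewrite -ge0_integralZl//; last by move=> z _; exact: integral_ge0.
  apply: eq_integral => z _; rewrite ge0_integralZl//.
  exact: (measurable_section z mW2).
rewrite ge0_integralZl// -/J1 muleA -EFinM -expRD in hM.
rewrite ge0_integralZl// in hZ; last by move=> z _; exact: integral_ge0.
rewrite -/J2 muleA -EFinM -expRD in hZ.
have fin a q q' I J : (0 <= I)%E -> (0 <= J)%E -> 0 <= q -> 0 <= q' ->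
    (I <= (expR a)%:E * J)%E -> q <= expR ((c + c') / 4) * q' ->
    a <= c' / 8 + 7 * c' / 12 ->
    (q%:E * I <= q'%:E * ((expR Delta)%:E * J))%E.
  move=> I0 J0 q0 q'0 IJ qq ac.
  apply: (@le_trans _ _ ((expR ((c + c') / 4) * q')%:E * ((expR a)%:E * J))%E).
    by apply: lee_pmul => //; rewrite lee_fin.
  rewrite EFinM [((expR _)%:E * q'%:E)%E]muleC -muleA lee_wpmul2l ?lee_fin//.
  rewrite muleA -EFinM -expRD lee_wpmul2r// lee_fin ler_expR /Delta; lra.
have I10 : (0 <= \int[mu]_z mixE D2 (fun e' => H1 (z, e')))%E.
  by apply: integral_ge0 => z _; apply: integral_ge0 => v _; rewrite mule_ge0// lee_fin.
have I20 : (0 <= \int[mu]_z \int[mu]_h H2 (z, 2 * h)%R)%E.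
  by apply: integral_ge0 => z _; exact: integral_ge0.
have k1 := fin _ _ _ _ _ I10 J10 (Q0 _) (Q0 _) hM (up _ _ D1c) (lexx _).
have k2 := fin _ _ _ _ _ I20 J20 (Q0 _) (Q0 _) hZ (up _ _ D2c) ltac:(lra).
have lo1 : ((1 - exceed (D1 + e))%:E <= (1 - exceed (D1' + (e + c)))%:E)%E.
  by rewrite lee_fin; exact: lo.
have lo2 : ((1 - exceed (D2 + e))%:E <= (1 - exceed (D2' + (e + c)))%:E)%E.
  by rewrite lee_fin; exact: lo.
rewrite eqJ1 eqJ2; apply: (leeD k1); apply: lee_pmul (lo1) _.
- by rewrite lee_fin.
- apply: adde_ge0; apply: mule_ge0; [by rewrite lee_fin|exact: I20|by rewrite lee_fin|exact: E00].
- by apply: (leeD k2); exact: lee_wpmul2r.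
Qed.

End onestep.

(* The draws in the order in which they are used: the first threshold noise and
   then, for the two NSG queries of each step, [Nu], [Z], and the threshold noise
   of an instance started on the next NSG query. *)
Definition draw_seq (j : nat) : draw :=
  match (j %% 3)%N with
  | 0 => DrawEta (j %/ 3)%N
  | 1 => DrawNu (j %/ 3)%N
  | _ => DrawZ (j %/ 3)%N
  end.

Lemma draw_seq_inj : injective draw_seq.
Proof.
move=> i j; rewrite /draw_seq => h.
rewrite (divn_eq i 3) (divn_eq j 3).
have := ltn_pmod i (isT : 0 < 3)%N; have := ltn_pmod j (isT : 0 < 3)%N.
by move: h; case: (i %% 3)%N => [|[|[|//]]]; case: (j %% 3)%N => [|[|[|//]]] // [->].
Qed.

(** * Independence of each draw from the earlier ones *)

Section independence.
Context (R : realType) (d : measure_display) (Omega : measurableType d)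
  (P : probability Omega R) (W : draw -> {RV P >-> R}).
Hypothesis indep : mutually_independent W.

Let V (j : nat) : Omega -> R := W (draw_seq j).

Lemma measurable_draw j : measurable_fun setT (V j).
Proof. exact: measurable_funP. Qed.

Definition past_boxes (j : nat) : set (set Omega) :=
  [set B | exists A : nat -> set R, (forall i, measurable (A i)) /\
     B = \bigcap_(i in `I_j) (V i @^-1` A i)].

Definition past (j : nat) := g_sigma_algebraType (past_boxes j).

Lemma past_boxes_setI j : setI_closed (past_boxes j).
Proof.
move=> _ _ [A [mA ->]] [B [mB ->]]; exists (fun i => A i `&` B i); split.
  by move=> i; exact: measurableI.
by rewrite -bigcapI; apply: eq_bigcapr => i _; rewrite preimage_setI.
Qed.

Lemma past_measurable j (A : set (past j)) : measurable A -> measurable (A : set Omega).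
Proof.
apply: smallest_sub; first exact: sigma_algebra_measurable.
move=> _ [B [mB ->]]; apply: bigcap_measurableType => i _.
by rewrite -[X in measurable X]setTI; exact: measurable_draw.
Qed.

Lemma past_mono i j (A : set Omega) : (i <= j)%N ->
  measurable (A : set (past i)) -> measurable (A : set (past j)).
Proof.
move=> ij; apply: smallest_sub.
  exact: (@sigma_algebra_measurable _ (past j)).
move=> _ [B [mB ->]]; apply: sub_sigma_algebra.
exists (fun k => if (k < i)%N then B k else setT); split.
  by move=> k; case: ifP.
apply/seteqP; split=> w h k /= kj.
  by case: ifPn => // ki; exact: h.
by have := h k (leq_trans kj ij); rewrite /= kj.
Qed.

Lemma past_draw i j : (i < j)%N -> measurable_fun setT (V i : past j -> R).
Proof.
move=> ij _ B mB; rewrite setTI; apply: sub_sigma_algebra.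
exists (fun k => if k == i then B else setT); split.
  by move=> k; case: ifP.
apply/seteqP; split=> w h.
  by move=> k /= kj; case: eqP => // ->.
by have := h i ij; rewrite /= eqxx.
Qed.

Lemma indep_boxes j (A : nat -> set R) : (forall i, measurable (A i)) ->
  (P (\bigcap_(i in `I_j) (V i @^-1` A i)) = \prod_(i < j) P (V i @^-1` A i))%E.
Proof.
move=> mA.
have := @indep j (fun i => draw_seq i) (fun i => A i) _ (fun i => mA i).
rewrite -[in X in _ -> X]/(V _) => <-; last first.
  by move=> a b /draw_seq_inj ab; exact: val_inj.
congr (P _); apply/seteqP; split=> w h.
  by move=> i _; exact: (h i (ltn_ord i)).
by move=> i /= ij; exact: (h (Ordinal ij) I).
Qed.

(** Dynkin's argument: the sets [A] with the product formula form a lambda-system, and the boxes in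
    the earlier draws are closed under intersection and generate [past j]. *)
Lemma indep_past j (A : set (past j)) (B : set R) :
  measurable A -> measurable B ->
  (P (A `&` V j @^-1` B) = P A * P (V j @^-1` B))%E.
Proof.
move=> mA mB.
have mVB : measurable (V j @^-1` B).
  by rewrite -[X in measurable X]setTI; exact: measurable_draw.
pose H : set (set Omega) := [set A | measurable A /\
  (P (A `&` V j @^-1` B) = P A * P (V j @^-1` B))%E].
suff : <<s past_boxes j >> `<=` H by move=> /(_ _ mA)[].
apply: (lambda_system_subset (@past_boxes_setI j)) => //; last first.
  move=> _ [C [mC ->]]; split.
    apply: bigcap_measurableType => i _.
    by rewrite -[X in measurable X]setTI; exact: measurable_draw.
  rewrite indep_boxes//.
  pose C' i := if i == j then B else C i.
  have mC' i : measurable (C' i) by rewrite /C'; case: ifP.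
  transitivity (P (\bigcap_(i in `I_j.+1) (V i @^-1` C' i))).
    congr (P _); apply/seteqP; split=> w.
      move=> [h1 h2] i /=; rewrite ltnS leq_eqVlt /C'.
      by case: eqP => [->//|_ /= ij]; exact: h1.
    move=> h; split.
      move=> i /= ij; have := h i (ltnW ij); rewrite /C' /=.
      by case: eqP ij => // ->; rewrite ltnn.
    by have := h j (ltnSn j); rewrite /C' /= eqxx.
  rewrite indep_boxes// big_ord_recr/= /C' eqxx; congr (_ * _)%E.
  by apply: eq_bigr => i _; rewrite ltn_eqF.
split.
- by [].
- by split => //; rewrite setTI probability_setT mul1e.
- move=> C D DC [mC hC] [mD hD]; split; first exact: measurableD.
  have fC : P C \is a fin_num by exact: fin_num_measure.
  have fD : P D \is a fin_num by exact: fin_num_measure.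
  have fB : P (V j @^-1` B) \is a fin_num by exact: fin_num_measure.
  have -> : (C `\` D) `&` V j @^-1` B = (C `&` V j @^-1` B) `\` (D `&` V j @^-1` B).
    apply/seteqP; split=> w /=; first by move=> [[Cw nDw] Bw]; split => // -[].
    by move=> [[Cw Bw] nDB]; split => //; split => // Dw; exact: nDB.
  have eD : P (C `\` D) = (P C - P D)%E.
    by rewrite measureD ?(setIidr DC)// -ge0_fin_numE.
  have eDB : P ((C `&` V j @^-1` B) `\` (D `&` V j @^-1` B))
      = (P (C `&` V j @^-1` B) - P (D `&` V j @^-1` B))%E.
    have m1 : measurable (C `&` V j @^-1` B) by exact: measurableI.
    have m2 : measurable (D `&` V j @^-1` B) by exact: measurableI.
    have i12 : C `&` V j @^-1` B `&` (D `&` V j @^-1` B) = D `&` V j @^-1` B.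
      apply/seteqP; split=> w; first by case.
      by move=> [Dw Bw]; split; split => //; exact: DC.
    have f1 : (P (C `&` V j @^-1` B) < +oo)%E.
      by rewrite -ge0_fin_numE//; exact: fin_num_measure.
    by rewrite (measureD m1 m2 f1) i12.
  by rewrite eDB hC hD eD muleBl// fin_num_adde_defr// fin_numN.
- move=> F ndF HF.
  have mF n : measurable (F n) by have [] := HF n.
  split; first exact: bigcupT_measurable.
  rewrite setI_bigcupl.
  have ndFB : nondecreasing_seq (fun n => F n `&` V j @^-1` B).
    move=> a b ab; apply/subsetPset; apply: setSI.
    by have /subsetPset := ndF _ _ ab.
  have c1 := nondecreasing_cvg_mu (mu := P) mF (bigcupT_measurable _ mF) ndF.
  have mFB n : measurable (F n `&` V j @^-1` B) by exact: measurableI.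
  have c2 := nondecreasing_cvg_mu (mu := P) mFB (bigcupT_measurable _ mFB) ndFB.
  have c3 : (P \o (fun n => F n `&` V j @^-1` B)) @ \oo -->
      (P (\bigcup_n F n) * P (V j @^-1` B))%E.
    rewrite (_ : _ \o _ = (fun n => P (F n) * P (V j @^-1` B))%E); last first.
      by apply/funext => n /=; have [_ ->] := HF n.
    by apply: cvgeZr => //; exact: fin_num_measure.
  exact: cvg_unique c2 c3.
Qed.

Hypothesis laplaceW : forall i, has_laplace_law 1 (W i).
Let mu : probability R R := distribution P (W (draw_seq 0)).

Lemma draw_law j (B : set R) : measurable B -> P (V j @^-1` B) = mu B.
Proof.
move=> mB; rewrite /mu -[LHS]/(distribution P (W (draw_seq j)) B).
exact: etrans (laplaceW _ mB) (esym (laplaceW _ mB)).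
Qed.

(** By [indep_past] the joint law of [Z] and the j-th draw agrees with the product of their laws on
    rectangles, hence everywhere, and Tonelli's theorem integrates the draw out. [mu] is the law of
    draw 0, shared by all draws. *)
Lemma disintegration j (d' : measure_display) (T : measurableType d')
    (Z : Omega -> T) (f : T * R -> \bar R) :
  measurable_fun setT (Z : past j -> T) ->
  measurable_fun setT f -> (forall x, 0 <= f x)%E ->
  (\int[P]_w f (Z w, V j w) = \int[P]_w \int[mu]_v f (Z w, v))%E.
Proof.
move=> mZ mf f0.
have mZ' : measurable_fun setT Z.
  by move=> _ B mB; apply: (@past_measurable j); exact: mZ.
have mZV : measurable_fun setT (fun w => (Z w, V j w)).
  by apply: measurable_fun_pair => //; exact: measurable_draw.
pose Zm : {mfun Omega >-> T} := HB.pack Z (isMeasurableFun.Build _ _ _ _ _ mZ').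
pose ZVm : {mfun Omega >-> (T * R)%type} :=
  HB.pack (fun w => (Z w, V j w)) (isMeasurableFun.Build _ _ _ _ _ mZV).
pose m1 : probability T R := distribution P Zm.
pose m' : probability (T * R)%type R := distribution P ZVm.
have E A B : measurable A -> measurable B -> m' (A `*` B) = (m1 A * mu B)%E.
  move=> mA mB.
  transitivity (P (Z @^-1` A `&` V j @^-1` B)); first by [].
  rewrite indep_past//; last by rewrite -[X in measurable X]setTI; exact: mZ.
  by congr (_ * _)%E; exact: draw_law.
transitivity (\int[m']_x f x)%E.
  by rewrite /m' ge0_integral_distribution.
transitivity (\int[(m1 \x mu)%E]_x f x)%E.
  apply: eq_measure_integral => A mA _.
  exact: esym (product_measure_unique E mA).
rewrite fubini_tonelli1//= /fubini_F/= /m1 ge0_integral_distribution//.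
  exact: measurable_integral_snd.
by move=> x; apply: integral_ge0.
Qed.

End independence.

(** * Measurability of discrete case distinctions and of lists of answers *)

Lemma measurable_invr (R : realType) : measurable_fun setT (fun x : R => x^-1).
Proof.
rewrite (_ : (fun x => x^-1) = (fun x : R =>
   if x < 0 then - ((- x) `^ (- 1)) else x `^ (- 1))); last first.
  apply/funext => x; case: ltP => x0; last by rewrite powR_inv1.
  by rewrite powR_inv1 ?invrN ?opprK// oppr_ge0 ltW.
apply: measurable_fun_ifT.
- by apply: measurable_fun_ltr => //; exact: measurable_cst.
- apply: measurableT_comp => //.
  exact: (measurableT_comp (@measurable_powR R (- 1)) (@oppr_measurable R setT)).
- exact: measurable_powR.
Qed.

Lemma measurable_fun_natP (d : measure_display) (T : measurableType d)
    (f : T -> nat) : (forall k, measurable [set x | f x = k]) ->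
  measurable_fun setT f.
Proof.
move=> h _ B _; rewrite setTI.
rewrite (_ : _ @^-1` _ = \bigcup_(k in B) [set x | f x = k]).
  by apply: bigcup_measurable.
by apply/seteqP; split=> x /=; [move=> Bx; exists (f x)|move=> [k Bk /= ->]].
Qed.

(** Case distinctions on counts, times and status codes reduce to the measurability of each branch
    with the code fixed. *)
Lemma measurable_fun_nat_dep (d d' : measure_display) (T : measurableType d)
    (U : measurableType d') (f : T -> nat) (F : nat -> T -> U) :
  measurable_fun setT f -> (forall k, measurable_fun setT (F k)) ->
  measurable_fun setT (fun x => F (f x) x).
Proof.
move=> mf mF _ B mB; rewrite setTI.
rewrite (_ : _ @^-1` _ = \bigcup_k ([set x | f x = k] `&` F k @^-1` B)).
  apply: bigcupT_measurable => k; apply: measurableI.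
    by have := mf measurableT [set k] I; rewrite setTI.
  by have := mF k measurableT B mB; rewrite setTI.
apply/seteqP; split=> x /=; first by move=> Bx; exists (f x).
by move=> [k _ [/= <-]].
Qed.

HB.instance Definition _ (T : choiceType) := isPointed.Build (seq T) [::].

Section answer_lists.
Context (R : realType).

(** These sets generate the disjoint union of the sigma-algebras on k-tuples for all k. Queries are
    assumed measurable on tuples of each length, which is measurability on this space. *)
Definition answer_sets : set (set (seq R)) :=
  [set A | exists k (B : set (k.-tuple R)), measurable B /\
     A = [set h : seq R | exists2 t : k.-tuple R, B t & h = t :> seq R]].

Local Notation answer_list := (g_sigma_algebraType answer_sets).

Lemma measurable_size_eq k : measurable [set h : answer_list | size h = k].
Proof.
apply: sub_sigma_algebra; exists k, setT; split => //.
apply/seteqP; split=> h /=; first by move=> <-; exists (in_tuple h).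
by move=> [t _ ->]; rewrite size_tuple.
Qed.

Lemma measurable_answer_set k (B : set (k.-tuple R)) : measurable B ->
  measurable [set h : answer_list | exists2 t : k.-tuple R, B t & h = t :> seq R].
Proof. by move=> mB; apply: sub_sigma_algebra; exists k, B. Qed.

Lemma measurable_size : measurable_fun setT (size : answer_list -> nat).
Proof. by apply: measurable_fun_natP => k; exact: measurable_size_eq. Qed.

Lemma measurable_fun_answer_list (d : measure_display) (U : measurableType d)
    (f : answer_list -> U) :
  (forall k, measurable_fun setT (fun t : k.-tuple R => f t)) ->
  measurable_fun setT f.
Proof.
move=> mf _ B mB; rewrite setTI.
rewrite (_ : _ @^-1` _ = \bigcup_k [set h : answer_list |
    exists2 t : k.-tuple R, ((fun t : k.-tuple R => f t) @^-1` B) t & h = t :> seq R]).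
  apply: bigcupT_measurable => k; apply: measurable_answer_set.
  by have := mf k measurableT B mB; rewrite setTI.
apply/seteqP; split=> h /=.
  by move=> Bh; exists (size h) => //; exists (in_tuple h).
by move=> [k _ [t /= Bt ->]].
Qed.

Lemma measurable_answer_nth i :
  measurable_fun setT (fun h : answer_list => nth 0 h i).
Proof.
apply: measurable_fun_answer_list => k.
have [ik|ik] := ltnP i k.
  rewrite (_ : (fun t : k.-tuple R => nth 0 t i) = fun t => tnth t (Ordinal ik)).
    exact: measurable_tnth.
  by apply/funext => t; rewrite (tnth_nth 0).
rewrite (_ : (fun t : k.-tuple R => nth 0 t i) = cst 0); first exact: measurable_cst.
by apply/funext => t; rewrite nth_default// size_tuple.
Qed.

Lemma measurable_fun_rcons (d : measure_display) (T : measurableType d)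
    (f : T -> answer_list) (a : T -> R) :
  measurable_fun setT f -> measurable_fun setT a ->
  measurable_fun setT (fun x => rcons (f x) (a x) : answer_list).
Proof.
move=> mf ma.
pose r x : answer_list := rcons (f x) (a x).
suff sub : answer_sets `<=` [set B | measurable (r @^-1` B)].
  move=> _ B mB; rewrite setTI.
  apply: (smallest_sub _ sub mB); split.
  - by rewrite /= preimage_set0.
  - by move=> A mA; rewrite /= setTD preimage_setC; exact: measurableC.
  - move=> A mA; rewrite /= preimage_bigcup; exact: bigcupT_measurable.
move=> _ [k [B [mB ->]]] /=.
case: k B mB => [|k] B mB.
  rewrite (_ : _ @^-1` _ = set0)//.
  apply/seteqP; split=> x //= [t _].
  by rewrite (tuple0 t) /r; case: (f x).
have ms := measurableT_comp measurable_size mf.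
have mn i : measurable_fun setT (fun x => nth 0 (f x) i).
  exact: (measurableT_comp (measurable_answer_nth i) mf).
pose g (x : T) : k.+1.-tuple R :=
  [tuple if (i < k)%N then nth 0 (f x) i else a x | i < k.+1].
have mg : measurable_fun setT g.
  apply/measurable_fun_tnthP => i.
  rewrite (_ : _ \o _ = fun x => if (i < k)%N then nth 0 (f x) i else a x).
    by case: (i < k)%N.
  by apply/funext => x /=; rewrite tnth_mktuple.
rewrite (_ : _ @^-1` _ = [set x | size (f x) = k] `&` g @^-1` B).
  apply: measurableI.
    by have := ms measurableT [set k] I; rewrite setTI.
  by have := mg measurableT B mB; rewrite setTI.
have gE x : size (f x) = k -> rcons (f x) (a x) = g x.
  move=> sk; apply: (@eq_from_nth _ 0); first by rewrite size_rcons size_tuple sk.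
  rewrite size_rcons sk => i ik.
  rewrite -[i]/(val (Ordinal ik)) -tnth_nth tnth_mktuple/= nth_rcons sk.
  by case: ltnP => // ki; rewrite (_ : i == k)// eqn_leq ki andbT -ltnS.
apply/seteqP; split=> x /=.
  move=> [t Bt E].
  have sk : size (f x) = k.
    by have := congr1 size E; rewrite size_rcons size_tuple => -[].
  split => //; rewrite (_ : g x = t)//; apply: val_inj.
  by rewrite /= -[LHS]gE.
by move=> [sk Bg]; exists (g x) => //; exact: gE.
Qed.

End answer_lists.

Notation answer_list R := (g_sigma_algebraType (@answer_sets R)).

(** * The state of the algorithm *)

Section machine.
Context (R : realType) (N n : nat) (eps alpha : R).

(* The public part of the state: the answers, the histogram y, the hard-query
   count, the code of the last arrival time (0 for none, t.+1 for t), the status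
   (0 running, 1 halted with Bot, 2 no further query); and, for the analysis only,
   the shift c that the current threshold noise is coupled with and the privacy
   loss incurred so far. *)
Definition public := (answer_list R * (N.-tuple R) * (nat * nat * nat) * (R * R))%type.

Definition p_ans (h : public) : seq R := h.1.1.1.
Definition p_y (h : public) : N.-tuple R := h.1.1.2.
Definition p_hard (h : public) : nat := h.1.2.1.1.
Definition p_last (h : public) : nat := h.1.2.1.2.
Definition p_status (h : public) : nat := h.1.2.2.
Definition p_c (h : public) : R := h.2.1.
Definition p_loss (h : public) : R := h.2.2.

Definition time_code (o : option nat) : nat := if o is Some t then t.+1 else 0.
Definition time_decode (k : nat) : option nat := if k is t.+1 then Some t else None.

Local Notation xi t := (pmwg_xi N n eps 0 alpha t).
Definition pmwg_c (t : nat) : R := xi t / t%:R.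

(** No query arrives before time [n], so the first instance is coupled with the shift [pmwg_c n];
    half of it is the initial loss because the shifted noise is Lap(2). *)
Definition pub0 : public :=
  ([::], [tuple N%:R^-1 | i < N], (0, 0, 0)%N, (pmwg_c n, pmwg_c n / 2)).

Variables (F : query_stream R N n).

Definition cur_query (h : public) : 'I_N -> R := qry F (p_ans h).

Definition cur_y (t : nat) (h : public) : 'I_N -> R :=
  pmwg_mix (time_decode (p_last h)) t (tnth (p_y h)).

Definition cur_fy (t : nat) (h : public) : R := eval (cur_query h) (cur_y t h).

(** The exponent [Delta] of [onestep_le], with the shift of the instance that fires as c and
    [pmwg_c t] as c'. *)
Definition step_loss (t : nat) (h : public) : R :=
  p_c h / 4 + 3 * pmwg_c t / 8 + 7 * pmwg_c t / 12.

Definition easy_pub (t : nat) (h : public) : public :=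
  (rcons (p_ans h) (cur_fy t h), [tuple cur_y t h i | i < N],
   (p_hard h, t.+1, 0)%N, (p_c h, p_loss h)).

(** Halting is charged like an answered hard query, since [Bot] also reveals that a comparison has
    fired. *)
Definition hard_pub (t : nat) (h : public) (a : R) : public :=
  if pmwg_max_hard N n alpha t < (p_hard h).+1%:R
  then (p_ans h, p_y h, (p_hard h, p_last h, 1)%N,
        (pmwg_c t, p_loss h + step_loss t h))
  else (rcons (p_ans h) a,
        [tuple mw_update alpha
                 (if a < cur_fy t h then cur_query h else fun i => 1 - cur_query h i)
                 (cur_y t h) i | i < N],
        ((p_hard h).+1, t.+1, 0)%N,
        (pmwg_c t, p_loss h + step_loss t h)).

Definition end_pub (h : public) : public :=
  (p_ans h, p_y h, (p_hard h, p_last h, 2)%N, (p_c h, p_loss h)).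

Definition cur_g (x : 'I_N -> R) (t : nat) (h : public) : R :=
  eval (cur_query h) x - cur_fy t h.

(* The comparisons of the two NATG calls are multiplied by xi_t, so that they
   read [xi (T -/+ g) + e <= 4 nu]. *)
Definition step_at (x : 'I_N -> R) (t : nat) (h : public) (e a z eta a' z' eta' : R)
  : public * R :=
  let g := cur_g x t h in
  let T := 2 * alpha / 3 in
  if xi t * (T - g) + e <= 4 * a
  then (hard_pub t h (cur_fy t h + (g + 8 / xi t * z)),
        if xi t * (T + g) + 2 * eta <= 4 * a' then 2 * eta' else 2 * eta)
  else if xi t * (T + g) + e <= 4 * a'
  then (hard_pub t h (cur_fy t h - (- g + 8 / xi t * z')), 2 * eta')
  else (easy_pub t h, e).

Definition step (X : db_stream N n) (s : public * R) (a z eta a' z' eta' : R)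
  : public * R :=
  if p_status s.1 is 0%N then
    if qtime F (p_ans s.1) is Some t then
      step_at (histogram R X t) t s.1 s.2 a z eta a' z' eta'
    else (end_pub s.1, s.2)
  else s.

Lemma measurable_qtime :
  measurable_fun setT (fun h : answer_list R => time_code (qtime F h)).
Proof.
have mS t : measurable [set h : answer_list R | qtime F h = Some t].
  rewrite (_ : [set h | _] = \bigcup_k [set h : answer_list R |
      exists2 u : k.-tuple R, [set u : k.-tuple R | qtime F u = Some t] u & h = u :> seq R]).
    by apply: bigcupT_measurable => k; apply: measurable_answer_set; exact: qtime_measurable.
  apply/seteqP; split=> h /=.
    by move=> ht; exists (size h) => //; exists (in_tuple h).
  by move=> [k _ [u /= ut ->]].
apply: measurable_fun_natP => -[|t].
  rewrite (_ : [set h | _] = ~` \bigcup_t [set h : answer_list R | qtime F h = Some t]).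
    by apply: measurableC; exact: bigcupT_measurable.
  apply/seteqP; split=> h /=; last by case E: (qtime F h) => [t|] // []; exists t.
  by move=> h0 [t _ /= ht]; rewrite ht in h0.
rewrite (_ : [set h | _] = [set h : answer_list R | qtime F h = Some t])//.
apply/seteqP; split=> h /=; last by move=> ->.
by case: (qtime F h) => //= t' [->].
Qed.

Lemma measurable_qry i : measurable_fun setT (fun h : answer_list R => qry F h i).
Proof. by apply: measurable_fun_answer_list => k; exact: qry_measurable. Qed.

Section measurability.
Context (d : measure_display) (T : measurableType d) (h : T -> public).
Hypothesis mh : measurable_fun setT h.

Lemma measurable_p_ans : measurable_fun setT (fun x => p_ans (h x) : answer_list R).
Proof.
exact: (measurableT_comp measurable_fst (measurableT_comp measurable_fst
  (measurableT_comp measurable_fst mh))).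
Qed.

Lemma measurable_p_y i : measurable_fun setT (fun x => tnth (p_y (h x)) i).
Proof.
exact: (measurableT_comp (measurable_tnth i) (measurableT_comp measurable_snd
  (measurableT_comp measurable_fst (measurableT_comp measurable_fst mh)))).
Qed.

Lemma measurable_p_ytuple : measurable_fun setT (fun x => p_y (h x)).
Proof.
exact: (measurableT_comp measurable_snd
  (measurableT_comp measurable_fst (measurableT_comp measurable_fst mh))).
Qed.

Lemma measurable_p_hard : measurable_fun setT (fun x => p_hard (h x)).
Proof.
exact: (measurableT_comp measurable_fst (measurableT_comp measurable_fst
  (measurableT_comp measurable_snd (measurableT_comp measurable_fst mh)))).
Qed.

Lemma measurable_p_last : measurable_fun setT (fun x => p_last (h x)).
Proof.
exact: (measurableT_comp measurable_snd (measurableT_comp measurable_fst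
  (measurableT_comp measurable_snd (measurableT_comp measurable_fst mh)))).
Qed.

Lemma measurable_p_status : measurable_fun setT (fun x => p_status (h x)).
Proof.
exact: (measurableT_comp measurable_snd (measurableT_comp measurable_snd
  (measurableT_comp measurable_fst mh))).
Qed.

Lemma measurable_p_c : measurable_fun setT (fun x => p_c (h x)).
Proof. exact: (measurableT_comp measurable_fst (measurableT_comp measurable_snd mh)). Qed.

Lemma measurable_p_loss : measurable_fun setT (fun x => p_loss (h x)).
Proof. exact: (measurableT_comp measurable_snd (measurableT_comp measurable_snd mh)). Qed.

Lemma measurable_cur_query i : measurable_fun setT (fun x => cur_query (h x) i).
Proof. exact: (measurableT_comp (measurable_qry i) measurable_p_ans). Qed.

Lemma measurable_cur_y t i : measurable_fun setT (fun x => cur_y t (h x) i).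
Proof.
apply: (measurable_fun_nat_dep (F := fun l x =>
  pmwg_mix (time_decode l) t (tnth (p_y (h x))) i) measurable_p_last) => -[|l] /=.
  exact: measurable_p_y.
case: (l < t)%N; last exact: measurable_p_y.
apply: measurable_funD; last exact: measurable_cst.
by apply: measurable_funM; [exact: measurable_cst|exact: measurable_p_y].
Qed.

Lemma measurable_fun_eval (f y : T -> 'I_N -> R) :
  (forall i, measurable_fun setT (f ^~ i)) ->
  (forall i, measurable_fun setT (y ^~ i)) ->
  measurable_fun setT (fun x => eval (f x) (y x)).
Proof.
move=> mf my; apply: measurable_sum => i.
exact: measurable_funM.
Qed.

Lemma measurable_cur_fy t : measurable_fun setT (fun x => cur_fy t (h x)).
Proof.
apply: measurable_fun_eval => i; first exact: measurable_cur_query.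
exact: measurable_cur_y.
Qed.

Lemma measurable_cur_g x0 t : measurable_fun setT (fun x => cur_g x0 t (h x)).
Proof.
apply: measurable_funB; last exact: measurable_cur_fy.
apply: measurable_fun_eval => i; first exact: measurable_cur_query.
exact: measurable_cst.
Qed.

Lemma measurable_mktuple (f : T -> 'I_N -> R) :
  (forall i, measurable_fun setT (f ^~ i)) ->
  measurable_fun setT (fun x => [tuple f x i | i < N]).
Proof.
move=> mf; apply/measurable_fun_tnthP => i.
rewrite (_ : _ \o _ = f ^~ i)//.
by apply/funext => x /=; rewrite tnth_mktuple.
Qed.

Lemma measurable_easy_pub t : measurable_fun setT (fun x => easy_pub t (h x)).
Proof.
apply: measurable_fun_pair; [apply: measurable_fun_pair;[apply: measurable_fun_pair|]|].
- apply: measurable_fun_rcons; [exact: measurable_p_ans|exact: measurable_cur_fy].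
- by apply: measurable_mktuple => i; exact: measurable_cur_y.
- apply: measurable_fun_pair; last exact: measurable_cst.
  apply: measurable_fun_pair; [exact: measurable_p_hard|exact: measurable_cst].
- apply: measurable_fun_pair; [exact: measurable_p_c|exact: measurable_p_loss].
Qed.

Lemma measurable_end_pub : measurable_fun setT (fun x => end_pub (h x)).
Proof.
apply: measurable_fun_pair; [apply: measurable_fun_pair|].
- by apply: measurable_fun_pair; [exact: measurable_p_ans|exact: measurable_p_ytuple].
- apply: measurable_fun_pair; last exact: measurable_cst.
  apply: measurable_fun_pair; [exact: measurable_p_hard|exact: measurable_p_last].
- apply: measurable_fun_pair; [exact: measurable_p_c|exact: measurable_p_loss].
Qed.

Lemma measurable_hard_pub t (a : T -> R) : measurable_fun setT a ->
  measurable_fun setT (fun x => hard_pub t (h x) (a x)).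
Proof.
move=> ma.
have ml : measurable_fun setT (fun x => (pmwg_c t, p_loss (h x) + step_loss t (h x))).
  apply: measurable_fun_pair; first exact: measurable_cst.
  apply: measurable_funD; first exact: measurable_p_loss.
  apply: measurable_funD; last exact: measurable_cst.
  apply: measurable_funD; last exact: measurable_cst.
  by apply: measurable_funM; [exact: measurable_p_c|exact: measurable_cst].
apply: measurable_fun_ifT.
- apply: (measurable_fun_nat_dep (F := fun k x =>
    pmwg_max_hard N n alpha t < k.+1%:R) measurable_p_hard) => k.
  exact: measurable_cst.
- apply: measurable_fun_pair => //; apply: measurable_fun_pair.
    by apply: measurable_fun_pair; [exact: measurable_p_ans|exact: measurable_p_ytuple].
  apply: measurable_fun_pair; last exact: measurable_cst.
  apply: measurable_fun_pair; [exact: measurable_p_hard|exact: measurable_p_last].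
apply: measurable_fun_pair => //; apply: measurable_fun_pair; last first.
  apply: measurable_fun_pair; last exact: measurable_cst.
  apply: measurable_fun_pair; last exact: measurable_cst.
  by apply: (measurable_fun_nat_dep (F := fun k x => k.+1) measurable_p_hard) => k;
    exact: measurable_cst.
apply: measurable_fun_pair.
  by apply: measurable_fun_rcons => //; exact: measurable_p_ans.
apply: measurable_mktuple => i.
have mr j : measurable_fun setT (fun x =>
    (if a x < cur_fy t (h x) then cur_query (h x) else fun i => 1 - cur_query (h x) i) j).
  rewrite (_ : (fun x => _) = fun x =>
    if a x < cur_fy t (h x) then cur_query (h x) j else 1 - cur_query (h x) j).
    apply: measurable_fun_ifT.
    - by apply: measurable_fun_ltr => //; exact: measurable_cur_fy.
    - exact: measurable_cur_query.
    - by apply: measurable_funB; [exact: measurable_cst|exact: measurable_cur_query].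
  by apply/funext => x; case: ifP.
have mye j : measurable_fun setT (fun x => cur_y t (h x) j * expR (- (alpha *
    (if a x < cur_fy t (h x) then cur_query (h x) else fun i => 1 - cur_query (h x) i) j / 6))).
  apply: measurable_funM; first exact: measurable_cur_y.
  apply: measurableT_comp => //; apply: measurableT_comp => //.
  apply: measurable_funM; last exact: measurable_cst.
  by apply: measurable_funM; first exact: measurable_cst.
apply: measurable_funM; first exact: mye.
apply: (measurableT_comp (@measurable_invr R)).
by apply: measurable_sum => j; exact: mye.
Qed.

Lemma measurable_step X (e a z eta a' z' eta' : T -> R) :
  measurable_fun setT e -> measurable_fun setT a -> measurable_fun setT z ->
  measurable_fun setT eta -> measurable_fun setT a' -> measurable_fun setT z' ->
  measurable_fun setT eta' ->
  measurable_fun setT (fun x =>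
    step X (h x, e x) (a x) (z x) (eta x) (a' x) (z' x) (eta' x)).
Proof.
move=> me ma mz meta ma' mz' meta'.
have msc k (f : T -> R) : measurable_fun setT f -> measurable_fun setT (fun x => k * f x).
  by move=> mf; apply: measurable_funM => //; exact: measurable_cst.
have mhe : measurable_fun setT (fun x => (h x, e x)) by exact: measurable_fun_pair.
apply: (measurable_fun_nat_dep (F := fun k x => if k is 0%N then
    if qtime F (p_ans (h x)) is Some t then
      step_at (histogram R X t) t (h x) (e x) (a x) (z x) (eta x) (a' x) (z' x) (eta' x)
    else (end_pub (h x), e x) else (h x, e x)) measurable_p_status) => -[|k] //.
have mq := measurableT_comp measurable_qtime measurable_p_ans.
pose G k x := if k is t.+1 then
    step_at (histogram R X t) t (h x) (e x) (a x) (z x) (eta x) (a' x) (z' x) (eta' x)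
  else (end_pub (h x), e x).
rewrite (_ : (fun x => _) = fun x => G (time_code (qtime F (p_ans (h x)))) x); last first.
  by apply/funext => x; case: (qtime F _).
apply: (@measurable_fun_nat_dep _ _ _ _ _ G mq) => -[|t].
  by apply: measurable_fun_pair => //; exact: measurable_end_pub.
have mg := measurable_cur_g (histogram R X t) t.
have mfy := measurable_cur_fy t.
have mlo s : measurable_fun setT (fun x => xi t * (2 * alpha / 3 + s * cur_g (histogram R X t) t (h x))).
  by apply: (msc _ _); apply: measurable_funD; [exact: measurable_cst|exact: msc].
have mlo1 : measurable_fun setT (fun x => xi t * (2 * alpha / 3 - cur_g (histogram R X t) t (h x))).
  by under eq_fun do rewrite -mulN1r; exact: mlo.
have mlo2 : measurable_fun setT (fun x => xi t * (2 * alpha / 3 + cur_g (histogram R X t) t (h x))).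
  by have := mlo 1; under eq_fun do rewrite mul1r.
apply: measurable_fun_ifT.
- by apply: measurable_fun_ler; [exact: measurable_funD|exact: msc].
- apply: measurable_fun_pair.
    apply: measurable_hard_pub; apply: measurable_funD => //.
    by apply: measurable_funD => //; exact: msc.
  apply: measurable_fun_ifT; [|exact: msc|exact: msc].
  by apply: measurable_fun_ler; [apply: measurable_funD => //; exact: msc|exact: msc].
apply: measurable_fun_ifT.
- by apply: measurable_fun_ler; [exact: measurable_funD|exact: msc].
- apply: measurable_fun_pair; last exact: msc.
  apply: measurable_hard_pub; apply: measurable_funB => //.
  apply: measurable_funD; last exact: msc.
  exact: measurableT_comp.
- by apply: measurable_fun_pair => //; exact: measurable_easy_pub.
Qed.

End measurability.

End machine.

(** * Expectation over one step, and the coupling of two runs *)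

Section section_integral.
Context (R : realType) (mu : probability R R).

Definition sint (d : measure_display) (T : measurableType d)
    (f : T * R -> \bar R) (x : T) : \bar R := (\int[mu]_v f (x, v))%E.

Context (d : measure_display) (T : measurableType d).
Implicit Types f : T * R -> \bar R.

Lemma measurable_sint f : measurable_fun setT f -> (forall x, 0 <= f x)%E ->
  measurable_fun setT (sint f).
Proof. exact: measurable_integral_snd. Qed.

Lemma sint_ge0 f : (forall x, 0 <= f x)%E -> forall x, (0 <= sint f x)%E.
Proof. by move=> f0 x; exact: integral_ge0. Qed.

Lemma sint_scale f (k : R) : measurable_fun setT f -> (forall x, 0 <= f x)%E ->
  0 <= k -> sint (fun x => k%:E * f x)%E = (fun x => k%:E * sint f x)%E.
Proof.
move=> mf f0 k0; apply/funext => x; rewrite /sint ge0_integralZl//.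
exact: (measurableT_comp mf (pair1_measurable x)).
Qed.

End section_integral.

Lemma eval_histogram_neighboring (R : realType) (N n : nat) (X X' : db_stream N n)
    (f : 'I_N -> R) (t : nat) :
  (0 < n)%N -> (n <= t)%N -> (forall i, 0 <= f i <= 1) -> neighboring X X' ->
  `|eval f (histogram R X t) - eval f (histogram R X' t)| <= t%:R^-1.
Proof.
move=> n0 nt f01 [t0 [_ same nb]].
have t_gt0 : 0 < t%:R :> R by rewrite ltr0n (leq_trans n0).
have [tt0|tt0] := ltnP t t0.
  rewrite (_ : eval _ _ = eval f (histogram R X' t)) ?subrr ?normr0 ?invr_ge0 ?ltW//.
  by apply: eq_bigr => i _; rewrite /histogram same// nt tt0.
have [i [j [ij cc]]] := nb t tt0.
rewrite /Defs.eval -sumrB.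
rewrite (_ : \sum_k _ = (f i - f j) / t%:R); last first.
  under eq_bigr => k _.
    rewrite /histogram -mulrBr -mulrBl mulrA.
    rewrite (_ : (counts X t k)%:R - (counts X' t k)%:R = (k == i)%:R - (k == j)%:R :> R); last first.
      by have /(congr1 (fun m => m%:R : R)) := cc k; rewrite !natrD; lra.
    over.
  rewrite -mulr_suml; congr (_ / _).
  under eq_bigr do rewrite mulrBr.
  rewrite sumrB; congr (_ - _).
    by rewrite (bigD1 i)//= eqxx mulr1 big1 ?addr0// => k /negbTE ->; rewrite mulr0.
  by rewrite (bigD1 j)//= eqxx mulr1 big1 ?addr0// => k /negbTE ->; rewrite mulr0.
rewrite normrM normfV (ger0_norm (ltW t_gt0)) ler_piMl// ?invr_ge0 ?(ltW t_gt0)//.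
by have /andP[? ?] := f01 i; have /andP[? ?] := f01 j; rewrite ler_norml; lra.
Qed.

Section run.
Context (R : realType) (N n : nat) (eps alpha : R) (F : query_stream R N n).
Local Notation public := (public R N).

(** Draw 0 is the first threshold noise and step k owns the draws 6k + 1 to 6k + 6, even after the
    run is over. Hence the state before step k depends on the first 6k + 1 draws only. *)
Fixpoint mrun (X : db_stream N n) (u : draw -> R) (k : nat) : public * R :=
  if k is k'.+1 then
    let v j := u (draw_seq (6 * k' + j)) in
    step eps alpha F X (mrun X u k') (v 1%N) (v 2%N) (v 3%N) (v 4%N) (v 5%N) (v 6%N)
  else (pub0 N n eps alpha, 2 * u (draw_seq 0)).

Definition stepF (X : db_stream N n) (phi : public * R -> \bar R)
    (q : ((((((public * R) * R) * R) * R) * R) * R) * R) : \bar R :=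
  phi (step eps alpha F X q.1.1.1.1.1.1 q.1.1.1.1.1.2 q.1.1.1.1.2 q.1.1.1.2 q.1.1.2 q.1.2 q.2).

Lemma measurable_stepF X phi : measurable_fun setT phi ->
  measurable_fun setT (stepF X phi).
Proof.
move=> mphi; apply: (measurableT_comp mphi).
have m1 (d1 d2 d3 : measure_display) (T1 : measurableType d1) (T2 : measurableType d2)
    (T3 : measurableType d3) (f : T1 -> T2 * T3) : measurable_fun setT f ->
    measurable_fun setT (fun x => (f x).1).
  by move=> mf; exact: (measurableT_comp measurable_fst mf).
have m2 (d1 d2 d3 : measure_display) (T1 : measurableType d1) (T2 : measurableType d2)
    (T3 : measurableType d3) (f : T1 -> T2 * T3) : measurable_fun setT f ->
    measurable_fun setT (fun x => (f x).2).
  by move=> mf; exact: (measurableT_comp measurable_snd mf).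
pose Q := ((((((public * R) * R) * R) * R) * R) * R * R)%type.
have := @measurable_step R N n eps alpha F _ Q (fun q => q.1.1.1.1.1.1.1) _ X
  (fun q => q.1.1.1.1.1.1.2) (fun q => q.1.1.1.1.1.2) (fun q => q.1.1.1.1.2)
  (fun q => q.1.1.1.2) (fun q => q.1.1.2) (fun q => q.1.2) (fun q => q.2).
have mid : measurable_fun setT (fun q : Q => q) by exact: measurable_id.
have p1 := m1 _ _ _ _ _ _ _ mid.
have p2 := m1 _ _ _ _ _ _ _ p1.
have p3 := m1 _ _ _ _ _ _ _ p2.
have p4 := m1 _ _ _ _ _ _ _ p3.
have p5 := m1 _ _ _ _ _ _ _ p4.
have p6 := m1 _ _ _ _ _ _ _ p5.
move=> /(_ (m1 _ _ _ _ _ _ _ p6) (m2 _ _ _ _ _ _ _ p6) (m2 _ _ _ _ _ _ _ p5)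
  (m2 _ _ _ _ _ _ _ p4) (m2 _ _ _ _ _ _ _ p3) (m2 _ _ _ _ _ _ _ p2)
  (m2 _ _ _ _ _ _ _ p1) (m2 _ _ _ _ _ _ _ mid)).
congr (measurable_fun _ _); apply/funext => q.
by case: (q.1.1.1.1.1.1).
Qed.

Section stepE.
Context (mu : probability R R).
Definition stepE (X : db_stream N n) (phi : public * R -> \bar R) :
    public * R -> \bar R :=
  sint mu (sint mu (sint mu (sint mu (sint mu (sint mu (stepF X phi)))))).

Lemma measurable_stepE X phi : measurable_fun setT phi -> (forall x, 0 <= phi x)%E ->
  measurable_fun setT (stepE X phi).
Proof.
move=> mphi phi0.
by do 6 (apply: measurable_sint; [|do ?apply: sint_ge0 => //; move=> x; exact: phi0]);
  exact: measurable_stepF.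
Qed.

Lemma stepE_ge0 X phi : (forall x, 0 <= phi x)%E -> forall s, (0 <= stepE X phi s)%E.
Proof. by move=> phi0; do 6 apply: sint_ge0; move=> x; exact: phi0. Qed.

Lemma stepE_scale X phi (k : R) : measurable_fun setT phi ->
  (forall x, 0 <= phi x)%E -> 0 <= k ->
  stepE X (fun x => k%:E * phi x)%E = (fun s => k%:E * stepE X phi s)%E.
Proof.
move=> mphi phi0 k0; rewrite /stepE.
rewrite (_ : stepF X _ = fun q => (k%:E * stepF X phi q)%E)//.
have m0 := measurable_stepF X mphi.
have g0 x : (0 <= stepF X phi x)%E by exact: phi0.
have m1 := measurable_sint mu m0 g0; have g1 := sint_ge0 mu g0.
have m2 := measurable_sint mu m1 g1; have g2 := sint_ge0 mu g1.
have m3 := measurable_sint mu m2 g2; have g3 := sint_ge0 mu g2.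
have m4 := measurable_sint mu m3 g3; have g4 := sint_ge0 mu g3.
have m5 := measurable_sint mu m4 g4; have g5 := sint_ge0 mu g4.
by rewrite (sint_scale mu m0 g0 k0) (sint_scale mu m1 g1 k0) (sint_scale mu m2 g2 k0)
  (sint_scale mu m3 g3 k0) (sint_scale mu m4 g4 k0) (sint_scale mu m5 g5 k0).
Qed.

Lemma stepE_cst X phi s s' :
  (forall a z eta a' z' eta', step eps alpha F X s a z eta a' z' eta' = s') ->
  stepE X phi s = phi s'.
Proof.
move=> h; rewrite /stepE /sint /stepF/=.
have -> : phi s' = (\int[mu]_a \int[mu]_z \int[mu]_b \int[mu]_a' \int[mu]_z'
    \int[mu]_b' phi s')%E by rewrite !integral_prob_cst.
apply: eq_integral => a _; apply: eq_integral => z _; apply: eq_integral => b _.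
apply: eq_integral => a' _; apply: eq_integral => z' _; apply: eq_integral => b' _.
by rewrite h.
Qed.

Local Notation xi t := (pmwg_xi N n eps 0 alpha t).

Lemma stepE_onestep X phi h e t (g := cur_g F (histogram R X t) t h)
    (fy := cur_fy F t h) (T := 2 * alpha / 3) :
  p_status h = 0%N -> qtime F (p_ans h) = Some t ->
  stepE X phi (h, e) = onestep mu (xi t * (T - g)) (xi t * (T + g)) e
    (fun x => phi (hard_pub eps alpha F t h (fy + (g + 8 / xi t * x.1)), x.2))
    (fun x => phi (hard_pub eps alpha F t h (fy - (- g + 8 / xi t * x.1)), x.2))
    (phi (easy_pub F t h, e)).
Proof.
move=> h0 ht; rewrite /stepE /onestep /sint.
apply: eq_integral => a _; apply: eq_integral => z _; apply: eq_integral => b _.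
apply: eq_integral => a' _; apply: eq_integral => z' _; apply: eq_integral => b' _.
rewrite /stepF /step /= h0 ht /step_at -/g -/fy -/T.
by case: ifP => // _; case: ifP.
Qed.

Hypothesis mu_laplace : forall A : set R, measurable A ->
  mu A = (\int[lebesgue_measure]_(z in A) (laplace_pdf 1 z)%:E)%E.

(** A step on [X] from noise [e - p_c h] is compared with a step on [X'] from noise [e]. Since the
    new shift and the new loss are recorded in the public state, the same weighted and shifted
    functional reappears after the step, and the bound can be iterated. *)
Lemma stepE_privacy X X' phi h e :
  (0 < n)%N -> (forall t, (n <= t)%N -> 0 < xi t) ->
  neighboring X X' ->
  (forall t, qtime F (p_ans h) = Some t -> pmwg_c N n eps alpha t <= p_c h) ->
  measurable_fun setT phi -> (forall x, 0 <= phi x)%E ->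
  ((expR (p_loss h))%:E * stepE X phi (h, e - p_c h)%R <=
   stepE X' (fun s => (expR (p_loss s.1))%:E * phi (s.1, s.2 - p_c s.1)%R) (h, e))%E.
Proof.
move=> n0 xi0 XX' hc mphi phi0.
case h0 : (p_status h) => [|m]; last first.
  rewrite (@stepE_cst X _ _ (h, e - p_c h)); last first.
    by move=> *; rewrite /step /= h0.
  by rewrite (@stepE_cst X' _ _ (h, e))//= => *; rewrite /step /= h0.
case ht : (qtime F (p_ans h)) => [t|]; last first.
  rewrite (@stepE_cst X _ _ (end_pub h, e - p_c h)); last first.
    by move=> *; rewrite /step /= h0 ht.
  by rewrite (@stepE_cst X' _ _ (end_pub h, e))//= => *; rewrite /step /= h0 ht.
have nt := qtime_ge ht.
have t_gt0 : 0 < t%:R :> R by rewrite ltr0n (leq_trans n0).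
have xit := xi0 _ nt.
have ct := hc _ ht.
set g := cur_g F (histogram R X t) t h; set g' := cur_g F (histogram R X' t) t h.
have gg : `|g - g'| <= t%:R^-1.
  rewrite /g /g' /cur_g (_ : _ - _ - _ = eval (cur_query F h) (histogram R X t)
    - eval (cur_query F h) (histogram R X' t)); last by lra.
  by apply: eval_histogram_neighboring => // i; exact: qry_itv.
set c' := pmwg_c N n eps alpha t in ct.
have c'E : xi t * t%:R^-1 = c' by [].
have mphi' : measurable_fun setT (fun s => ((expR (p_loss h))%:E * phi s)%E).
  by apply: emeasurable_funM => //; exact: measurable_cst.
have ep : 0 <= expR (p_loss h) by exact: expR_ge0.
have phi0' x : (0 <= (expR (p_loss h))%:E * phi x)%E by rewrite mule_ge0// lee_fin.
rewrite -[leLHS]/((fun s => (expR (p_loss h))%:E * stepE X phi s)%E (h, e - p_c h)).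
rewrite -(stepE_scale X mphi phi0 ep).
pose Phi s := ((expR (p_loss h))%:E * phi s)%E.
pose Psi (s : public * R) := ((expR (p_loss s.1))%:E * phi (s.1, s.2 - p_c s.1)%R)%E.
rewrite (stepE_onestep X Phi (e - p_c h) h0 ht) (stepE_onestep X' Psi e h0 ht) -/g -/g'.
set fy := cur_fy F t h.
pose H1 x := Phi (hard_pub eps alpha F t h (fy + (g + 8 / xi t * x.1)), x.2).
pose H2 x := Phi (hard_pub eps alpha F t h (fy - (- g + 8 / xi t * x.1)), x.2).
pose E0 := Phi (easy_pub F t h, e - p_c h).
have mpub (f : R * R -> R) : measurable_fun setT f -> measurable_fun setT
    (fun x : R * R => Phi (hard_pub eps alpha F t h (f x), x.2)).
  move=> mf; apply: (measurableT_comp mphi'); apply: measurable_fun_pair.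
    by apply: (@measurable_hard_pub R N n eps alpha F _ _ (fun _ => h)).
  exact: measurable_snd.
have mH1 : measurable_fun setT H1.
  apply: mpub; apply: measurable_funD; first exact: measurable_cst.
  apply: measurable_funD; first exact: measurable_cst.
  by apply: measurable_funM; [exact: measurable_cst|exact: measurable_fst].
have mH2 : measurable_fun setT H2.
  apply: mpub; apply: measurable_funB; first exact: measurable_cst.
  apply: measurable_funD; first exact: measurable_cst.
  by apply: measurable_funM; [exact: measurable_cst|exact: measurable_fst].
have Dle a : `|a| = 1 -> `|xi t * (2 * alpha / 3 + a * g) - xi t * (2 * alpha / 3 + a * g')| <= c'.
  move=> a1; rewrite -mulrBr (_ : _ - _ = a * (g - g')); last by lra.
  by rewrite !normrM a1 mul1r (gtr0_norm xit) -c'E ler_wpM2l// ltW.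
(* The shift of the draw [Z] that makes the released answers equal: [8 / xi t * s1 = g - g']. If the
   second call fires, the query is negated and so is the shift. *)
pose s1 := (g - g') * xi t / 8.
have s1c : `|s1| <= c' / 8.
  rewrite /s1 !normrM (gtr0_norm xit) normfV (ger0_norm (_ : 0 <= 8 :> R))//.
  by rewrite ler_wpM2r ?invr_ge0// -c'E mulrC ler_wpM2l// ltW.
have D1c : `|xi t * (2 * alpha / 3 - g) - xi t * (2 * alpha / 3 - g')| <= c'.
  by have := Dle (-1); rewrite !mulN1r normrN1; exact.
have D2c : `|xi t * (2 * alpha / 3 + g) - xi t * (2 * alpha / 3 + g')| <= c'.
  by have := Dle 1; rewrite !mul1r normr1; exact.
have s2c : `|- s1| <= c' / 8 by rewrite normrN.
have H10 x : (0 <= H1 x)%E by exact: phi0'.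
have H20 x : (0 <= H2 x)%E by exact: phi0'.
have E00 : (0 <= E0)%E by exact: phi0'.
have main := @onestep_le R mu mu_laplace _ _ _ _ (p_c h) c' (e - p_c h)
  s1 (- s1) H1 H2 E0 D1c D2c ct s1c s2c mH1 mH2 H10 H20 E00.
rewrite subrK in main.
have hc' b : p_c (hard_pub eps alpha F t h b) = c' by rewrite /hard_pub; case: ifP.
have hl b : p_loss (hard_pub eps alpha F t h b) = p_loss h + step_loss n eps alpha t h.
  by rewrite /hard_pub; case: ifP.
have e8 : 8 / xi t * ((g - g') * xi t / 8) = g - g'.
  by field; rewrite gt_eqF.
set Delta := (_ + 7 * c' / 12) in main.
have DeltaE : step_loss n eps alpha t h = Delta by [].
have e1 : (fun x : R * R => (expR Delta)%:E * H1 (x.1 - s1, x.2 - c')%R)%E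
    = fun x => Psi (hard_pub eps alpha F t h (fy + (g' + 8 / xi t * x.1)), x.2).
  apply/funext => x; rewrite /H1 /Phi /Psi/= hl hc' DeltaE expRD EFinM -muleA muleCA.
  have -> : fy + (g + 8 / xi t * (x.1 - s1)) = fy + (g' + 8 / xi t * x.1).
    by rewrite mulrBr /s1 e8; lra.
  by [].
have e2 : (fun x : R * R => (expR Delta)%:E * H2 (x.1 - - s1, x.2 - c')%R)%E
    = fun x => Psi (hard_pub eps alpha F t h (fy - (- g' + 8 / xi t * x.1)), x.2).
  apply/funext => x; rewrite /H2 /Phi /Psi/= hl hc' DeltaE expRD EFinM -muleA muleCA.
  have -> : fy - (- g + 8 / xi t * (x.1 - - s1)) = fy - (- g' + 8 / xi t * x.1).
    by rewrite opprK mulrDr /s1 e8; lra.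
  by [].
rewrite e1 e2 in main; exact: main.
Qed.

End stepE.

End run.

Section privacy_run.
Context (R : realType) (N n : nat) (eps alpha : R) (F : query_stream R N n)
  (d : measure_display) (Omega : measurableType d)
  (P : probability Omega R) (W : draw -> {RV P >-> R}).
Hypotheses (indep : mutually_independent W)
  (laplaceW : forall i, has_laplace_law 1 (W i)).
Local Notation public := (public R N).
Local Notation mrun := (mrun eps alpha F).
Let u (w : Omega) : draw -> R := fun i => W i w.
Let mu : probability R R := distribution P (W (draw_seq 0)).

Let mu_laplace (A : set R) : measurable A ->
  mu A = (\int[lebesgue_measure]_(z in A) (laplace_pdf 1 z)%:E)%E.
Proof. exact: laplaceW. Qed.

Lemma past_fun_mono i j (d' : measure_display) (T : measurableType d')
    (f : Omega -> T) : (i <= j)%N ->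
  measurable_fun setT (f : past W i -> T) -> measurable_fun setT (f : past W j -> T).
Proof.
move=> ij mf _ B mB; rewrite setTI; apply: (past_mono ij).
by have := mf measurableT B mB; rewrite setTI.
Qed.

Lemma measurable_mrun X k :
  measurable_fun setT ((fun w => mrun X (u w) k) : past W (6 * k).+1 -> public * R).
Proof.
elim: k => [|k IH].
  apply: measurable_fun_pair; first exact: measurable_cst.
  by apply: measurable_funM; [exact: measurable_cst|exact: past_draw].
have IH' := past_fun_mono (leq_addr 6 (6 * k).+1) IH.
have -> : (6 * k.+1).+1 = ((6 * k).+1 + 6)%N by rewrite mulnS addnC addSn.
have md j : (j <= 6)%N -> measurable_fun setT
    ((fun w => u w (draw_seq (6 * k + j))) : past W ((6 * k).+1 + 6) -> R).
  by move=> j6; apply: past_draw; rewrite addSn ltnS leq_add2l.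
have := @measurable_step R N n eps alpha F _ (past W ((6 * k).+1 + 6))
  (fun w => (mrun X (u w) k).1) (measurableT_comp measurable_fst IH') X
  (fun w => (mrun X (u w) k).2) _ _ _ _ _ _ (measurableT_comp measurable_snd IH')
  (md 1%N isT) (md 2%N isT) (md 3%N isT) (md 4%N isT) (md 5%N isT) (md 6%N isT).
congr (measurable_fun _ _); apply/funext => w /=.
by case: (mrun X (u w) k).
Qed.

Lemma measurable_mrunT X k : measurable_fun setT (fun w => mrun X (u w) k).
Proof.
move=> _ B mB; apply: (past_measurable (W := W) (j := (6 * k).+1)).
exact: measurable_mrun.
Qed.

Lemma disint j (d' : measure_display) (T : measurableType d')
    (Z : Omega -> T) (f : T * R -> \bar R) :
  measurable_fun setT (Z : past W j -> T) ->
  measurable_fun setT f -> (forall x, 0 <= f x)%E ->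
  (\int[P]_w f (Z w, u w (draw_seq j)) = \int[P]_w sint mu f (Z w))%E.
Proof. by move=> mZ mf f0; exact: (disintegration indep laplaceW mZ mf f0). Qed.

Lemma integral_mrunS X phi k : measurable_fun setT phi -> (forall x, 0 <= phi x)%E ->
  (\int[P]_w phi (mrun X (u w) k.+1) = \int[P]_w stepE eps alpha F mu X phi (mrun X (u w) k))%E.
Proof.
move=> mphi phi0.
have m0 := measurable_stepF eps alpha F X mphi.
have g0 x : (0 <= stepF eps alpha F X phi x)%E by exact: phi0.
have m1 := measurable_sint mu m0 g0; have g1 := sint_ge0 mu g0.
have m2 := measurable_sint mu m1 g1; have g2 := sint_ge0 mu g1.
have m3 := measurable_sint mu m2 g2; have g3 := sint_ge0 mu g2.
have m4 := measurable_sint mu m3 g3; have g4 := sint_ge0 mu g3.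
have m5 := measurable_sint mu m4 g4; have g5 := sint_ge0 mu g4.
have e j : (6 * k + j.+1 = (6 * k).+1 + j)%N by rewrite addnS addSn.
pose v w j := u w (draw_seq (6 * k + j)).
have ext j (d' : measure_display) (T : measurableType d') (Z : Omega -> T) :
    measurable_fun setT (Z : past W (6 * k + j) -> T) ->
    measurable_fun setT ((fun w => (Z w, v w j)) : past W (6 * k + j.+1) -> T * R).
  move=> mZ; apply: measurable_fun_pair.
    by apply: past_fun_mono mZ; rewrite leq_add2l.
  by apply: past_draw; rewrite ltn_add2l.
have z1 : measurable_fun setT ((fun w => mrun X (u w) k) : past W (6 * k + 1) -> _).
  by rewrite addn1; exact: measurable_mrun.
have z2 := ext _ _ _ _ z1.
have z3 := ext _ _ _ _ z2.
have z4 := ext _ _ _ _ z3.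
have z5 := ext _ _ _ _ z4.
have z6 := ext _ _ _ _ z5.
rewrite /stepE.
rewrite -(disint z1 m5 g5) -(disint z2 m4 g4) -(disint z3 m3 g3).
by rewrite -(disint z4 m2 g2) -(disint z5 m1 g1) -(disint z6 m0 g0).
Qed.

(** The induction holds for all [phi] at once: the last step is absorbed into the test function by
    [stepE], the hypothesis treats the first k steps, and [stepE_privacy] is integrated over the run
    on [X']. *)
Lemma mrun_privacy X X' k phi :
  (0 < n)%N -> (forall t, (n <= t)%N -> 0 < pmwg_xi N n eps 0 alpha t) ->
  0 <= pmwg_c N n eps alpha n ->
  neighboring X X' ->
  (forall v j t, qtime F (p_ans (mrun X' v j).1) = Some t ->
     pmwg_c N n eps alpha t <= p_c (mrun X' v j).1) ->
  measurable_fun setT phi -> (forall x, 0 <= phi x)%E ->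
  (\int[P]_w phi (mrun X (u w) k) <=
   \int[P]_w ((expR (p_loss (mrun X' (u w) k).1))%:E *
     phi ((mrun X' (u w) k).1, (mrun X' (u w) k).2 - p_c (mrun X' (u w) k).1)%R))%E.
Proof.
move=> n0 xi0 c0 XX' hc.
pose Psi (f : public * R -> \bar R) (s : public * R) :=
  ((expR (p_loss s.1))%:E * f (s.1, s.2 - p_c s.1)%R)%E.
have mPsi f : measurable_fun setT f -> measurable_fun setT (Psi f).
  move=> mf; apply: emeasurable_funM.
    apply/measurable_EFinP; apply: measurableT_comp => //.
    exact: (measurable_p_loss measurable_fst).
  apply: (measurableT_comp mf); apply: measurable_fun_pair; first exact: measurable_fst.
  apply: measurable_funB; first exact: measurable_snd.
  exact: (measurable_p_c measurable_fst).
have Psi0 f : (forall x, 0 <= f x)%E -> forall x, (0 <= Psi f x)%E.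
  by move=> f0 x; rewrite mule_ge0// lee_fin expR_ge0.
elim: k phi => [|k IH] phi mphi phi0.
  have m2 : measurable_fun setT (fun v : R => phi (pub0 N n eps alpha, 2 * v)).
    apply: (measurableT_comp mphi); apply: measurable_fun_pair; first exact: measurable_cst.
    exact: measurable_scale.
  have -> : (\int[P]_w phi (mrun X (u w) 0) = \int[mu]_v phi (pub0 N n eps alpha, 2 * v)%R)%E.
    by rewrite ge0_integral_distribution.
  apply: (le_trans (laplace_shift mu_laplace (pmwg_c N n eps alpha n / 2) m2 (fun=> phi0 _))).
  have c20 : 0 <= pmwg_c N n eps alpha n / 2 by lra.
  rewrite (ger0_norm c20).
  have m3 : measurable_fun setT (fun v : R => phi (pub0 N n eps alpha, 2 * (v - pmwg_c N n eps alpha n / 2))).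
    apply: (measurableT_comp m2).
    by apply: measurable_funB => //; exact: measurable_cst.
  rewrite ge0_integral_distribution// -ge0_integralZl//; last 2 first.
  - have mW : measurable_fun setT (W (draw_seq 0)) by exact: measurable_funP.
    exact: (measurableT_comp m3 mW).
  - by move=> w _; exact: phi0.
  rewrite le_eqVlt; apply/orP; left; apply/eqP; apply: eq_integral => w _ /=.
  have -> : 2 * (W (draw_seq 0) w - pmwg_c N n eps alpha n / 2)
      = 2 * u w (draw_seq 0) - p_c (pub0 N n eps alpha) by rewrite /u /p_c/=; lra.
  by [].
rewrite integral_mrunS//.
apply: (le_trans (IH _ (measurable_stepE eps alpha F mu X mphi phi0) _)).
  exact: stepE_ge0.
have := integral_mrunS X' k (mPsi _ mphi) (Psi0 _ phi0).
rewrite [X in X = _ -> _](_ : _ = \int[P]_w ((expR (p_loss (mrun X' (u w) k.+1).1))%:E *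
     phi ((mrun X' (u w) k.+1).1, (mrun X' (u w) k.+1).2 - p_c (mrun X' (u w) k.+1).1)%R))%E//.
move=> ->; apply: ge0_le_integral => //.
- by move=> w _; rewrite mule_ge0 ?lee_fin ?expR_ge0//; exact: stepE_ge0.
- apply: (measurableT_comp (mPsi _ (measurable_stepE eps alpha F mu X mphi phi0))).
  exact: measurable_mrunT.
- apply: (measurableT_comp (measurable_stepE eps alpha F mu X' (mPsi _ mphi) (Psi0 _ phi0))).
  exact: measurable_mrunT.
move=> w _; have := hc (u w) k; case: (mrun X' (u w) k) => h e /= hc'.
exact: stepE_privacy.
Qed.

End privacy_run.

(** * The privacy budget *)

Section ln_bounds.
Context (R : realType).

(* [((4 + h) / (4 - h))^2 <= (2 + h) / (2 - h)]; iterating it improves the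
   estimate [ln y >= 1 - 1/y] to almost [ln ((2 + h) / (2 - h)) >= h]. *)
Lemma ln_half_ge (m : nat) (h : R) : 0 <= h -> h < 2 ->
  2 * h / (2 + h / 2 ^+ m) <= ln ((2 + h) / (2 - h)).
Proof.
elim: m h => [|m IH] h h0 h2.
  have y0 : 0 < (2 + h) / (2 - h) by rewrite divr_gt0; lra.
  have := @le_ln1Dx R ((2 - h) / (2 + h) - 1).
  rewrite subrKC -[in ln _]invf_div lnV ?posrE//.
  have -> : -1 < (2 - h) / (2 + h) - 1 by rewrite ltrBrDr addNr divr_gt0; lra.
  move=> /(_ isT) le1; rewrite expr0 divr1.
  have : 2 * h / (2 + h) = 1 - (2 - h) / (2 + h) by field; rewrite gt_eqF; lra.
  lra.
have q0 : 0 < (2 + h / 2) / (2 - h / 2) by rewrite divr_gt0; lra.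
apply: (@le_trans _ _ (ln (((2 + h / 2) / (2 - h / 2)) ^+ 2))).
  have e : h / 2 / 2 ^+ m = h / 2 ^+ m.+1 by rewrite exprS invfM mulrA.
  have le1 := IH (h / 2) ltac:(lra) ltac:(lra); rewrite e in le1.
  rewrite lnXn// [leRHS]mulr2n.
  by set X := (2 + h / 2 ^+ m.+1)^-1 in le1 *; lra.
rewrite ler_ln ?posrE ?exprn_gt0// ?divr_gt0//; [|lra|lra].
rewrite ler_pdivlMr; last by lra.
rewrite exprMn exprVn mulrAC ler_pdivrMr; last by rewrite exprn_gt0//; lra.
have : 0 <= h ^+ 3 by rewrite exprn_ge0.
lra.
Qed.

(** With h = 2/(2k + 1) one has (k + 1)/k = (2 + h)/(2 - h), and eight halvings leave the error term
    1/256. *)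
Lemma ln_succ_ge (k : nat) : (0 < k)%N ->
  2 / (2 * k%:R + 1 + 1 / 256) <= ln ((k%:R + 1) / k%:R) :> R.
Proof.
move=> k0; have k0' : 1 <= k%:R :> R by rewrite ler1n.
have := @ln_half_ge 8 (2 / (2 * k%:R + 1)).
have -> : (2 + 2 / (2 * k%:R + 1)) / (2 - 2 / (2 * k%:R + 1)) = (k%:R + 1) / k%:R :> R.
  by field; rewrite !gt_eqF//; lra.
have h0 : 0 <= 2 / (2 * k%:R + 1) :> R by rewrite divr_ge0//; lra.
have h2 : 2 / (2 * k%:R + 1) < 2 :> R by rewrite ltr_pdivrMr; lra.
move=> /(_ h0 h2); congr (_ <= _).
have -> : 2 ^+ 8 = 256 :> R by lra.
by field; rewrite !gt_eqF//; lra.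
Qed.

(** 16/15, 25/24, 81/80 and 28/27 are ratios of consecutive integers without prime factors above 7,
    so their logarithms determine those of 2, 3, 5 and 7. For instance ln 3 = 11 ln(16/15) + 8
    ln(25/24) + 5 ln(81/80). The coefficients for ln 3 and ln 21 are all positive, so lower bounds
    suffice. *)
Lemma ln3_ln21_ge : 1098 / 1000 <= ln (3 : R) /\ 3042 / 1000 <= ln (21 : R).
Proof.
have h1 : (64 + 1 / 2) / 1000 <= ln ((15%:R + 1) / 15%:R) :> R.
  by apply: le_trans (@ln_succ_ge 15 isT); rewrite ler_pdivlMr; lra.
have h2 : (40 + 4 / 5) / 1000 <= ln ((24%:R + 1) / 24%:R) :> R.
  by apply: le_trans (@ln_succ_ge 24 isT); rewrite ler_pdivlMr; lra.
have h3 : (12 + 42 / 100) / 1000 <= ln ((80%:R + 1) / 80%:R) :> R.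
  by apply: le_trans (@ln_succ_ge 80 isT); rewrite ler_pdivlMr; lra.
have h4 : 36 / 1000 <= ln ((27%:R + 1) / 27%:R) :> R.
  by apply: le_trans (@ln_succ_ge 27 isT); rewrite ler_pdivlMr; lra.
have p (a : R) : 0 < a -> a \is Num.pos by rewrite posrE.
have e1 : ln ((15%:R + 1) / 15%:R) = 4 * ln 2 - (ln 3 + ln 5) :> R.
  by rewrite !mulr_natl -!lnXn// -lnM ?p// -ln_div ?p//; congr ln; lra.
have e2 : ln ((24%:R + 1) / 24%:R) = 2 * ln 5 - (3 * ln 2 + ln 3) :> R.
  by rewrite !mulr_natl -!lnXn// -lnM ?p// -ln_div ?p//; congr ln; lra.
have e3 : ln ((80%:R + 1) / 80%:R) = 4 * ln 3 - (4 * ln 2 + ln 5) :> R.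
  by rewrite !mulr_natl -!lnXn// -lnM ?p// -ln_div ?p//; congr ln; lra.
have e4 : ln ((27%:R + 1) / 27%:R) = 2 * ln 2 + ln 7 - 3 * ln 3 :> R.
  by rewrite !mulr_natl -!lnXn// -lnM ?p// -ln_div ?p//; congr ln; lra.
have e5 : ln 21 = ln 3 + ln 7 :> R by rewrite -lnM ?p//; congr ln; lra.
rewrite e1 in h1; rewrite e2 in h2; rewrite e3 in h3; rewrite e4 in h4; rewrite e5.
by split; lra.
Qed.

End ln_bounds.

Section budget.
Context (R : realType) (N n : nat) (eps alpha : R) (F : query_stream R N n).
Hypotheses (N3 : (3 <= N)%N) (n21 : (21 <= n)%N) (eps0 : 0 < eps)
  (alpha0 : 0 < alpha) (alpha1 : alpha <= 1).
Local Notation B t := (pmwg_max_hard N n alpha t).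
Local Notation c t := (pmwg_c N n eps alpha t).

Lemma ln_Nn : ln (N * n)%:R = ln N%:R + ln n%:R :> R.
Proof. by rewrite natrM lnM// posrE ltr0n; [exact: leq_trans N3|exact: leq_trans n21]. Qed.

Lemma lnN_ge : 1098 / 1000 <= ln N%:R :> R.
Proof. by apply: (le_trans (ln3_ln21_ge R).1); rewrite ler_ln ?posrE ?ltr0n ?ler_nat//; exact: leq_trans N3. Qed.

Lemma lnn_ge : 3042 / 1000 <= ln n%:R :> R.
Proof. by apply: (le_trans (ln3_ln21_ge R).2); rewrite ler_ln ?posrE ?ltr0n ?ler_nat//; exact: leq_trans n21. Qed.

Lemma ln_Nn_gt0 : 0 < ln (N * n)%:R :> R.
Proof. by rewrite ln_Nn; have := lnN_ge; have := lnn_ge; lra. Qed.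

Definition pmwg_K : R := alpha ^+ 2 * Num.sqrt n%:R / (162 * ln (N * n)%:R) * eps.

Lemma sqrtn_gt0 t : (0 < t)%N -> 0 < Num.sqrt t%:R :> R.
Proof. by move=> t0; rewrite sqrtr_gt0 ltr0n. Qed.

Let n_gt0 : (0 < n)%N. Proof. exact: leq_trans n21. Qed.

Lemma pmwg_K_gt0 : 0 < pmwg_K.
Proof.
rewrite /pmwg_K mulr_gt0// divr_gt0 ?mulr_gt0 ?exprn_gt0 ?sqrtn_gt0//.
exact: ln_Nn_gt0.
Qed.

Lemma pmwg_xiE t : pmwg_xi N n eps 0 alpha t = pmwg_K * Num.sqrt t%:R.
Proof. by rewrite /pmwg_xi eqxx. Qed.

Lemma pmwg_xi_gt0 t : (n <= t)%N -> 0 < pmwg_xi N n eps 0 alpha t.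
Proof.
move=> nt; rewrite pmwg_xiE mulr_gt0 ?pmwg_K_gt0 ?sqrtn_gt0//.
exact: leq_trans nt.
Qed.

Lemma pmwg_cE t : (0 < t)%N -> c t = pmwg_K / Num.sqrt t%:R.
Proof.
move=> t0; rewrite /pmwg_c pmwg_xiE -[X in _ / X](@sqr_sqrtr _ t%:R)//.
by rewrite expr2 invfM mulrA mulfK// gt_eqF// sqrtn_gt0.
Qed.

Lemma pmwg_c_anti s t : (0 < s)%N -> (s <= t)%N -> c t <= c s.
Proof.
move=> s0 st; have t0 := leq_trans s0 st.
rewrite !pmwg_cE// ler_wpM2l ?(ltW pmwg_K_gt0)// lef_pV2 ?posrE ?sqrtn_gt0//.
by rewrite ler_sqrt// ler_nat.
Qed.

Lemma pmwg_c_gt0 t : (0 < t)%N -> 0 < c t.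
Proof. by move=> t0; rewrite pmwg_cE// divr_gt0 ?pmwg_K_gt0 ?sqrtn_gt0. Qed.

Definition tailG (t : nat) : R := (2 * ln N%:R + 2 * ln t%:R + 6) / Num.sqrt t%:R.

Lemma pmwg_b_ge0 t : (0 < t)%N -> 0 <= pmwg_b R N t.+1.
Proof.
move=> t0; rewrite /pmwg_b -natr1 addrK.
have t0' : 0 < t%:R :> R by rewrite ltr0n.
have lnt : 0 <= ln t%:R :> R by rewrite ln_ge0// ler1n.
have lnN := lnN_ge.
rewrite addr_ge0//; last by rewrite ln_ge0// ler_pdivlMr// mul1r lerDl.
by rewrite addr_ge0// divr_ge0//; lra.
Qed.

(* The tail sum of b_t / sqrt t is compared with the integral of
   (log N + log s + 1) s^(-3/2), whose primitive is - tailG. *)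
Lemma pmwg_b_tail t : (0 < t)%N ->
  pmwg_b R N t.+1 / Num.sqrt t.+1%:R <= tailG t - tailG t.+1.
Proof.
move=> t0; rewrite /pmwg_b /tailG -natr1 addrK.
have t0' : 0 < t%:R :> R by rewrite ltr0n.
set x := Num.sqrt t%:R; set y := Num.sqrt (t%:R + 1).
have x0 : 0 < x by exact: sqrtn_gt0.
have xx : x ^+ 2 = t%:R by rewrite sqr_sqrtr// ltW.
have yy : y ^+ 2 = t%:R + 1 by rewrite sqr_sqrtr//; lra.
have xy : x <= y by rewrite ler_sqrt; lra.
have y0 : 0 < y by lra.
have q0 : 0 < (t%:R + 1) / t%:R :> R by rewrite divr_gt0//; lra.
have lnt1 : ln (t%:R + 1) = ln t%:R + ln ((t%:R + 1) / t%:R) :> R.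
  by rewrite -lnM ?posrE// mulrC divfK// gt_eqF.
set q := ln ((t%:R + 1) / t%:R) in lnt1 *.
have qle : q <= 2 * (y / x - 1).
  have -> : q = ln (y / x) *+ 2.
    by rewrite -lnXn ?divr_gt0// exprMn exprVn xx yy.
  have := @le_ln1Dx R (y / x - 1); rewrite subrKC => /(_ _).
  have -> : -1 < y / x - 1 by rewrite ltrBrDr addNr divr_gt0.
  by move=> /(_ isT); rewrite -mulr_natr; lra.
have lnN := lnN_ge.
have lnt : 0 <= ln t%:R :> R by rewrite ln_ge0// ler1n.
rewrite lnt1; pose l : R := ln N%:R + ln t%:R.
have l0 : 0 <= l by rewrite /l; lra.
(* As y^2 - x^2 = 1, the right side is 2/(x y (x + y)), while the left side is 2/(y y (y + y)). *)
have key : y^-1 * y^-1 * y^-1 <= 2 * (x^-1 - y^-1).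
  have -> : 2 * (x^-1 - y^-1) = 2 / (x * y * (x + y)).
    have h : (y - x) * (x + y) = 1.
      by rewrite (_ : _ * _ = y ^+ 2 - x ^+ 2); [rewrite xx yy; lra|ring].
    rewrite -[2 / _]mulr1 -h; field; rewrite !gt_eqF//; lra.
  have -> : y^-1 * y^-1 * y^-1 = 2 / (y * y * (y + y)).
    by field; do ?[apply/andP; split]; rewrite gt_eqF//; lra.
  rewrite ler_wpM2l// lef_pV2 ?posrE ?mulr_gt0//; [|lra|lra].
  have h1 : x * y <= y * y by rewrite ler_wpM2r// ltW.
  apply: ler_pM => //; [by rewrite mulr_ge0 ?ltW|lra|lra].
have y1 : (t%:R + 1)^-1 = y^-1 * y^-1 :> R by rewrite -yy expr2 invfM.
rewrite y1.
have k1 := ler_wpM2l l0 key.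
(* One q/y comes from b_(t+1) and two come from the growth of the logarithm in [tailG]; the constant
   6 in [tailG] pays for all three. *)
have k2 : 3 * q * y^-1 <= 6 * (x^-1 - y^-1).
  have -> : 6 * (x^-1 - y^-1) = 3 * (2 * (y / x - 1)) * y^-1.
    by field; rewrite !gt_eqF.
  have yV0 : 0 <= y^-1 by rewrite invr_ge0 ltW.
  by apply: (ler_wpM2r yV0); lra.
rewrite /l in k1; lra.
Qed.

Lemma max_hardS t : (n <= t)%N -> B t.+1 = B t + 36 / alpha ^+ 2 * pmwg_b R N t.+1.
Proof.
by move=> nt; rewrite /pmwg_max_hard big_nat_recr//= !mulrDr addrA.
Qed.

Definition hardPhi (t H : nat) : R :=
  (B t - H%:R) / Num.sqrt t%:R + 36 / alpha ^+ 2 * tailG t.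

Lemma hardPhiS t H : (n <= t)%N -> H%:R <= B t ->
  H%:R <= B t.+1 /\ hardPhi t.+1 H <= hardPhi t H.
Proof.
move=> nt HB; have t0 : (0 < t)%N by exact: leq_trans nt.
have b0 := pmwg_b_ge0 t0; have bt := pmwg_b_tail t0.
have a0 : 0 < 36 / alpha ^+ 2 by rewrite divr_gt0// exprn_gt0.
rewrite max_hardS//; split.
  by rewrite (le_trans HB)// lerDl mulr_ge0// ltW.
rewrite /hardPhi max_hardS//.
have h1 : (B t - H%:R) / Num.sqrt t.+1%:R <= (B t - H%:R) / Num.sqrt t%:R.
  rewrite ler_wpM2l ?subr_ge0// lef_pV2 ?posrE ?sqrtn_gt0//.
  by rewrite ler_sqrt// ler_nat.
have h2 := ler_wpM2l (ltW a0) bt; lra.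
Qed.

Lemma hardPhi_anti s t H : (n <= s)%N -> (s <= t)%N -> H%:R <= B s ->
  H%:R <= B t /\ hardPhi t H <= hardPhi s H.
Proof.
move=> ns st HB; elim: t st => [|t IH].
  by rewrite leqn0 => /eqP s0; rewrite s0 in ns HB *.
rewrite leq_eqVlt => /predU1P[<-//|]; rewrite ltnS => st.
have [HBt le1] := IH st; have [HBt1 le2] := hardPhiS (leq_trans ns st) HBt.
by split => //; exact: le_trans le1.
Qed.

Lemma hardPhi_ge0 t H : (n <= t)%N -> H%:R <= B t -> 0 <= hardPhi t H.
Proof.
move=> nt HB; have t0 : (0 < t)%N by exact: leq_trans nt.
have lnN := lnN_ge.
have lnt : 0 <= ln t%:R :> R by rewrite ln_ge0// ler1n.
rewrite addr_ge0 ?divr_ge0 ?mulr_ge0 ?subr_ge0 ?sqrtr_ge0 ?invr_ge0 ?sqr_ge0//; lra.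
Qed.

(** The 3/4 is 1/2 for the shift of the initial noise plus 1/4 paid in advance for the query that
    ends the first instance. A hard query at time t then costs 23/24 [c t], plus 1/4 [c t] in
    advance for the next one, in total 29/24 [c t]. [M1] adds 23/24 for the hard query on which the
    run halts, which the counter does not include. *)
Let M0 : R := 3 / 4 * c n + 29 / 24 * pmwg_K * hardPhi n 0.
Let M1 : R := M0 + 23 / 24 * c n.

(** Up to the factor eps / ln(Nn) this is 41/3888 alpha^2 + 29/108 (3 ln N + 2 ln n + 6) <= ln N +
    ln n. The worst case is [N = 3], [n = 21], [alpha = 1], with a margin below 0.002, hence the
    sharp bounds on ln 3 and ln 21. *)
Lemma budget_total : M1 <= eps.
Proof.
have L0 := ln_Nn_gt0.
have s0 := sqrtn_gt0 n_gt0.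
have cn : c n = alpha ^+ 2 * eps / (162 * ln (N * n)%:R).
  rewrite pmwg_cE// /pmwg_K; field; rewrite !gt_eqF//; lra.
have B0 : B n = 36 / alpha ^+ 2 * ln N%:R.
  by rewrite /pmwg_max_hard big_geq// addr0.
have -> : M1 = eps / ln (N * n)%:R * (41 / 3888 * alpha ^+ 2
    + 29 / 108 * (3 * ln N%:R + 2 * ln n%:R + 6)).
  rewrite /M1 /M0 cn /hardPhi B0 subr0 /tailG /pmwg_K.
  by field; rewrite !gt_eqF//; lra.
rewrite mulrAC ler_pdivrMr// ler_wpM2l ?(ltW eps0)// ln_Nn.
have := lnN_ge; have := lnn_ge.
have : alpha ^+ 2 <= 1 by rewrite expr_le1// ltW.
lra.
Qed.

Definition budget_inv (h : public R N) := exists s, [/\ (n <= s)%N,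
  forall t, qtime F (p_ans h) = Some t -> (s <= t)%N,
  c s <= p_c h, p_c h <= c n &
  if p_status h is 0%N then (p_hard h)%:R <= B s /\
    p_loss h + p_c h / 4 + 29 / 24 * pmwg_K * hardPhi s (p_hard h) <= M0
  else p_loss h <= M1].

Lemma budget_inv0 : budget_inv (pub0 N n eps alpha).
Proof.
exists n; split => //; first by move=> t /qtime_ge.
rewrite /p_hard/=; split.
  rewrite /pmwg_max_hard big_geq// addr0 mulr_ge0 ?divr_ge0 ?sqr_ge0//.
  by have := lnN_ge; lra.
by rewrite /p_loss /p_c /= /M0; lra.
Qed.

Lemma qtime_rcons_ge h a t t' : qtime F h = Some t ->
  qtime F (rcons h a) = Some t' -> (t <= t')%N.
Proof. by move=> ht /qtime_mono[t0]; rewrite ht => -[->]. Qed.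

Lemma budget_inv_easy t h : qtime F (p_ans h) = Some t -> p_status h = 0%N ->
  budget_inv h -> budget_inv (easy_pub F t h).
Proof.
move=> ht h0 [s [ns st cs cn]]; rewrite h0 => -[HB Hl].
have st' := st _ ht; have [HBt le1] := hardPhi_anti ns st' HB.
exists t; split => //.
- exact: leq_trans st'.
- by move=> t'; exact: qtime_rcons_ge.
- by apply: le_trans cs; apply: pmwg_c_anti => //; exact: leq_trans ns.
rewrite /p_hard/=; split => //; apply: le_trans Hl; rewrite /p_loss/p_c/=.
by rewrite lerD2l ler_wpM2l// mulr_ge0 ?(ltW pmwg_K_gt0)//; lra.
Qed.

Lemma budget_inv_hard t h a : qtime F (p_ans h) = Some t -> p_status h = 0%N ->
  budget_inv h -> budget_inv (hard_pub eps alpha F t h a).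
Proof.
move=> ht h0 [s [ns st cs cn]]; rewrite h0 => -[HB Hl].
have st' := st _ ht; have [HBt le1] := hardPhi_anti ns st' HB.
have nt : (n <= t)%N := leq_trans ns st'.
have t0 : (0 < t)%N := leq_trans n_gt0 nt.
have K0 := pmwg_K_gt0.
have le2 : 29 / 24 * pmwg_K * hardPhi t (p_hard h) <= 29 / 24 * pmwg_K * hardPhi s (p_hard h).
  by rewrite ler_wpM2l// mulr_ge0 ?(ltW K0)//; lra.
have ctn : c t <= c n by exact: pmwg_c_anti.
have Phi0 : 0 <= 29 / 24 * pmwg_K * hardPhi t (p_hard h).
  by apply: mulr_ge0 (hardPhi_ge0 nt HBt); apply: mulr_ge0; [lra|exact: ltW].
rewrite /hard_pub; case: ltP => Hb; exists t; split => //.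
- by move=> t'; rewrite /p_ans/= -/(p_ans h) ht => -[->].
- by rewrite /p_loss /= -/(p_loss h) /M1 /step_loss; lra.
- by move=> t'; exact: qtime_rcons_ge.
rewrite /p_hard /= -/(p_hard h); split => //.
have -> : 29 / 24 * pmwg_K * hardPhi t (p_hard h).+1
    = 29 / 24 * pmwg_K * hardPhi t (p_hard h) - 29 / 24 * c t.
  rewrite pmwg_cE// /hardPhi -natr1; lra.
by rewrite /p_loss /p_c /= -/(p_loss h) /step_loss; lra.
Qed.

Lemma budget_inv_step X h e a z b a' z' b' : budget_inv h ->
  budget_inv (step eps alpha F X (h, e) a z b a' z' b').1.
Proof.
move=> hi; rewrite /step/=; case h0 : (p_status h) => [|m] //.
case ht : (qtime F (p_ans h)) => [t|]; last first.
  case: hi => s [ns st cs cn]; rewrite h0 => -[HB Hl].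
  exists s; split => //; rewrite /p_loss/= /M1.
  have := pmwg_c_gt0 n_gt0; have := hardPhi_ge0 ns HB; have := pmwg_K_gt0.
  have := pmwg_c_gt0 (leq_trans n_gt0 ns) => c1 K0 P0 c2.
  have : 0 <= 29 / 24 * pmwg_K * hardPhi s (p_hard h).
    by apply: mulr_ge0 P0; apply: mulr_ge0; [lra|exact: ltW].
  rewrite -/(p_loss h); lra.
rewrite /step_at; case: ifP => _; first exact: budget_inv_hard.
by case: ifP => _; [exact: budget_inv_hard|exact: budget_inv_easy].
Qed.

Lemma mrun_budget_inv X u k : budget_inv (mrun eps alpha F X u k).1.
Proof.
elim: k => [|k IH] /=; first exact: budget_inv0.
by move: IH; case: (mrun _ _ _ _ _ k) => h e; exact: budget_inv_step.
Qed.

Lemma mrun_c_ge X u k t : qtime F (p_ans (mrun eps alpha F X u k).1) = Some t ->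
  c t <= p_c (mrun eps alpha F X u k).1.
Proof.
have [s [ns st cs _ _]] := mrun_budget_inv X u k => ht.
by apply: le_trans cs; apply: pmwg_c_anti; [exact: leq_trans ns|exact: st].
Qed.

Lemma mrun_loss_le X u k : p_loss (mrun eps alpha F X u k).1 <= eps.
Proof.
have [s [ns st cs cn]] := mrun_budget_inv X u k.
move=> p; apply: le_trans budget_total; move: p.
case: (p_status _) => [[HB Hl]|m //].
have := pmwg_c_gt0 n_gt0; have P0 := hardPhi_ge0 ns HB; have K0 := pmwg_K_gt0.
have c1 := pmwg_c_gt0 (leq_trans n_gt0 ns) => c2.
have : 0 <= 29 / 24 * pmwg_K * hardPhi s (p_hard (mrun eps alpha F X u k).1).
  by apply: mulr_ge0 P0; apply: mulr_ge0; [lra|exact: ltW].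
rewrite /M1; lra.
Qed.

End budget.

(** * The machine produces the transcripts of the algorithm *)

Lemma draw_seqE k :
  [/\ draw_seq (6 * k + 1) = DrawNu k.*2, draw_seq (6 * k + 2) = DrawZ k.*2,
      draw_seq (6 * k + 3) = DrawEta k.*2.+1 &
   [/\ draw_seq (6 * k + 4) = DrawNu k.*2.+1, draw_seq (6 * k + 5) = DrawZ k.*2.+1 &
      draw_seq (6 * k + 6) = DrawEta k.+1.*2]].
Proof.
have e i : draw_seq (6 * k + i) = match (i %% 3)%N with
    | 0 => DrawEta (k.*2 + i %/ 3) | 1 => DrawNu (k.*2 + i %/ 3)
    | _ => DrawZ (k.*2 + i %/ 3) end.
  rewrite /draw_seq (_ : (6 * k + i = k.*2 * 3 + i)%N); last first.
    by rewrite -muln2 -mulnA mulnC.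
  by rewrite modnMDl divnMDl.
by rewrite !e/= !addn1 addn0 addn2 doubleS.
Qed.

Section bridge.
Context (R : realType) (N n : nat) (eps alpha : R) (F : query_stream R N n).
Hypothesis xi0 : forall t, (n <= t)%N -> 0 < pmwg_xi N n eps 0 alpha t.
Local Notation public := (public R N).
Local Notation mrun := (mrun eps alpha F).
Local Notation xi t := (pmwg_xi N n eps 0 alpha t).

Definition pub_transcript (h : public) : transcript R := fun j =>
  if (j < size (p_ans h))%N then Ans (nth 0 (p_ans h) j)
  else if (j == size (p_ans h)) && (p_status h == 1%N) then Bot else NoOutput.

Lemma natg_scaled (x T g e a : R) : 0 < x ->
  (T + e / x <= g + 4 / x * a) = (x * (T - g) + e <= 4 * a).
Proof.
move=> x0; rewrite -subr_ge0 -[RHS]subr_ge0.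
rewrite (_ : 4 * a - _ = x * (g + 4 / x * a - (T + e / x))) ?pmulr_rge0//.
by field; rewrite gt_eqF.
Qed.

Section fixed_run.
Variables (X : db_stream N n) (u : draw -> R).

Definition pmwg_out (k : nat) : output R :=
  (pmwg_step eps 0 alpha u X F k (pmwg_run eps 0 alpha u X F k)).1.

(** The algorithm starts an instance only when the next query arrives, while the machine already
    holds its noise as the sixth draw of the preceding step; the last clause reconciles the two. *)
Definition state_match (k : nat) (s : pmwg_state R N) (h : public) (e : R) :=
  [/\ st_answers s = p_ans h, st_y s = tnth (p_y h), st_hard s = p_hard h,
      st_last s = time_decode (p_last h) &
      e = if st_nsg s is Some e0 then e0 else 2 * u (DrawEta k.*2)].

Lemma pmwg_query_step k t s h e (v := fun j => u (draw_seq (6 * k + j))%N) :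
  (n <= t)%N -> state_match k s h e ->
  let p := pmwg_query eps 0 alpha u X k t (qry F (st_answers s)) s in
  let q := step_at eps alpha F (histogram R X t) t h e
             (v 1%N) (v 2%N) (v 3%N) (v 4%N) (v 5%N) (v 6%N) in
  if p_status q.1 is 0%N then
    exists a s', [/\ p = (Ans a, Some s'), p_ans q.1 = rcons (p_ans h) a &
      state_match k.+1 s' q.1 q.2]
  else [/\ p = (Bot, None), p_ans q.1 = p_ans h & p_status q.1 = 1%N].
Proof.
move=> nt [sa sy sh sl se] p q; have x0 := xi0 nt.
have [d1 d2 d3 [d4 d5 d6]] := draw_seqE k.
rewrite /v d1 d2 d3 d4 d5 d6 in q *.
have ey : pmwg_mix (st_last s) t (st_y s) = cur_y t h by rewrite sl sy.
have ef : qry F (st_answers s) = cur_query F h by rewrite sa.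
have efy : eval (cur_query F h) (cur_y t h) = cur_fy F t h by [].
have eg : eval (cur_query F h) (histogram R X t) - cur_fy F t h
  = cur_g F (histogram R X t) t h by [].
have eg' : cur_fy F t h - eval (cur_query F h) (histogram R X t)
  = - cur_g F (histogram R X t) t h by rewrite -eg opprB.
have cmp1 e0 a0 : (2 * alpha / 3 + e0 / xi t <= cur_g F (histogram R X t) t h + lap (4 / xi t) a0)
   = (xi t * (2 * alpha / 3 - cur_g F (histogram R X t) t h) + e0 <= 4 * a0).
  exact: natg_scaled.
have cmp2 e0 a0 : (2 * alpha / 3 + e0 / xi t <= - cur_g F (histogram R X t) t h + lap (4 / xi t) a0)
   = (xi t * (2 * alpha / 3 + cur_g F (histogram R X t) t h) + e0 <= 4 * a0).
  by rewrite /lap natg_scaled// opprK.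
have tupE (f : 'I_N -> R) : tnth [tuple f i | i < N] = f.
  by apply/funext => i; rewrite tnth_mktuple.
have se' : (if st_nsg s is Some e0 then e0 else lap 2 (u (DrawEta k.*2))) = e by rewrite se.
rewrite {}/p /pmwg_query /nsg /natg /step_at /= se' ef ey efy eg eg' cmp1.
case: ifPn => hi1 /=; rewrite ?cmp2.
- rewrite -[lap 2 _]/(2 * u (DrawEta k.*2.+1)) -[lap (8 / xi t) _]/(8 / xi t * u (DrawZ k.*2)).
  rewrite /hard_pub sh; case: (ltP (pmwg_max_hard N n alpha t)) => Hb /=; first by split.
  case: (xi t * (2 * alpha / 3 + cur_g F (histogram R X t) t h) + _ <= _) => /=; eexists; eexists; (split; [reflexivity|by []|split => //=]);
    by rewrite ?sa ?tupE.
case: (xi t * (2 * alpha / 3 + cur_g F (histogram R X t) t h) + _ <= _) => /=.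
- rewrite -[lap (8 / xi t) _]/(8 / xi t * u (DrawZ k.*2.+1)).
  rewrite /hard_pub sh; case: (ltP (pmwg_max_hard N n alpha t)) => Hb /=; first by split.
  by eexists; eexists; (split; [reflexivity|by []|split => //=]); rewrite ?sa ?tupE.
by eexists; eexists; (split; [reflexivity|by []|split => //=]); rewrite ?sa ?tupE.
Qed.

Lemma mrun_bridge k (h := (mrun X u k).1) (e := (mrun X u k).2) :
  [/\ forall j, (j < k)%N -> pmwg_out j = pub_transcript h j &
   if p_status h is 0%N then size (p_ans h) = k /\
     exists2 s, pmwg_run eps 0 alpha u X F k = Some s & state_match k s h e
   else (size (p_ans h) < k)%N /\ pmwg_run eps 0 alpha u X F k = None].
Proof.
rewrite {}/h {}/e; elim: k => [|k [IHt IHs]].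
  split => //=; split => //; exists (pmwg_init R N) => //; split => //=.
  by apply/funext => i; rewrite tnth_mktuple.
have outk : pmwg_out k = (pmwg_step eps 0 alpha u X F k (pmwg_run eps 0 alpha u X F k)).1 by [].
have runk : pmwg_run eps 0 alpha u X F k.+1
  = (pmwg_step eps 0 alpha u X F k (pmwg_run eps 0 alpha u X F k)).2 by [].
pose v j := u (draw_seq (6 * k + j)).
have mk : mrun X u k.+1 = step eps alpha F X (mrun X u k)
  (v 1%N) (v 2%N) (v 3%N) (v 4%N) (v 5%N) (v 6%N) by [].
rewrite mk runk; clear mk runk.
move: IHt IHs outk; case: (mrun X u k) => h e IHt IHs.
rewrite [(h, e).1]/= [(h, e).2]/= in IHt IHs.
case h0 : (p_status h) => [|m]; rewrite h0 in IHs; last first.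
  have -> : step eps alpha F X (h, e) (v 1%N) (v 2%N) (v 3%N) (v 4%N) (v 5%N) (v 6%N)
    = (h, e) by rewrite /step /= h0.
  case: IHs => sk ->; rewrite [pmwg_step _ _ _ _ _ _ _ _]/= => outk /=; rewrite h0.
  split; last by split => //; exact: ltnW.
  move=> j; rewrite ltnS leq_eqVlt => /predU1P[->|]; last exact: IHt.
  by rewrite outk /pub_transcript ltnNge (ltnW sk)/= gtn_eqF.
case: IHs => sk [s rk sm]; have [sa _ _ _ _] := sm.
rewrite rk /pmwg_step sa; case ht : (qtime F (p_ans h)) => [t|]; last first.
  have -> : step eps alpha F X (h, e) (v 1%N) (v 2%N) (v 3%N) (v 4%N) (v 5%N) (v 6%N)
    = (end_pub h, e) by rewrite /step /= h0 ht.
  move=> outk; split; last by split => //; rewrite -[p_ans _]/(p_ans h) sk.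
  have trE j : pub_transcript (end_pub h) j
      = if (j < k)%N then Ans (nth 0 (p_ans h) j) else NoOutput.
    by rewrite /pub_transcript -[p_ans _]/(p_ans h) sk andbF.
  move=> j; rewrite ltnS leq_eqVlt [(_, _).1]/= trE => /predU1P[->|jk].
    by rewrite outk ltnn.
  by rewrite jk IHt// /pub_transcript sk jk.
have -> : step eps alpha F X (h, e) (v 1%N) (v 2%N) (v 3%N) (v 4%N) (v 5%N) (v 6%N)
    = step_at eps alpha F (histogram R X t) t h e
        (v 1%N) (v 2%N) (v 3%N) (v 4%N) (v 5%N) (v 6%N) by rewrite /step /= h0 ht.
have := pmwg_query_step (qtime_ge ht) sm; rewrite sa -!/(v _).
set q := step_at _ _ _ _ _ _ _ _ _ _ _ _ _; set p := pmwg_query _ _ _ _ _ _ _ _ _.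
move=> /= Hq outk; move: Hq.
case q0 : (p_status q.1) => [|m].
  move=> [a [s' [pE qa sm']]]; rewrite pE/= in outk *; split; last first.
    by rewrite qa size_rcons sk; split => //; exists s'.
  move=> j; rewrite ltnS leq_eqVlt => /predU1P[->|jk].
    by rewrite outk /pub_transcript qa size_rcons sk ltnSn nth_rcons sk ltnn eqxx.
  by rewrite IHt// /pub_transcript qa size_rcons sk jk ltnS (ltnW jk) nth_rcons sk jk.
move=> [pE qa q1]; rewrite pE/= in outk *; split; last by rewrite qa sk.
move=> j; rewrite ltnS leq_eqVlt => /predU1P[->|jk].
  by rewrite outk /pub_transcript qa sk ltnn eqxx q0 q1.
by rewrite IHt// /pub_transcript qa sk jk.
Qed.

Lemma pmwg_outE j k : (j < k)%N -> pmwg_out j = pub_transcript (mrun X u k).1 j.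
Proof. by have [h _] := mrun_bridge k; exact: h. Qed.

Lemma answers_mrun k : answers pmwg_out k = p_ans (mrun X u k).1.
Proof.
have [ht hs] := mrun_bridge k; set h := (mrun X u k).1 in ht hs *.
have sk : (size (p_ans h) <= k)%N.
  by move: hs; case: (p_status h) => [[->]|m [/ltnW]].
rewrite /answers (eq_in_pmap (f2 := fun j => if (j < size (p_ans h))%N
   then Some (nth 0 (p_ans h) j) else None)); last first.
  move=> j; rewrite mem_iota add0n => /ht ->.
  by rewrite /pub_transcript; case: ifP => //; case: ifP.
rewrite -(subnKC sk) iotaD pmap_cat add0n.
have tl m i : (size (p_ans h) <= i)%N -> pmap (fun j => if (j < size (p_ans h))%N
    then Some (nth 0 (p_ans h) j) else None) (iota i m) = [::].
  by elim: m i => //= m IH i ii; rewrite ltnNge ii/=; apply: IH; exact: leqW.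
rewrite (tl _ _ (leqnn _)) cats0.
rewrite (eq_in_pmap (f2 := fun j => Some (nth 0 (p_ans h) j))); last first.
  by move=> j; rewrite mem_iota add0n => /andP[_ ->].
rewrite -[RHS](mkseq_nth 0) /mkseq.
by elim: (iota 0 (size (p_ans h))) => //= j l ->.
Qed.

End fixed_run.

End bridge.

Lemma sigma_algebra_transcripts (R : realType) :
  sigma_algebra setT (@measurable_transcripts R).
Proof. exact: smallest_sigma_algebra. Qed.

(** * Events on transcripts *)

Section transcripts.
Context (R : realType) (N : nat).

Lemma measurable_transcripts_preimage (d : measure_display) (T : measurableType d)
    (f : T -> transcript R) :
  (forall k (B : set (output R)), measurable ([set a | B (Ans a)] : set R) ->
     measurable [set x | B (f x k)]) ->
  forall S, measurable_transcripts S -> measurable [set x | S (f x)].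
Proof.
move=> mf S mS.
have sub : [set C | exists k (B : set (output R)),
    measurable ([set a | B (Ans a)] : set R) /\ C = [set T | B (T k)]]
    `<=` [set S | measurable (f @^-1` S)].
  by move=> _ [k [B [mB ->]]]; exact: mf.
apply: (smallest_sub _ sub mS); split.
- by rewrite /= preimage_set0.
- by move=> A mA; rewrite /= setTD preimage_setC; exact: measurableC.
- by move=> A mA; rewrite /= preimage_bigcup; exact: bigcupT_measurable.
Qed.

Lemma measurable_pub_transcript S : measurable_transcripts S ->
  measurable [set h : public R N | S (pub_transcript h)].
Proof.
move: S; apply: measurable_transcripts_preimage => k B mB.
have mid : measurable_fun setT (fun h : public R N => h) by exact: measurable_id.
have ma := measurable_p_ans mid.
have ms : measurable_fun setT (fun h : public R N => size (p_ans h)).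
  exact: (measurableT_comp (@measurable_size R) ma).
have mst := measurable_p_status mid.
have mlt : measurable [set h : public R N | (k < size (p_ans h))%N].
  by have := ms measurableT [set i | (k < i)%N] I; rewrite setTI.
have mbot : measurable [set h : public R N | size (p_ans h) = k /\ p_status h = 1%N].
  apply: measurableI.
    by have := ms measurableT [set k] I; rewrite setTI.
  by have := mst measurableT [set 1%N] I; rewrite setTI.
have mcst (Q : Prop) : measurable [set h : public R N | Q].
  have [q|q] := pselect Q.
    by rewrite (_ : [set h | Q] = setT); [exact: measurableT|apply/seteqP; split].
  by rewrite (_ : [set h | Q] = set0); [exact: measurable0|apply/seteqP; split].
have mnth : measurable [set h : public R N | B (Ans (nth 0 (p_ans h) k))].
  have := measurableT_comp (@measurable_answer_nth R k) ma.
  by move=> /(_ measurableT _ mB); rewrite setTI.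
rewrite (_ : [set h | _] =
  ([set h : public R N | (k < size (p_ans h))%N] `&` [set h | B (Ans (nth 0 (p_ans h) k))])
  `|` ([set h : public R N | size (p_ans h) = k /\ p_status h = 1%N] `&` [set h | B Bot])
  `|` (~` ([set h : public R N | (k < size (p_ans h))%N] `|`
     [set h : public R N | size (p_ans h) = k /\ p_status h = 1%N]) `&` [set h | B NoOutput])).
  apply: measurableU; [apply: measurableU; exact: measurableI|].
  by apply: measurableI => //; apply: measurableC; exact: measurableU.
apply/seteqP; split => h; rewrite /= /pub_transcript.
- case: ifPn => [ks|ks Bh]; first by left; left.
  move: Bh; case: ifPn => [/andP[/eqP sk /eqP s1]|nb] Bh; first by left; right.
  right; split => //; case => //.
  by move=> [sk s1]; rewrite sk s1 !eqxx in nb.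
- case; first case.
  + by move=> [-> Bh].
  + by move=> [[-> ->]]; rewrite ltnn !eqxx.
  move=> [nn Bn]; case: ifPn => [ks|ks]; first by case: nn; left.
  by case: ifPn => // /andP[/eqP sk /eqP s1]; case: nn; right.
Qed.

Definition depends_on_prefix (K : nat) (S : set (transcript R)) :=
  forall T T' : transcript R, (forall j, (j < K)%N -> T j = T' j) -> S T -> S T'.

Definition prefix_sets : set (set (transcript R)) :=
  [set S | measurable_transcripts S /\ exists K, depends_on_prefix K S].

Let mtU A B : @measurable_transcripts R A -> measurable_transcripts B ->
  measurable_transcripts (A `|` B).
Proof.
move=> mA mB; have [h0 hC hU] := sigma_algebra_transcripts R.
rewrite -bigcup2E; apply: hU => -[|[|k]]//=.
Qed.

Let mtC A : @measurable_transcripts R A -> measurable_transcripts (~` A).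
Proof. by move=> mA; have [h0 hC hU] := sigma_algebra_transcripts R; rewrite -setTD; exact: hC. Qed.

Lemma depends_on_prefixW K K' S : (K <= K')%N ->
  depends_on_prefix K S -> depends_on_prefix K' S.
Proof. by move=> KK dS T T' e; apply: dS => j jK; apply: e; exact: leq_trans KK. Qed.

Lemma prefix_sets_setring : setring prefix_sets.
Proof.
split.
- by split; [have [] := sigma_algebra_transcripts R|exists 0%N].
- move=> A B [mA [K dA]] [mB [K' dB]]; split; first exact: mtU.
  exists (maxn K K') => T T' e [AT|BT]; [left|right].
    exact: (depends_on_prefixW (leq_maxl K K') dA) e AT.
  exact: (depends_on_prefixW (leq_maxr K K') dB) e BT.
- move=> A B [mA [K dA]] [mB [K' dB]]; split.
    have -> : A `\` B = ~` (~` A `|` B) by rewrite setCU setCK setDE.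
    by apply: (mtC _); apply: (mtU _ _) => //; exact: mtC.
  exists (maxn K K') => T T' e [AT BT]; split.
    exact: (depends_on_prefixW (leq_maxl K K') dA) e AT.
  move=> BT'; apply: BT; apply: (depends_on_prefixW (leq_maxr K K') dB) BT'.
  by move=> j jK; rewrite e.
Qed.

(** The monotone class theorem is applied to a ring of sets. The whole space is itself a prefix
    event, so the sigma-ring generated by these events is closed under complements. *)
Lemma measurable_transcripts_sub_sr : @measurable_transcripts R `<=` <<sr prefix_sets >>.
Proof.
have [s0 sD sU] := smallest_sigma_ring prefix_sets.
apply: smallest_sub.
  split => // A mA; apply: sD => //; apply: sub_g_sigma_ring; split; last by exists 0%N.
  by rewrite -setC0; apply: mtC; have [] := sigma_algebra_transcripts R.
move=> _ [k [B [mB ->]]]; apply: sub_g_sigma_ring; split.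
  by apply: sub_sigma_algebra; exists k, B.
by exists k.+1 => T T' e /=; rewrite e.
Qed.

End transcripts.

(** * Privacy of the full transcript *)

Section privacy.
Context (R : realType) (N n : nat) (eps alpha : R)
  (d : measure_display) (Omega : measurableType d)
  (P : probability Omega R) (W : draw -> {RV P >-> R}).
Hypotheses (N3 : (3 <= N)%N) (n21 : (21 <= n)%N) (eps0 : 0 < eps) (alpha0 : 0 < alpha).
Hypothesis source : laplace_source W.
Local Notation mrun := (mrun eps alpha).
Let u (w : Omega) : draw -> R := fun i => W i w.
Let M : mechanism R N n Omega := pmwg eps 0 alpha W.

Let xi0 t (nt : (n <= t)%N) := pmwg_xi_gt0 N3 n21 eps0 alpha0 nt.

Lemma measurable_pmwg X F S : measurable_transcripts S ->
  measurable [set w | S (M X F w)].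
Proof.
move: S; apply: measurable_transcripts_preimage => k B mB.
rewrite (_ : [set w | _] = (fun w => (mrun F X (u w) k.+1).1) @^-1`
    [set h | B (pub_transcript h k)]); last first.
  apply/seteqP; split => w /=;
  by rewrite -(@pmwg_outE _ _ _ _ _ F xi0 X (u w) _ _ (ltnSn k)).
have mm := measurableT_comp measurable_fst (measurable_mrunT eps alpha F W X k.+1).
have := @measurable_pub_transcript R N [set T | B (T k)].
move=> /(_ _)/mm; rewrite setTI; apply => //.
by apply: sub_sigma_algebra; exists k, B.
Qed.

Lemma pmwg_private_prefix F X X' S : alpha <= 1 -> neighboring X X' ->
  prefix_sets S ->
  (P [set w | S (M X F w)] <= (expR eps)%:E * P [set w | S (M X' F w)])%E.
Proof.
move=> alpha1 XX' [mS [K dS]].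
have mSp := @measurable_pub_transcript R N S mS.
have n0 : (0 < n)%N by exact: leq_trans n21.
pose phi (s : public R N * R) : \bar R :=
  (\1_[set h : public R N | S (pub_transcript h)] s.1)%:E.
have mphi : measurable_fun setT phi.
  by apply/measurable_EFinP; apply: (measurableT_comp (measurable_indic mSp)); exact: measurable_fst.
have phi0 x : (0 <= phi x)%E by rewrite lee_fin.
have E Y w : [set w | S (M Y F w)] w <-> S (pub_transcript (mrun F Y (u w) K).1).
  have e j (jK : (j < K)%N) := @pmwg_outE _ _ _ _ _ F xi0 Y (u w) _ _ jK.
  by split; apply: dS => j jK; rewrite -?(e _ jK).
have PE Y : P [set w | S (M Y F w)] = (\int[P]_w phi (mrun F Y (u w) K))%E.
  rewrite -[X in P X]setIT -integral_indic//; last exact: measurable_pmwg.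
  apply: eq_integral => w _; congr EFin; rewrite !indicE; congr (nat_of_bool _)%:R.
  by apply/idP/idP; rewrite !inE => /E.
have mm := measurable_mrunT eps alpha F W X' K.
have := @mrun_privacy R N n eps alpha F d Omega P W source.1 source.2 X X' K phi
  n0 xi0 (ltW (pmwg_c_gt0 N3 n21 eps0 alpha0 n0)) XX' _ mphi phi0.
rewrite -PE; move=> /(_ (fun v j t => @mrun_c_ge R N n eps alpha F N3 n21 eps0 alpha0 X' v j t)) le1.
apply: (le_trans le1).
rewrite PE -ge0_integralZl//; last by exact: (measurableT_comp mphi mm).
apply: ge0_le_integral => //.
- by move=> w _; rewrite mule_ge0 ?lee_fin ?expR_ge0.
- apply: emeasurable_funM.
    apply/measurable_EFinP; apply: measurableT_comp => //.
    exact: (measurable_p_loss (measurableT_comp measurable_fst mm)).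
  apply/measurable_EFinP; apply: (measurableT_comp (measurable_indic mSp)).
  exact: (measurableT_comp measurable_fst mm).
- apply: emeasurable_funM; first exact: measurable_cst.
  exact: (measurableT_comp mphi mm).
(* The test function reads only the public state, so the shift of the hidden noise disappears and
   the loss alone remains to be bounded. *)
move=> w _; rewrite /phi /= lee_wpmul2r ?lee_fin// ler_expR.
exact: mrun_loss_le.
Qed.

Lemma pmwg_private : alpha <= 1 -> differentially_private P eps 0 M.
Proof.
move=> alpha1 F X X' XX' S mS; rewrite adde0.
pose G := [set S | measurable_transcripts S /\
  (P [set w | S (M X F w)] <= (expR eps)%:E * P [set w | S (M X' F w)])%E].
have mtU (A : nat -> set (transcript R)) : (forall i, G (A i)) ->
    measurable_transcripts (\bigcup_i A i).
  by have [_ _ hU] := sigma_algebra_transcripts R => GA; apply: hU => i; case: (GA i).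
have mtI (A : nat -> set (transcript R)) : (forall i, G (A i)) ->
    measurable_transcripts (\bigcap_i A i).
  have [_ hC hU] := sigma_algebra_transcripts R => GA.
  rewrite -[\bigcap_i _]setCK setC_bigcap -setTD; apply: (hC _); apply: (hU _) => i.
  by rewrite -setTD; apply: (hC _); case: (GA i).
suff sub : <<sr @prefix_sets R >> `<=` G.
  by have [] := sub S (measurable_transcripts_sub_sr mS).
have mpre Y (A : nat -> set (transcript R)) : (forall i, G (A i)) ->
    forall i, measurable [set w | A i (M Y F w)].
  by move=> GA i; apply: measurable_pmwg; case: (GA i).
apply: monotone_setring_sub_g_sigma_ring; last 2 first.
- exact: prefix_sets_setring.
- by move=> A pA; split; [case: pA|exact: pmwg_private_prefix].
split => A mono GA; (split; first by [exact: mtU|exact: mtI]).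
- have cvA Y : P [set w | A i (M Y F w)] @[i --> \oo] -->
      P [set w | (\bigcup_i A i) (M Y F w)].
    have mA := mpre Y _ GA.
    apply: (@nondecreasing_cvg_mu _ _ _ P (fun i => [set w | A i (M Y F w)])) => //.
      exact: bigcupT_measurable.
    by move=> i j ij; apply/subsetPset => w /=; have /subsetPset := mono _ _ ij; exact.
  apply: (lee_cvg_to (cvA X) (cvgeZl _ (cvA X'))) => //.
  by near=> i; case: (GA i).
- have cvA Y : P [set w | A i (M Y F w)] @[i --> \oo] -->
      P [set w | (\bigcap_i A i) (M Y F w)].
    have mA := mpre Y _ GA.
    apply: (@nonincreasing_cvg_mu _ _ _ P (fun i => [set w | A i (M Y F w)])) => //.
    - by rewrite (le_lt_trans (probability_le1 _ (mA 0%N))) ?ltry.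
    - exact: bigcapT_measurable.
    by move=> i j ij; apply/subsetPset => w /=; have /subsetPset := mono _ _ ij; exact.
  apply: (lee_cvg_to (cvA X) (cvgeZl _ (cvA X'))) => //.
  by near=> i; case: (GA i).
Unshelve. all: by end_near.
Qed.

End privacy.

(** * Relative entropy *)

Section potential.
Context (R : realType) (N : nat).

Lemma ln_ge_1BV (z : R) : 0 < z -> 1 - z^-1 <= ln z.
Proof.
move=> z0; have z1 : 0 < z^-1 by rewrite invr_gt0.
have := @le_ln1Dx R (z^-1 - 1); rewrite subrKC lnV ?posrE// => h.
by have := h _; move=> /(_ ltac:(lra)); lra.
Qed.

Lemma expRN_le (v : R) : 0 <= v -> expR (- v) <= 1 - v + v ^+ 2.
Proof.
move=> v0; rewrite expRN; have v1 : 0 < 1 + v by lra.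
apply: (@le_trans _ _ (1 + v)^-1).
  by rewrite lef_pV2 ?posrE ?expR_gt0// expR_ge1Dx.
rewrite -[_^-1]mul1r ler_pdivrMr//.
have : 0 <= v ^+ 3 by rewrite exprn_ge0.
have -> : (1 - v + v ^+ 2) * (1 + v) = 1 + v ^+ 3 by ring.
lra.
Qed.

(* With Y = t y, this is t times the relative entropy of the histogram c / t
   with respect to y; keeping Y unnormalized makes the passage from time t to
   time t + 1 the mere addition of 1 / N to every weight. *)
Definition klpot (c : 'I_N -> nat) (Y : 'I_N -> R) : R :=
  \sum_i (c i)%:R * ln ((c i)%:R / Y i).

Lemma klpot_ge0 c Y : (forall i, 0 < Y i) -> \sum_i Y i = (\sum_i c i)%:R ->
  0 <= klpot c Y.
Proof.
move=> Y0 YE; have : \sum_i ((c i)%:R - Y i) = 0.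
  by rewrite big_split/= sumrN YE natr_sum subrr.
move=> <-; apply: ler_sum => i _.
case: (posnP (c i)) => [->|c0]; first by rewrite mul0r sub0r oppr_le0 ltW.
have c0' : 0 < (c i)%:R :> R by rewrite ltr0n.
have := ler_wpM2l (ltW c0') (ln_ge_1BV (divr_gt0 c0' (Y0 i))).
by rewrite invf_div mulrBr mulr1 mulrCA divff ?gt_eqF// mulr1.
Qed.

(** The log-sum inequality for the pairs (c, Y) and (1, q): the bound [ln z >= 1 - 1/z] is applied
    to the quotient of c/Y, and of 1/q, by (c + 1)/(Y + q), and the error terms cancel. An empty
    count needs monotonicity only. *)
Lemma log_sum_succ (c : nat) (Y q : R) : 0 < Y -> 0 < q ->
  c.+1%:R * ln (c.+1%:R / (Y + q)) <= c%:R * ln (c%:R / Y) + ln q^-1.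
Proof.
move=> Y0 q0; have Yq : 0 < Y + q by lra.
case: c => [|m].
  rewrite mul0r add0r !mul1r ler_ln ?posrE ?invr_gt0// lef_pV2 ?posrE//; lra.
have c0 : 0 < m.+1%:R :> R by rewrite ltr0n.
rewrite -[m.+2%:R]natr1; set c : R := m.+1%:R in c0 *.
have c1 : 0 < c + 1 by lra.
have := ler_wpM2l (ltW c0) (ln_ge_1BV (divr_gt0 (divr_gt0 c0 Y0) (divr_gt0 c1 Yq))).
have qV : 0 < q^-1 by rewrite invr_gt0.
have := ln_ge_1BV (divr_gt0 qV (divr_gt0 c1 Yq)).
rewrite !ln_div ?posrE ?divr_gt0//.
have -> : (q^-1 / ((c + 1) / (Y + q)))^-1 = q * (c + 1) / (Y + q).
  by field; rewrite !gt_eqF.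
have -> : c * (1 - (c / Y / ((c + 1) / (Y + q)))^-1) = c - Y * (c + 1) / (Y + q).
  by field; rewrite !gt_eqF.
have : q * (c + 1) / (Y + q) + Y * (c + 1) / (Y + q) = c + 1.
  by field; rewrite gt_eqF.
lra.
Qed.

(** The new entry costs ln N by [log_sum_succ] with q = 1/N; the terms of all other types only
    decrease, as their weights grow. *)
Lemma klpot_grow (c c' : 'I_N -> nat) Y (i0 : 'I_N) : (forall i, 0 < Y i) ->
  (forall j, c' j = (c j + (j == i0))%N) ->
  klpot c' (fun i => Y i + N%:R^-1) <= klpot c Y + ln N%:R.
Proof.
move=> Y0 c'E.
have N0 : 0 < N%:R^-1 :> R by rewrite invr_gt0 ltr0n (leq_ltn_trans _ (ltn_ord i0)).
rewrite /klpot (bigD1 i0)//= [X in _ <= X + _](bigD1 i0)//=.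
have le1 : (c' i0)%:R * ln ((c' i0)%:R / (Y i0 + N%:R^-1))
    <= (c i0)%:R * ln ((c i0)%:R / Y i0) + ln N%:R.
  by have := log_sum_succ (c i0) (Y0 i0) N0; rewrite invrK c'E eqxx addn1.
suff le2 : \sum_(i < N | i != i0) (c' i)%:R * ln ((c' i)%:R / (Y i + N%:R^-1))
    <= \sum_(i < N | i != i0) (c i)%:R * ln ((c i)%:R / Y i) by lra.
apply: ler_sum => i ii0; rewrite c'E (negbTE ii0) addn0.
case: (posnP (c i)) => [->|ci]; first by rewrite !mul0r.
have ci' : 0 < (c i)%:R :> R by rewrite ltr0n.
have Yi : 0 < Y i + N%:R^-1 by have := Y0 i; lra.
rewrite ler_pM2l// ler_ln ?posrE ?divr_gt0// ler_pM2l// lef_pV2 ?posrE//; lra.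
Qed.

Section mw.
Variables (alpha : R) (r y : 'I_N -> R).
Hypotheses (alpha0 : 0 < alpha) (r01 : forall i, 0 <= r i <= 1)
  (y0 : forall i, 0 < y i) (y1 : \sum_i y i = 1).
Let Z := \sum_j y j * expR (- (alpha * r j / 6)).

Let N0 : (0 < N)%N.
Proof. by case: N y y1 => // y' /eqP; rewrite big_ord0 eq_sym oner_eq0. Qed.

Let Z0 : 0 < Z.
Proof.
have : exists i : 'I_N, true by exists (Ordinal N0).
case=> i _; rewrite /Z (bigD1 i)//= ltr_pwDl ?mulr_gt0 ?expR_gt0//.
by apply: sumr_ge0 => j _; rewrite mulr_ge0 ?expR_ge0// ltW.
Qed.

Lemma mw_update_gt0 i : 0 < mw_update alpha r y i.
Proof. by rewrite divr_gt0 ?mulr_gt0 ?expR_gt0. Qed.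

Lemma mw_update_sum : \sum_i mw_update alpha r y i = 1.
Proof. by rewrite -mulr_suml divff// gt_eqF. Qed.

Lemma ln_mw_normalizer : ln Z <= - (alpha / 6 * eval r y) + (alpha / 6) ^+ 2.
Proof.
have le1 : Z <= 1 + (- (alpha / 6 * eval r y) + (alpha / 6) ^+ 2).
  have -> : 1 + (- (alpha / 6 * eval r y) + (alpha / 6) ^+ 2)
      = \sum_i (y i * (1 - alpha / 6 * r i + (alpha / 6) ^+ 2)).
    under eq_bigr do rewrite mulrDr mulrBr mulr1 [y _ * (_ * _)]mulrC -[_ * _ * y _]mulrA.
    by rewrite big_split/= big_split/= sumrN -mulr_sumr -mulr_suml y1 mul1r addrA.
  apply: ler_sum => i _; rewrite ler_pM2l//.
  have /andP[r0 r1] := r01 i.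
  have v0 : 0 <= alpha * r i / 6 by rewrite divr_ge0 ?mulr_ge0// ltW.
  apply: (le_trans (expRN_le v0)).
  have -> : alpha * r i / 6 = alpha / 6 * r i by ring.
  rewrite lerD2l exprMn -[leRHS]mulr1 ler_wpM2l ?sqr_ge0// expr_le1//.
have lt1 : -1 < Z - 1 by rewrite ltrBrDr addNr.
have := le_ln1Dx lt1; rewrite subrKC; clearbody Z; lra.
Qed.

(** With step size eta = alpha/6 the change of the potential is t (eta r(x) + ln Z), at most t (-
    eta gap + eta^2) by [ln_mw_normalizer]. A gap of at least 2 eta makes this at most - t eta^2,
    which explains the step size: half of the guaranteed error alpha/3. *)
Lemma klpot_mw c t : (0 < t)%N -> (\sum_i c i)%N = t ->
  2 * (alpha / 6) <= eval r y - eval r (fun i => (c i)%:R / t%:R) ->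
  klpot c (fun i => t%:R * mw_update alpha r y i) + t%:R * (alpha / 6) ^+ 2
    <= klpot c (fun i => t%:R * y i).
Proof.
move=> t0 ct gap; have t0' : 0 < t%:R :> R by rewrite ltr0n.
have -> : klpot c (fun i => t%:R * mw_update alpha r y i) =
    klpot c (fun i => t%:R * y i) + t%:R * (alpha / 6 * eval r (fun i => (c i)%:R / t%:R) + ln Z).
  have -> : t%:R * (alpha / 6 * eval r (fun i => (c i)%:R / t%:R) + ln Z)
      = \sum_i (c i)%:R * (alpha / 6 * r i + ln Z).
    under eq_bigr do rewrite mulrDr.
    rewrite big_split/= -mulr_suml -natr_sum ct mulrDr; congr (_ + _).
    rewrite /eval !mulr_sumr; apply: eq_bigr => i _; field; rewrite gt_eqF//.
  rewrite /klpot -big_split/=; apply: eq_bigr => i _.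
  case: (posnP (c i)) => [->|ci]; first by rewrite !mul0r addr0.
  have ci' : 0 < (c i)%:R :> R by rewrite ltr0n.
  rewrite -mulrDr; congr (_ * _).
  have lnd (v : R) : 0 < v -> ln ((c i)%:R / (t%:R * v)) = ln (c i)%:R - (ln t%:R + ln v).
    by move=> v0; rewrite ln_div ?posrE ?mulr_gt0// lnM.
  rewrite (lnd _ (y0 i)) (lnd _ (mw_update_gt0 i)) /mw_update -/Z.
  have -> : ln (y i * expR (- (alpha * r i / 6)) / Z) = ln (y i) - alpha * r i / 6 - ln Z.
    by rewrite ln_div ?posrE ?mulr_gt0 ?expR_gt0// lnM ?posrE ?expR_gt0// expRK.
  ring.
have h1 := ln_mw_normalizer.
have a6 : 0 < alpha / 6 by rewrite divr_gt0.
have h2 := ler_wpM2l (ltW a6) gap.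
rewrite -addrA -mulrDr gerDl mulr_ge0_le0 ?(ltW t0')//.
clearbody Z; rewrite expr2 in h1 *; lra.
Qed.

End mw.

End potential.

(** * The entropy argument along a run *)

Section accuracy_run.
Context (R : realType) (N n : nat) (eps alpha : R) (F : query_stream R N n)
  (X : db_stream N n).
Hypotheses (N0 : (0 < N)%N) (n0 : (0 < n)%N) (alpha0 : 0 < alpha).
Local Notation eta := (alpha / 6).

Definition entropy_budget (t : nat) : R :=
  ln N%:R + \sum_(n.+1 <= tau < t.+1) pmwg_b R N tau.
Local Notation Bs := entropy_budget.

Lemma entropy_budgetS t : (n <= t)%N -> Bs t.+1 = Bs t + pmwg_b R N t.+1.
Proof. by move=> nt; rewrite /Bs big_nat_recr//= addrA. Qed.

Let max_hardE t : pmwg_max_hard N n alpha t = Bs t / eta ^+ 2.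
Proof. by rewrite /pmwg_max_hard -/(Bs t); field; rewrite gt_eqF. Qed.

Lemma pmwg_b_ge t : (0 < t)%N -> ln N%:R / t.+1%:R <= pmwg_b R N t.+1.
Proof.
move=> t0; rewrite /pmwg_b -[t.+1%:R]natr1 addrK.
have t0' : 0 < t%:R :> R by rewrite ltr0n.
have lnt : 0 <= ln t%:R :> R by rewrite ln_ge0// ler1n.
have h : 0 <= ln ((t%:R + 1) / t%:R) :> R.
  by rewrite ln_ge0// ler_pdivlMr// mul1r lerDl.
rewrite -addrA lerDl addr_ge0// divr_ge0//; lra.
Qed.

Lemma pmwg_mixE (s t : nat) (y : 'I_N -> R) i : (0 < s)%N -> (s <= t)%N ->
  t%:R * pmwg_mix (Some s) t y i = s%:R * y i + (t - s)%:R / N%:R.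
Proof.
move=> s0 st; have t0 : t%:R != 0 :> R by rewrite pnatr_eq0 -lt0n (leq_trans s0).
rewrite /pmwg_mix; case: ltnP => ts.
  rewrite mulrDr; congr (_ + _); first by rewrite mulrA mulrCA divff// mulr1.
  by rewrite mulrA mulrCA divff// mulr1.
by rewrite (_ : s = t) ?subnn ?mul0r ?addr0//; apply/eqP; rewrite eqn_leq st.
Qed.

Lemma pmwg_mix_gt0 (l : option nat) t (y : 'I_N -> R) :
  (forall i, 0 < y i) -> forall i, 0 < pmwg_mix l t y i.
Proof.
move=> y0 i; case: l => [s|] //=; case: ltnP => // st.
have t0 : 0 < t%:R :> R by rewrite ltr0n (leq_ltn_trans _ st).
have q0 : 0 < (t - s)%:R / t%:R * N%:R^-1 :> R.
  by apply: divr_gt0; [apply: divr_gt0 => //; rewrite ltr0n subn_gt0|rewrite ltr0n].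
by rewrite ltr_wpDl// mulr_ge0 ?divr_ge0// ltW.
Qed.

Lemma pmwg_mix_sum (l : option nat) t (y : 'I_N -> R) :
  \sum_i y i = 1 -> \sum_i pmwg_mix l t y i = 1.
Proof.
move=> y1; case: l => [s|] //=; case: ltnP => // st.
have t0 : 0 < t%:R :> R by rewrite ltr0n (leq_ltn_trans _ st).
rewrite big_split/= -mulr_sumr y1 mulr1 sumr_const card_ord -[_ *+ N]mulr_natr natrB 1?ltnW//.
by field; rewrite !gt_eqF// ltr0n.
Qed.

Local Notation pot t y := (klpot (counts X t) (fun i => t%:R * y i) / t%:R).

Lemma pot_ge0 t (y : 'I_N -> R) : (n <= t)%N -> (forall i, 0 < y i) ->
  \sum_i y i = 1 -> 0 <= pot t y.
Proof.
move=> nt y0 y1; have t0 : 0 < t%:R :> R by rewrite ltr0n (leq_trans n0).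
rewrite divr_ge0 ?(ltW t0)// klpot_ge0//; first by move=> i; rewrite mulr_gt0.
by rewrite -mulr_sumr y1 mulr1 counts_size.
Qed.

(** In unnormalized weights, mixing from s to t adds 1/N once per time step ([pmwg_mixE]), so a jump
    over several times is the iteration of single steps, each of which is charged to its own b.
    Nonnegativity of the potential allows dividing it by t + 1 instead of t. *)
Lemma pot_forward (H : R) s t (y : 'I_N -> R) : (n <= s)%N -> (s <= t)%N ->
  (forall i, 0 < y i) -> \sum_i y i = 1 ->
  H + pot s y <= Bs s -> H + pot t (pmwg_mix (Some s) t y) <= Bs t.
Proof.
move=> ns st y0 y1 Hs; have s0 := leq_trans n0 ns.
elim: t st => [|t IH]; first by rewrite leqn0 => /eqP s00; rewrite s00 in s0.
rewrite leq_eqVlt => /predU1P[<-|]; first by rewrite /pmwg_mix ltnn.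
rewrite ltnS => st; have nt := leq_trans ns st; have {}IH := IH st.
have t0 : 0 < t%:R :> R by rewrite ltr0n (leq_trans n0).
have t10 : 0 < t.+1%:R :> R by rewrite ltr0n.
set yt := pmwg_mix (Some s) t y in IH.
have yt0 : forall i, 0 < yt i by exact: pmwg_mix_gt0.
have yt1 : \sum_i yt i = 1 by exact: pmwg_mix_sum.
have p0 := pot_ge0 nt yt0 yt1.
have YE : (fun i => t.+1%:R * pmwg_mix (Some s) t.+1 y i)
    = fun i => t%:R * yt i + N%:R^-1.
  apply/funext => i; rewrite !pmwg_mixE// 1?leqW// subSn// -natr1 mulrDl mul1r addrA.
  by [].
have [i0 ci0] := counts_grow X nt.
have := @klpot_grow R N (counts X t) (counts X t.+1) (fun i => t%:R * yt i) i0 _ ci0.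
rewrite -YE => /(_ (fun i => mulr_gt0 t0 (yt0 i))).
set K1 := klpot _ _; set K := klpot _ _ => le1.
have le2 : K1 / t.+1%:R <= K / t%:R + ln N%:R / t.+1%:R.
  apply: (@le_trans _ _ ((K + ln N%:R) / t.+1%:R)).
    by rewrite ler_pM2r// invr_gt0.
  have K0 : 0 <= K by move: p0; rewrite -/K pmulr_lge0 ?invr_gt0.
  by rewrite mulrDl lerD2r ler_wpM2l// lef_pV2 ?posrE// ler_nat.
have b1 := pmwg_b_ge (leq_trans n0 nt).
rewrite entropy_budgetS//; rewrite -/K in IH; clear p0 le1; move: le2 b1 IH.
move: (K1 / _) (K / _) (ln N%:R / _) (pmwg_b _ _ _) => p1 p q b; lra.
Qed.

Lemma pot_uniform t : (n <= t)%N -> pot t (fun=> N%:R^-1 : R) <= ln N%:R.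
Proof.
move=> nt; have t0 : 0 < t%:R :> R by rewrite ltr0n (leq_trans n0).
have N0' : 0 < N%:R :> R by rewrite ltr0n.
rewrite ler_pdivrMr// -[X in _ * X%:R](counts_size X nt) natr_sum mulr_sumr.
apply: ler_sum => i _; rewrite mulrC.
case: (posnP (counts X t i)) => [->|ci]; first by rewrite !mulr0.
have ci' : 0 < (counts X t i)%:R :> R by rewrite ltr0n.
rewrite ler_pM2r// ler_ln ?posrE ?divr_gt0 ?mulr_gt0 ?invr_gt0//.
rewrite invfM invrK mulrA -[leRHS]mul1r ler_pM2r// ler_pdivrMr// mul1r ler_nat.
by rewrite -[X in (_ <= X)%N](counts_size X nt) (bigD1 i)//= leq_addr.
Qed.

Lemma entropy_budget_ge t : (n <= t)%N -> ln N%:R <= Bs t.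
Proof.
elim: t => [|t IH] nt; first by rewrite /Bs big_geq ?addr0.
move: nt; rewrite leq_eqVlt => /predU1P[<-|]; first by rewrite /Bs big_geq ?addr0.
rewrite ltnS => nt; have {}IH := IH nt.
have b0 := pmwg_b_ge (leq_trans n0 nt).
have : 0 <= ln N%:R / t.+1%:R :> R by rewrite divr_ge0// ln_ge0// ler1n.
rewrite entropy_budgetS//; move: b0; move: (ln N%:R / _) (pmwg_b _ _ _) => q b; lra.
Qed.

(** The bound is required at every time not before the latest query, because the analyst chooses the
    time of the next one. *)
Definition potential_inv (h : public R N) :=
  [/\ forall i, 0 < tnth (p_y h) i, \sum_i tnth (p_y h) i = 1 &
   forall t, (n <= t)%N -> (forall s, time_decode (p_last h) = Some s -> (s <= t)%N) ->
     (p_hard h)%:R * eta ^+ 2 + pot t (cur_y t h) <= Bs t].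

Lemma potential_inv0 : potential_inv (pub0 N n eps alpha).
Proof.
have e : tnth (p_y (pub0 N n eps alpha)) = fun=> N%:R^-1.
  by apply/funext => i; rewrite tnth_mktuple.
split.
- by move=> i; rewrite e invr_gt0 ltr0n.
- by rewrite e sumr_const card_ord -[_ *+ N]mulr_natr mulVf// pnatr_eq0 -lt0n.
move=> t nt _; rewrite /cur_y/= e mul0r add0r.
by apply: (le_trans (pot_uniform nt)); exact: entropy_budget_ge.
Qed.

Section one_query.
Variables (h : public R N) (t : nat).
Hypotheses (ht : qtime F (p_ans h) = Some t) (hi : potential_inv h)
  (lt : forall s, time_decode (p_last h) = Some s -> (s <= t)%N).

Let nt : (n <= t)%N := qtime_ge ht.
Let t0 : (0 < t)%N := leq_trans n0 nt.
Let y0 i : 0 < cur_y t h i.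
Proof. by case: hi => h1 h2 h3; exact: pmwg_mix_gt0. Qed.
Let y1 : \sum_i cur_y t h i = 1.
Proof. by case: hi => h1 h2 h3; exact: pmwg_mix_sum. Qed.

Lemma potential_inv_easy : potential_inv (easy_pub F t h).
Proof.
have e : tnth (p_y (easy_pub F t h)) = cur_y t h.
  by apply/funext => i; rewrite tnth_mktuple.
split; [by rewrite e|by rewrite e|] => s ns /(_ t erefl) ts.
rewrite /cur_y e -[p_hard _]/(p_hard h) -[time_decode _]/(Some t).
by apply: pot_forward => //; case: hi => h1 h2 h3; exact: h3.
Qed.

Lemma potential_inv_hard a
    (r := if a < cur_fy F t h then cur_query F h else fun i => 1 - cur_query F h i) :
  2 * eta <= eval r (cur_y t h) - eval r (histogram R X t) ->
  [/\ p_status (hard_pub eps alpha F t h a) = 0%N,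
      p_ans (hard_pub eps alpha F t h a) = rcons (p_ans h) a,
      time_decode (p_last (hard_pub eps alpha F t h a)) = Some t &
      potential_inv (hard_pub eps alpha F t h a)].
Proof.
move=> gap.
have r01 i : 0 <= r i <= 1.
  have := qry_itv F (p_ans h) i; rewrite /r; case: ifP => _ //=.
  by rewrite /cur_query => /andP[q0 q1]; apply/andP; split; lra.
have kl := klpot_mw alpha0 r01 y0 y1 t0 (counts_size X nt) gap.
have t0' : 0 < t%:R :> R by rewrite ltr0n.
have ny0 := mw_update_gt0 alpha r y0 y1.
have ny1 := mw_update_sum alpha r y0 y1.
have drop : pot t (mw_update alpha r (cur_y t h)) + eta ^+ 2 <= pot t (cur_y t h).
  rewrite -[eta ^+ 2](mulfK (lt0r_neq0 t0')) [_ * t%:R]mulrC -mulrDl ler_pM2r// invr_gt0//.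
have p0 := pot_ge0 nt ny0 ny1.
have Ht : (p_hard h).+1%:R * eta ^+ 2 + pot t (mw_update alpha r (cur_y t h)) <= Bs t.
  case: hi => h1 h2 h3; have := h3 t nt lt.
  by rewrite -[(p_hard h).+1%:R]natr1 mulrDl mul1r; lra.
(* The potential after the update is still nonnegative, so [Ht] bounds the new hard-query count
   alone and the halting test fails. *)
have nb : (pmwg_max_hard N n alpha t < (p_hard h).+1%:R) = false.
  apply/negbTE; rewrite -leNgt max_hardE ler_pdivlMr ?exprn_gt0 ?divr_gt0//.
  by apply: le_trans Ht; rewrite lerDl.
rewrite /hard_pub nb; split => //.
set h' : public R N := (_, _, _, _).
have e : tnth (p_y h') = mw_update alpha r (cur_y t h).
  by apply/funext => i; rewrite tnth_mktuple.
split; [by rewrite e|by rewrite e|] => s ns /(_ t erefl) ts.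
rewrite /cur_y e -[p_hard h']/((p_hard h).+1) -[time_decode _]/(Some t).
exact: pot_forward.
Qed.

End one_query.

End accuracy_run.

Section accurate_run.
Context (R : realType) (N n : nat) (eps alpha : R) (F : query_stream R N n)
  (X : db_stream N n) (u : draw -> R) (lam : nat -> R).
Hypotheses (N0 : (0 < N)%N) (n0 : (0 < n)%N) (alpha0 : 0 < alpha).
Hypothesis xi0 : forall t, (n <= t)%N -> 0 < pmwg_xi N n eps 0 alpha t.
Local Notation xi t := (pmwg_xi N n eps 0 alpha t).
Hypothesis lam_mono : forall i j, (i <= j)%N -> lam i <= lam j.
Hypothesis good : forall j, `|u (draw_seq j)| <= lam j.
Hypothesis small : forall l t, qtime F l = Some t ->
  lam (6 * size l + 6) <= xi t * (alpha / 48).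

(** A run that is over has no further query to answer: halting with [Bot] is excluded. *)
Definition accuracy_inv (k : nat) (s : public R N * R) :=
  if p_status s.1 is 0%N then
    [/\ size (p_ans s.1) = k, `|s.2| <= 2 * lam (6 * k), potential_inv alpha X s.1 &
     forall s', time_decode (p_last s.1) = Some s' ->
     forall t, qtime F (p_ans s.1) = Some t -> (s' <= t)%N]
  else qtime F (p_ans s.1) = None.

Lemma evalB1 (f y : 'I_N -> R) : eval (fun i => 1 - f i) y = \sum_i y i - eval f y.
Proof.
rewrite /eval -sumrB; apply: eq_bigr => i _; by rewrite mulrBl mul1r.
Qed.

Lemma histogram_sum t : (n <= t)%N -> \sum_i histogram R X t i = 1.
Proof.
move=> nt; rewrite -mulr_suml -natr_sum counts_size// divff//.
by rewrite pnatr_eq0 -lt0n (leq_trans n0).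
Qed.

Lemma accuracy_step k h e (a z b a' z' b' : R) t (m := lam (6 * k + 6))
    (q := step_at eps alpha F (histogram R X t) t h e a z b a' z' b') :
  p_status h = 0%N -> qtime F (p_ans h) = Some t -> accuracy_inv k (h, e) ->
  `|a| <= m -> `|z| <= m -> `|b| <= m -> `|a'| <= m -> `|z'| <= m -> `|b'| <= m ->
  [/\ p_status q.1 = 0%N, accuracy_inv k.+1 q &
   exists2 c, p_ans q.1 = rcons (p_ans h) c &
     `|eval (qry F (p_ans h)) (histogram R X t) - c| <= alpha].
Proof.
move=> h0 ht; rewrite /accuracy_inv/= h0 => -[sk em hp hl] am zm bm a'm z'm b'm.
have nt := qtime_ge ht; have x0 := xi0 nt.
have mle : m <= xi t * (alpha / 48) by rewrite /m -sk; exact: small.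
have em' : `|e| <= 2 * m.
  by apply: (le_trans em); rewrite ler_pM2l// lam_mono// leq_addr.
have lt s : time_decode (p_last h) = Some s -> (s <= t)%N by move=> /hl; exact.
have y1 : \sum_i cur_y t h i = 1 by case: hp => ? ? _; exact: pmwg_mix_sum.
have x1 := histogram_sum nt.
pose g := cur_g F (histogram R X t) t h.
have gE : eval (qry F (p_ans h)) (histogram R X t) = cur_fy F t h + g.
  by rewrite /g /cur_g /cur_query addrC subrK.
have a0 := alpha0.
(* The noise in a comparison is at most 4m + 2m <= xi_t alpha/8. A call that fires thus certifies an
   error of at least (2/3 - 1/8) alpha = 13/24 alpha, more than alpha/3; silence certifies at most
   (2/3 + 1/8) alpha, less than alpha. *)
have cmp s (v w : R) : `|v| <= m -> `|w| <= 2 * m ->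
    xi t * (2 * alpha / 3 + s) + w <= 4 * v -> - s >= 13 / 24 * alpha.
  move=> /ler_normlP[v1 v2] /ler_normlP[w1 w2] le1.
  have : xi t * (2 * alpha / 3 + s) <= xi t * (alpha / 8) by lra.
  by rewrite ler_pM2l//; lra.
have cmpN s (v w : R) : `|v| <= m -> `|w| <= 2 * m ->
    4 * v < xi t * (2 * alpha / 3 + s) + w -> - s <= alpha.
  move=> /ler_normlP[v1 v2] /ler_normlP[w1 w2] le1.
  have : xi t * (- (alpha / 8)) <= xi t * (2 * alpha / 3 + s) by lra.
  by rewrite ler_pM2l//; lra.
(* The released answer is off by at most alpha/6 < 13/24 alpha, so it lies on the correct side of
   f(y) and the update goes in the right direction. *)
have noise v : `|v| <= m -> `|8 / xi t * v| <= alpha / 6.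
  move=> vm; rewrite mulrAC normrM normfV (gtr0_norm x0) ler_pdivrMr// normrM ger0_norm//.
  lra.
have fin (h' : public R N) (e' c : R) : p_status h' = 0%N ->
    p_ans h' = rcons (p_ans h) c -> time_decode (p_last h') = Some t ->
    potential_inv alpha X h' -> `|e'| <= 2 * m -> `|cur_fy F t h + g - c| <= alpha ->
    [/\ p_status h' = 0%N, if p_status h' is 0%N then
      [/\ size (p_ans h') = k.+1, `|e'| <= 2 * lam (6 * k.+1), potential_inv alpha X h' &
       forall s', time_decode (p_last h') = Some s' ->
       forall t, qtime F (p_ans h') = Some t -> (s' <= t)%N]
      else qtime F (p_ans h') = None &
      exists2 c, p_ans h' = rcons (p_ans h) c & `|cur_fy F t h + g - c| <= alpha].
  move=> h'0 h'a h'l h'p h'e h'c; split => //; last by exists c.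
  rewrite h'0; split => //; first by rewrite h'a size_rcons sk.
    by rewrite mulnS addnC.
  by move=> s'; rewrite h'l => -[<-] t'; rewrite h'a => /(qtime_rcons_ge ht).
have hardP (c e' : R) (r := if c < cur_fy F t h then cur_query F h
       else fun i => 1 - cur_query F h i) :
    2 * (alpha / 6) <= eval r (cur_y t h) - eval r (histogram R X t) ->
    `|e'| <= 2 * m -> `|cur_fy F t h + g - c| <= alpha ->
    [/\ p_status (hard_pub eps alpha F t h c) = 0%N,
      accuracy_inv k.+1 (hard_pub eps alpha F t h c, e') &
      exists2 c', p_ans (hard_pub eps alpha F t h c) = rcons (p_ans h) c' &
        `|cur_fy F t h + g - c'| <= alpha].
  move=> gap e'm cm.
  have [p1 p2 p3 p4] := potential_inv_hard eps N0 n0 alpha0 ht hp lt gap.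
  exact: (fin _ _ c).
have dbl v : `|v| <= m -> `|2 * v| <= 2 * m by move=> vm; rewrite normrM ger0_norm// ler_pM2l.
rewrite gE {}/q /step_at -/g; clearbody g.
case: leP => c1.
  have g1 : 13 / 24 * alpha <= g by rewrite -[g]opprK; apply: cmp c1.
  have /ler_normlP[n1 n2] := noise _ zm.
  apply: hardP.
  - have -> : (cur_fy F t h + (g + 8 / xi t * z) < cur_fy F t h) = false.
      by apply/negbTE; rewrite -leNgt lerDl; lra.
    rewrite !evalB1 x1 y1 -/(cur_fy F t h) /cur_query gE -/(cur_query F h) -/(cur_fy F t h); lra.
  - by case: ifP => _; exact: dbl.
  - by apply/ler_normlP; split; lra.
case: leP => c2.
  have g1 : 13 / 24 * alpha <= - g by apply: cmp c2.
  have /ler_normlP[n1 n2] := noise _ z'm.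
  apply: hardP.
  - have -> : cur_fy F t h - (- g + 8 / xi t * z') < cur_fy F t h by rewrite gtrDl; lra.
    rewrite -/(cur_fy F t h) /cur_query gE -/(cur_query F h) -/(cur_fy F t h); lra.
  - exact: dbl.
  - by apply/ler_normlP; split; lra.
have g1 : g <= alpha by rewrite -[g]opprK; apply: cmpN c1.
have g2 : - g <= alpha by apply: cmpN c2.
apply: (fin _ _ (cur_fy F t h)) => //; first exact: potential_inv_easy.
by apply/ler_normlP; split; lra.
Qed.

Lemma mrun_accuracy_inv k : accuracy_inv k (mrun eps alpha F X u k).
Proof.
elim: k => [|k IH].
  split => //=; first by rewrite normrM ger0_norm// ler_pM2l//; exact: (good 0).
  exact: potential_inv0.
have gj j : (j <= 6)%N -> `|u (draw_seq (6 * k + j))| <= lam (6 * k + 6).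
  by move=> j6; apply: (le_trans (good _)); apply: lam_mono; rewrite leq_add2l.
rewrite /= -/(mrun eps alpha F X u k).
case: (mrun eps alpha F X u k) IH => h e IH; rewrite /step/=.
case h0 : (p_status h) => [|i]; last by rewrite /accuracy_inv/= h0 in IH *.
case ht : (qtime F (p_ans h)) => [t|]; last exact: ht.
by have [] := accuracy_step h0 ht IH (gj 1%N isT) (gj 2%N isT) (gj 3%N isT) (gj 4%N isT)
  (gj 5%N isT) (gj 6%N isT).
Qed.

Lemma mrun_accurate k t (h := (mrun eps alpha F X u k).1)
    (h' := (mrun eps alpha F X u k.+1).1) : qtime F (p_ans h) = Some t ->
  size (p_ans h) = k /\ exists2 c, p_ans h' = rcons (p_ans h) c &
    `|eval (qry F (p_ans h)) (histogram R X t) - c| <= alpha.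
Proof.
have gj j : (j <= 6)%N -> `|u (draw_seq (6 * k + j))| <= lam (6 * k + 6).
  by move=> j6; apply: (le_trans (good _)); apply: lam_mono; rewrite leq_add2l.
have IH := mrun_accuracy_inv k.
rewrite {}/h' {}/h /= -/(mrun eps alpha F X u k).
case: (mrun eps alpha F X u k) IH => h e IH /=; rewrite /step/=.
case h0 : (p_status h) => [|i] ht; last by rewrite /accuracy_inv/= h0 ht in IH.
rewrite ht; have [_ _ hc] := accuracy_step h0 ht IH (gj 1%N isT) (gj 2%N isT) (gj 3%N isT)
  (gj 4%N isT) (gj 5%N isT) (gj 6%N isT).
by split => //; move: IH; rewrite /accuracy_inv/= h0 => -[].
Qed.

Lemma pmwg_all_accurate : all_accurate alpha X F (pmwg_out eps alpha F X u).
Proof.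
move=> k t; rewrite (answers_mrun F xi0) => ht.
have [sk [c hc cl]] := mrun_accurate ht.
exists c => //; rewrite (pmwg_outE F xi0 X u (ltnSn k)) /pub_transcript hc.
by rewrite size_rcons sk ltnSn nth_rcons sk ltnn eqxx.
Qed.

End accurate_run.

(** * Counting the queries that precede a given one *)

Section query_count.
Context (R : realType) (N n : nat) (F : query_stream R N n).

Lemma qtime_take (l : seq R) t j : qtime F l = Some t ->
  exists2 s, qtime F (take j l) = Some s & (s <= t)%N.
Proof.
elim/last_ind: l t => [|l a IH] t ht; first by exists t.
have [jl|jl] := leqP j (size l); last first.
  by exists t => //; rewrite take_oversize// size_rcons.
have [s hs st] := qtime_mono ht.
have [s' hs' ss'] := IH _ hs.
by exists s'; [rewrite -cats1 takel_cat|exact: leq_trans st].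
Qed.

Lemma count_le_ell (a : nat -> R) (k t : nat) :
  (\sum_(j < k) (qtime F (mkseq a j) == Some t) <= ell F a t)%N.
Proof.
rewrite /ell -(big_mkord xpredT (fun j => (qtime F (mkseq a j) == Some t) : nat)).
rewrite -big_mkcond/= sum1_count -size_filter; apply: uniq_leq_size.
  by rewrite filter_uniq// iota_uniq.
move=> j; rewrite mem_filter => /andP[/eqP hj _].
by rewrite in_fset_set ?inE//; exact: qtime_finite.
Qed.

(** Every prefix of [l], including [l] itself, poses a query at a time between [n] and [t]. As [ell]
    takes an infinite answer sequence, [l] is continued by zeros; this can only add queries to the
    count. *)
Lemma size_le_ell (l : seq R) t : qtime F l = Some t ->
  ((size l).+1 <= \sum_(n <= tau < t.+1) ell F (nth (0%R : R) l) tau)%N.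
Proof.
move=> ht.
have tk (j : 'I_(size l).+1) : mkseq (nth (0%R : R) l) j = take j l.
  have jl : (j <= size l)%N by rewrite -ltnS.
  apply: (@eq_from_nth _ 0); first by rewrite size_mkseq size_takel.
  by rewrite size_mkseq => i ij; rewrite nth_mkseq// nth_take.
apply: (@leq_trans (\sum_(n <= tau < t.+1) \sum_(j < (size l).+1)
    (qtime F (mkseq (nth (0%R : R) l) j) == Some tau))); last first.
  by apply: leq_sum => tau _; exact: count_le_ell.
rewrite exchange_big/= -[X in (X <= _)%N]card_ord -sum1_card; apply: leq_sum => j _.
have [s hs st] := qtime_take j ht.
have ns := qtime_ge hs.
by rewrite tk hs (bigD1_seq s) ?mem_index_iota ?ns ?ltnS ?iota_uniq//= eqxx.
Qed.

End query_count.

(** * The noise level *)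

Section tail_levels.
Context (R : realType) (beta : R).
Hypotheses (beta0 : 0 < beta) (beta1 : beta < 1).

(* The j-th draw exceeds this level in absolute value with probability at most
   beta / (2 (j+1)^2), and these probabilities sum to at most beta. *)
Definition tail_level (j : nat) : R := ln (2 * j.+1%:R ^+ 2 / beta).

Let arg_gt0 j : 0 < 2 * j.+1%:R ^+ 2 / beta.
Proof. by rewrite divr_gt0// mulr_gt0// exprn_gt0// ltr0n. Qed.

Lemma tail_level_mono i j : (i <= j)%N -> tail_level i <= tail_level j.
Proof.
move=> ij; rewrite /tail_level ler_ln ?posrE// ler_pM2r ?invr_gt0// ler_pM2l//.
by rewrite lerXn2r ?nnegrE ?ler0n// ler_nat.
Qed.

Lemma tail_level_ge0 j : 0 <= tail_level j.
Proof.
rewrite ln_ge0// ler_pdivlMr// mul1r.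
have : 1 <= j.+1%:R ^+ 2 :> R by rewrite exprn_ege1// ler1n.
by move: beta1 (_ ^+ 2) => b1 q; lra.
Qed.

Lemma expRN_tail_level j : expR (- tail_level j) = beta / 2 / j.+1%:R ^+ 2.
Proof.
rewrite expRN lnK ?posrE// invf_div invfM mulrA; congr (_ * _).
Qed.

Lemma sum_inv_sqr m : \sum_(j < m) (j.+1%:R ^+ 2)^-1 <= 2 :> R.
Proof.
case: m => [|m]; first by rewrite big_ord0.
suff : \sum_(j < m.+1) (j.+1%:R ^+ 2)^-1 <= 2 - m.+1%:R^-1 :> R.
  by have : 0 <= m.+1%:R^-1 :> R by []; move: (m.+1%:R^-1) => q; lra.
elim: m => [|m IH]; first by rewrite big_ord_recr big_ord0 /= expr1n invr1; lra.
rewrite big_ord_recr/= -[m.+2%:R]natr1.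
set x : R := m.+1%:R in IH *; have x0 : 0 < x by rewrite ltr0n.
have : ((x + 1) ^+ 2)^-1 <= x^-1 - (x + 1)^-1.
  have -> : x^-1 - (x + 1)^-1 = (x * (x + 1))^-1.
    by field; rewrite !gt_eqF//; lra.
  rewrite lef_pV2 ?posrE ?exprn_gt0 ?mulr_gt0//; [|lra|lra].
  by rewrite expr2 ler_pM2r; lra.
move: IH; move: (\sum_(_ < _) _) (x^-1) (((x + 1) ^+ 2)^-1) ((x + 1)^-1) => a b c d; lra.
Qed.

End tail_levels.

(** * Accuracy with probability 1 - beta *)

Section accuracy.
Context (R : realType) (N n : nat) (eps alpha : R)
  (d : measure_display) (Omega : measurableType d)
  (P : probability Omega R) (W : draw -> {RV P >-> R}).
Hypotheses (N3 : (3 <= N)%N) (n21 : (21 <= n)%N) (eps0 : 0 < eps) (alpha0 : 0 < alpha).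
Hypothesis source : laplace_source W.
Let u (w : Omega) : draw -> R := fun i => W i w.
Local Notation xi t := (pmwg_xi N n eps 0 alpha t).
Local Notation mrun := (mrun eps alpha).
Let M : mechanism R N n Omega := pmwg eps 0 alpha W.
Let xi0 t (nt : (n <= t)%N) : 0 < xi t := pmwg_xi_gt0 N3 n21 eps0 alpha0 nt.
Let n0 : (0 < n)%N. Proof. exact: leq_trans n21. Qed.
Let N0 : (0 < N)%N. Proof. exact: leq_trans N3. Qed.

Lemma measurable_all_accurate X F :
  measurable [set w | all_accurate alpha X F (M X F w)].
Proof.
pose h k w := (mrun F X (u w) k).1.
have mh k : measurable_fun setT (h k).
  exact: (measurableT_comp measurable_fst (measurable_mrunT eps alpha F W X k)).
pose A k t := [set w | qtime F (p_ans (h k w)) = Some t].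
pose B k t := [set w | (k < size (p_ans (h k.+1 w)))%N] `&`
  [set w | `|eval (qry F (p_ans (h k w))) (histogram R X t) - nth 0 (p_ans (h k.+1 w)) k| <= alpha].
have -> : [set w | all_accurate alpha X F (M X F w)]
    = \bigcap_k \bigcap_t (~` A k t `|` B k t).
  have key w k t : (exists2 a, M X F w k = Ans a &
      `|eval (qry F (p_ans (h k w))) (histogram R X t) - a| <= alpha) <-> B k t w.
    rewrite -[M X F w k]/(pmwg_out eps alpha F X (u w) k).
    rewrite (pmwg_outE F xi0 X (u w) (ltnSn k)) /pub_transcript /B /= -/(h k.+1 w).
    case: ifPn => ks; last by split => [[a]|[]//]; case: ifP.
    by split => [[a [<-]]|[]//]; last by exists (nth 0 (p_ans (h k.+1 w)) k).
  have ans w k : answers (M X F w) k = p_ans (h k w) := answers_mrun F xi0 X (u w) k.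
  apply/seteqP; split => w /=.
    move=> acc k _ t _; have [ht|] := pselect (qtime F (p_ans (h k w)) = Some t); last by left.
    by right; apply/key; rewrite -ans; apply: acc; rewrite ans.
  move=> acc k t; rewrite ans => ht; apply/key.
  by case: (acc k Logic.I t Logic.I).
apply: bigcapT_measurable => k; apply: bigcapT_measurable => t.
have mq := measurableT_comp (measurable_qtime F) (measurable_p_ans (mh k)).
have ma := measurable_p_ans (mh k.+1).
apply: measurableU.
  apply: measurableC; have := mq measurableT [set t.+1] Logic.I; rewrite setTI.
  congr measurable; apply/seteqP; split => w; rewrite /A /=; last by move=> ->.
  by case: (qtime F _) => //= s [->].
apply: measurableI.
  have := measurableT_comp (@measurable_size R) ma.
  by move=> /(_ measurableT [set i | (k < i)%N] Logic.I); rewrite setTI.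
have mev : measurable_fun setT (fun w => `|eval (qry F (p_ans (h k w))) (histogram R X t)
    - nth 0 (p_ans (h k.+1 w)) k|).
  apply: measurableT_comp => //; apply: measurable_funB; last first.
    exact: (measurableT_comp (@measurable_answer_nth R k) ma).
  apply: measurable_fun_eval => i; last exact: measurable_cst.
  exact: (measurable_cur_query F (mh k)).
have := measurable_fun_ler mev (measurable_cst alpha).
move=> /(_ measurableT [set true] Logic.I); rewrite setTI.
by congr measurable; apply/seteqP; split.
Qed.

Lemma good_draws_probability (beta : R) : 0 < beta -> beta < 1 ->
  let G := [set w | forall j, `|u w (draw_seq j)| <= tail_level beta j] in
  measurable G /\ ((1 - beta)%:E <= P G)%E.
Proof.
move=> beta0 beta1 G.
pose A j := [set w | tail_level beta j < `|u w (draw_seq j)|].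
have mV j : measurable [set v : R | tail_level beta j < `|v|].
  have := measurable_fun_ltr (measurable_cst (tail_level beta j))
    (measurableT_comp (@normr_measurable R setT) (@measurable_id _ R setT)).
  move=> /(_ measurableT [set true] Logic.I); rewrite setTI.
  by congr measurable; apply/seteqP; split.
have mA j : measurable (A j).
  have mW : measurable_fun setT (W (draw_seq j)) by exact: measurable_funP.
  by have := mW measurableT _ (mV j); rewrite setTI.
have GE : G = ~` \bigcup_j A j.
  apply/seteqP; split => w /=.
    by move=> gw [j _]; rewrite /A /= ltNge gw.
  by move=> nA j; rewrite leNgt; apply/negP => Aj; apply: nA; exists j.
have mU : measurable (\bigcup_j A j) by exact: bigcupT_measurable.
split; first by rewrite GE; exact: measurableC.
have PA j : (P (A j) <= (beta / 2 / j.+1%:R ^+ 2)%:E)%E.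
  rewrite -expRN_tail_level//.
  exact: (laplace_tail (source.2 (draw_seq j)) (tail_level_ge0 beta0 beta1 j)).
have PU : (P (\bigcup_j A j) <= beta%:E)%E.
  apply: (@le_trans _ _ (\sum_(0 <= j <oo) P (A j))%E).
    exact: measure_sigma_subadditive.
  apply: lime_le; first exact: is_cvg_nneseries.
  near=> m; apply: (@le_trans _ _ (\sum_(0 <= j < m) (beta / 2 / j.+1%:R ^+ 2)%:E)%E).
    exact: lee_sum.
  rewrite sumEFin lee_fin -mulr_sumr big_mkord.
  have b2 : 0 < beta / 2 by lra.
  have := ler_wpM2l (ltW b2) (sum_inv_sqr R m).
  move: (\sum_(_ < _) _) => q; lra.
have := probability_setC P mU; rewrite -GE => ->.
rewrite EFinB; exact: leeB.
Unshelve. all: by end_near.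
Qed.

Section noise_level.
Variables (C kappa beta : R) (F : query_stream R N n).
Hypotheses (C_ge3 : 3 <= C) (C_ge : 3 * (162 * 48) <= C) (kappa1 : 1 <= kappa)
  (beta0 : 0 < beta) (beta1 : beta < 1).
Local Notation L := (ln (N * n)%:R : R).
Local Notation Lam := (ln (kappa * n%:R / beta)).
Hypothesis alpha_ge : C * (L * Lam / (n%:R * eps)) `^ (1 / 3) <= alpha.
Let E (t : nat) : R := alpha ^+ 3 * eps * Num.sqrt (n * t)%:R / (C * L).
Hypothesis F_le : forall (a : nat -> R) (t : nat), (n <= t)%N ->
  (\sum_(n <= tau < t.+1) ell F a tau)%:R
    <= kappa * \sum_(n <= tau < t.+1) expR (E tau).

Let nR : 0 < n%:R :> R. Proof. by rewrite ltr0n. Qed.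
Let L0 : 0 < L. Proof. exact: ln_Nn_gt0 N3 n21. Qed.
Let C0 : 0 < C. Proof. by move: C_ge3; lra. Qed.
Let k0 : 0 < kappa. Proof. by move: kappa1; lra. Qed.

Lemma ln_kappaE : Lam = ln kappa + ln n%:R - ln beta.
Proof. by rewrite ln_div ?posrE ?mulr_gt0// lnM. Qed.

Lemma ln_beta_le0 : ln beta <= 0.
Proof. by rewrite ln_le0// ltW. Qed.

Lemma ln_kappa_ge : 3 <= Lam.
Proof.
rewrite ln_kappaE; have := ln_ge0 kappa1; have := ln_beta_le0; have := lnn_ge R n21.
lra.
Qed.

Lemma exponentE t : E t = alpha ^+ 3 * eps * Num.sqrt n%:R / (C * L) * Num.sqrt t%:R.
Proof. by rewrite /E natrM sqrtrM ?ler0n//; ring. Qed.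

Lemma exponent_mono s t : (s <= t)%N -> E s <= E t.
Proof.
move=> st; rewrite !exponentE ler_wpM2l//; last by rewrite ler_sqrt// ler_nat.
by rewrite divr_ge0 ?mulr_ge0 ?sqrtr_ge0 ?exprn_ge0 ?(ltW alpha0) ?(ltW eps0) ?(ltW C0) ?(ltW L0).
Qed.

(** The assumption on [alpha] is cubed: C^3 from it and the 1/C in the exponent leave C^2, and the
    square root of n n is n. *)
Lemma exponent_ge : C ^+ 2 * Lam <= E n.
Proof.
have Lam3 := ln_kappa_ge.
pose x := L * Lam / (n%:R * eps).
have x0 : 0 <= x.
  by rewrite divr_ge0 ?mulr_ge0 ?(ltW L0) ?(ltW nR) ?(ltW eps0)//; lra.
have a3 : C ^+ 3 * x <= alpha ^+ 3.
  have -> : C ^+ 3 * x = (C * x `^ (1 / 3)) ^+ 3.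
    rewrite exprMn -[(x `^ _) ^+ 3]powR_mulrn ?powR_ge0// -powRrM.
    by rewrite (_ : 1 / 3 * 3%:R = 1) ?powRr1//; lra.
  by rewrite lerXn2r ?nnegrE ?mulr_ge0 ?powR_ge0 ?(ltW C0) ?(ltW alpha0).
rewrite /E natrM -expr2 sqrtr_sqr ger0_norm ?(ltW nR)//.
have -> : C ^+ 2 * Lam = C ^+ 3 * x * (eps * n%:R / (C * L)).
  by rewrite /x; field; rewrite !gt_eqF.
rewrite -[leRHS]mulrA -[X in _ <= X]mulrA [eps * (_ * _)]mulrA ler_wpM2r//.
by rewrite divr_ge0 ?mulr_ge0 ?(ltW eps0) ?(ltW nR) ?(ltW C0) ?(ltW L0).
Qed.

(** With r the square root of t/n, ln t <= ln n + 2 (r - 1), and [E t = E n * r] is at least 8 [Lam]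
    r. The level is at most 2 [E t] + 4 [Lam] + 4 (r - 1), where the last two terms are absorbed by
    one more [E t]. This makes it at most 3 [E t]. *)
Lemma noise_level_small l t : qtime F l = Some t ->
  tail_level beta (6 * size l + 6) <= xi t * (alpha / 48).
Proof.
move=> ht; have nt := qtime_ge ht; set k := size l.
have t0 : 0 < t%:R :> R by rewrite ltr0n (leq_trans n0).
have kle : k.+1%:R <= kappa * (t%:R * expR (E t)).
  apply: (@le_trans _ _ (\sum_(n <= tau < t.+1) ell F (nth (0%R : R) l) tau)%:R).
    by rewrite ler_nat; exact: size_le_ell.
  apply: (le_trans (F_le _ nt)); rewrite ler_pM2l//.
  apply: (@le_trans _ _ (\sum_(n <= tau < t.+1) expR (E t))).
    by apply: ler_sum_nat => tau /andP[_ tt]; rewrite ler_expR exponent_mono.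
  rewrite sumr_const_nat -[_ *+ _]mulr_natl ler_wpM2r ?expR_ge0// ler_nat.
  by rewrite leq_subLR addnC -addn1 leq_add2l.
have k10 : 0 < k.+1%:R :> R by rewrite ltr0n.
have lnk : ln k.+1%:R <= ln kappa + ln t%:R + E t.
  apply: (@le_trans _ _ (ln (kappa * (t%:R * expR (E t))))).
    by rewrite ler_ln ?posrE ?mulr_gt0 ?expR_gt0.
  by rewrite lnM ?posrE ?mulr_gt0 ?expR_gt0// lnM ?posrE ?expR_gt0// expRK addrA.
pose r : R := Num.sqrt t%:R / Num.sqrt n%:R.
have sn : 0 < Num.sqrt n%:R :> R by rewrite sqrtr_gt0.
have st : 0 < Num.sqrt t%:R :> R by rewrite sqrtr_gt0.
have r0 : 0 < r by rewrite divr_gt0.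
have r1 : 1 <= r by rewrite ler_pdivlMr// mul1r ler_sqrt ?(ltW t0)// ler_nat.
have Er : E t = E n * r by rewrite !exponentE /r; field; rewrite !gt_eqF.
have lnt : ln t%:R <= ln n%:R + 2 * (r - 1).
  have -> : t%:R = n%:R * r ^+ 2 :> R.
    by rewrite exprMn exprVn !sqr_sqrtr ?(ltW t0) ?(ltW nR)// mulrC divfK// gt_eqF.
  rewrite lnM ?posrE ?exprn_gt0// lnXn// lerD2l -[_ *+ 2]mulr_natl ler_pM2l//.
  have r1' : -1 < r - 1 by rewrite ltrBrDr addNr.
  by have := le_ln1Dx r1'; rewrite subrKC.
(* 98 = 2 * 7^2 arises from the bound 6k + 7 <= 7 (k + 1) inside the tail level of the last draw of
   step k. *)
have ln98 : ln (98 : R) <= 2 * ln n%:R.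
  rewrite mulr_natl -lnXn// ler_ln ?posrE ?exprn_gt0//.
  have n21' : 21 <= n%:R :> R by rewrite ler_nat.
  by apply: (@le_trans _ _ (21 ^+ 2)); [lra|rewrite lerXn2r ?nnegrE].
have lamle : tail_level beta (6 * k + 6) <= ln 98 + 2 * ln k.+1%:R - ln beta.
  have -> : ln 98 + 2 * ln k.+1%:R - ln beta = ln (98 * k.+1%:R ^+ 2 / beta).
    by rewrite ln_div ?posrE ?mulr_gt0 ?exprn_gt0// lnM ?posrE ?exprn_gt0// lnXn// mulr_natl.
  rewrite /tail_level ler_ln ?posrE ?divr_gt0 ?mulr_gt0 ?exprn_gt0 ?ltr0n//.
  rewrite ler_pM2r ?invr_gt0//.
  apply: (@le_trans _ _ (2 * (7 * k.+1%:R) ^+ 2)).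
    rewrite ler_pM2l// lerXn2r ?nnegrE ?mulr_ge0// -natrM ler_nat mulnS.
    by rewrite -addnS [(7 + _)%N]addnC leq_add2r leq_mul2r orbT.
  by rewrite exprMn mulrA ler_pM2r ?exprn_gt0//; lra.
have Een := exponent_ge; have Lam3 := ln_kappa_ge; have LE := ln_kappaE.
have lnb := ln_beta_le0; have lnkap := ln_ge0 kappa1; have lnn := lnn_ge R n21.
have C9 : 9 <= C ^+ 2 by rewrite (_ : 9 = 3 ^+ 2); [rewrite lerXn2r ?nnegrE ?(ltW C0)|lra].
have E9 : 9 * Lam <= E n.
  by apply: le_trans Een; rewrite ler_wpM2r//; move: Lam3; lra.
have En0 : 0 < E n by move: E9 Lam3; lra.
have rLam : 8 * Lam * r <= E t.
  by rewrite Er ler_pM2r//; move: E9 Lam3; lra.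
have Lamr : 4 * Lam + 4 * (r - 1) <= 8 * Lam * r.
  rewrite -subr_ge0 (_ : _ - _ = 4 * ((Lam - 1) * (r - 1) + Lam * r)); last by ring.
  have h1 : 0 <= (Lam - 1) * (r - 1).
    by rewrite mulr_ge0// subr_ge0//; move: Lam3; lra.
  have h2 : 0 <= Lam * r by rewrite mulr_ge0 ?(ltW r0)//; move: Lam3; lra.
  by rewrite mulr_ge0//; move: h1 h2; lra.
have le3 : tail_level beta (6 * k + 6) <= 3 * E t.
  move: lamle lnk lnt ln98 rLam Lamr LE lnb lnkap.
  move: (tail_level _ _) (ln 98) (ln k.+1%:R) (E t) (ln n%:R) (ln kappa) (ln beta) (ln t%:R).
  move: (Lam * r) Lam => a b c e f g h i j m.
  lra.
apply: (le_trans le3).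
have -> : xi t * (alpha / 48) = C / (162 * 48) * E t.
  rewrite pmwg_xiE exponentE /pmwg_K; field; rewrite !gt_eqF//; lra.
rewrite ler_wpM2r//; first by rewrite Er mulr_ge0 ?(ltW En0) ?(ltW r0).
by rewrite ler_pdivlMr; move: C_ge; lra.
Qed.

End noise_level.

Lemma pmwg_accurate (C kappa beta : R) (F : query_stream R N n) :
  3 <= C -> 3 * (162 * 48) <= C -> 1 <= kappa -> 0 < beta ->
  C * (ln (N * n)%:R * ln (kappa * n%:R / beta) / (n%:R * eps)) `^ (1 / 3) <= alpha ->
  (forall (a : nat -> R) (t : nat), (n <= t)%N ->
     (\sum_(n <= tau < t.+1) ell F a tau)%:R
       <= kappa * \sum_(n <= tau < t.+1)
            expR (alpha ^+ 3 * eps * Num.sqrt (n * tau)%:R / (C * ln (N * n)%:R))) ->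
  accurate P alpha beta M F.
Proof.
move=> C3 C_ge kappa1 beta0 alpha_ge F_le X.
have [beta1|beta1] := ltP beta 1; last first.
  by apply: (@le_trans _ _ 0%E); rewrite ?measure_ge0// lee_fin subr_le0.
have [mG] := good_draws_probability beta0 beta1; move/le_trans; apply.
apply: le_measure; rewrite ?inE//; first exact: measurable_all_accurate.
move=> w /= gw.
apply: (@pmwg_all_accurate R N n eps alpha F X (u w) (tail_level beta) N0 n0 alpha0 xi0
  (tail_level_mono beta0) gw).
exact: (noise_level_small C3 C_ge kappa1 beta0 beta1 alpha_ge F_le).
Qed.

End accuracy.

Theorem theorem19 (R : realType) :
  exists2 C : R, 0 < C &
  forall (N n : nat) (eps alpha : R)
    (d : measure_display) (Omega : measurableType d) (P : probability Omega R)
    (W : draw -> {RV P >-> R}),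
  (3 <= N)%N -> (21 <= n)%N -> 0 < eps -> 0 < alpha ->
  laplace_source W ->
  (alpha <= 1 ->
     differentially_private P eps 0 (@pmwg R N n eps 0 alpha d Omega P W)) /\
  (forall (kappa beta : R) (F : query_stream R N n),
     1 <= kappa -> 0 < beta ->
     C * (ln (N * n)%:R * ln (kappa * n%:R / beta) / (n%:R * eps)) `^ (1 / 3)
       <= alpha ->
     (forall (a : nat -> R) (t : nat), (n <= t)%N ->
        (\sum_(n <= tau < t.+1) ell F a tau)%:R
          <= kappa * \sum_(n <= tau < t.+1)
               expR (alpha ^+ 3 * eps * Num.sqrt (n * tau)%:R
                     / (C * ln (N * n)%:R))) ->
     accurate P alpha beta (@pmwg R N n eps 0 alpha d Omega P W) F).
Proof.
(* 162 is the constant in xi_t, 48 the fraction of [alpha] allotted to a single draw, and 3 the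
   multiple of the exponent that bounds the draws. *)
exists (3 * (162 * 48)); first by lra.
move=> N n eps alpha d Omega P W N3 n21 eps0 alpha0 source; split.
  exact: pmwg_private.
by move=> kappa beta F; apply: pmwg_accurate => //; lra.
Qed.
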